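(* Consider the continuous time model $$v(t)=\int_0^{\infty}g(s)\,u(t-s)\,\mathrm{d}s,\qquad t\in\mathbb{R}_+,$$ where $u(t)$ is the (known) measured input. Let $y^N=[\,y(1)\,\ldots\,y(N)\,]^T$ be sampled noisy measurements (with sampling time $1$) $$y(k):=v(k)+e(k),\qquad k=1,\dots,N,$$ where $e(k)$, $k=1,\dots,N$, are i.i.d. zero mean Gaussian with variance $\sigma^2$, independent of $g(t)$. Assume that the prior distribution on $g(t)$ is (zero-mean) Gaussian with kernel $$K(t,s)=\mathbb{E}[g(t)g(s)]=e^{\alpha_0(t+s)}K_1(t-s),\qquad K_1(t-s)=\frac12\int_{-\infty}^{\infty}\phi_1(\omega)\cos(\omega(t-s))\,\mathrm{d}\omega,$$ with $\alpha_0<0$ and $\phi_1$ nonnegative and even. Then the posterior mean $\mathbb{E}[g(t)\mid y^N]$ of $g(t)$ given $y^N$ satisfies $$\mathbb{E}[g(t)\mid y^N]=\frac12 e^{\alpha_0 t}\int_{-\infty}^{\infty}\mathbb{E}[G_{\alpha_0}(\omega)\mid y^N]\,e^{j\omega t}\,\mathrm{d}\omega,$$ where $$\mathbb{E}[G_{\alpha_0}(\omega)\mid y^N]=\phi_1(\omega)\,U_{\alpha_0}(\omega)^*\,V_{\alpha_0}^{-1}\,y^N$$ is the posterior mean of $G_{\alpha_0}(\omega)$ (the process defined in the context), with $$V_{\alpha_0}=\int_{-\infty}^{\infty}\phi_1(\omega)\,U_{\alpha_0}(\omega)U_{\alpha_0}(\omega)^*\,\mathrm{d}\omega+\sigma^2I_N,$$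 $$U_{\alpha_0}(\omega)=\frac12\int_0^{\infty}e^{\alpha_0 s}\,u_s^N\,e^{j\omega s}\,\mathrm{d}s,\qquad u_s^N=[\,u(1-s)\,\ldots\,u(N-s)\,]^T.$$
   Context: Here $j$ is the imaginary unit, $\mathbb{R}_+$ is the set of nonnegative reals, $A^*$ is the conjugate transpose of $A$, $I_N$ is the $N\times N$ identity matrix, $\delta$ is the Dirac delta, and $|x|$, $\angle x$, $\overline{x}$ are the absolute value, phase and conjugate of $x\in\mathbb{C}$. The impulse response $g(t)$, $t\in\mathbb{R}_+$, is modeled as an infinite ''dense'' sum of decaying sinusoids, $$g(t)=\int_{-\infty}^{0}\int_{-\infty}^{\infty}|c(\alpha,\omega)|\,e^{\alpha t}\cos(\omega t+\angle c(\alpha,\omega))\,\mathrm{d}\omega\,\mathrm{d}\alpha,$$ where, for the kernel in the claim, the generalized Fourier transform $c$ has the form $c(\alpha,\omega)=c_1(\omega)\,\delta(\alpha-\alpha_0)$. Here $c_1(\omega)$ is a zero-mean complex Gaussian process such that $$\mathbb{E}[c_1(\omega)\overline{c_1(\omega')}]=\phi_1(\omega)\,\delta(\omega-\omega'),\qquad \mathbb{E}[c_1(\omega)c_1(\omega')]=0,$$ and $\phi_1(\omega)=\phi_1(-\omega)\ge 0$ denotes its power spectral density. The process $G_{\alpha_0}$ is defined by $$G_{\alpha_0}(\omega):=\frac{c_1(\omega)+\overline{c_1(-\omega)}}{2},$$ and $g$ is written in terms of it as $$g(t)=\frac12 e^{\alpha_0 t}\int_{-\infty}^{\infty}G_{\alpha_0}(\omega)\,e^{j\omega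 t}\,\mathrm{d}\omega,$$ so that $G_{\alpha_0}(\omega)$ is the Fourier transform of $\pi^{-1}e^{-\alpha_0 t}g(t)$: $$G_{\alpha_0}(\omega)=\int_0^{\infty}\pi^{-1}e^{-\alpha_0 t}g(t)\,e^{-j\omega t}\,\mathrm{d}t.$$
   Formalization: As displayed the constants are inconsistent with K_1; proved instead: E[g(t)|y^N] = e^{α0 t}∫E[G|y^N]e^{jωt}dω (no 1/2, likewise for g in terms of G) and V = 2∫φ1 UU^* dω + σ²I; for the formula for E[G|y^N], the noise e is independent of c_1, not only of g. *)

(* Defs.v *)
(* Probability and integration come from MathComp-Analysis; the complex
   numbers are R[i] (mathcomp-real-closed) over a realType R. *)
From HB Require Import structures.
From mathcomp Require Import all_boot all_order all_algebra.
From mathcomp Require Import complex.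
From mathcomp Require Import all_classical all_reals all_analysis.

Set Implicit Arguments.
Unset Strict Implicit.
Unset Printing Implicit Defensive.
Import Order.TTheory GRing.Theory Num.Theory.
Import numFieldNormedType.Exports.

Local Open Scope classical_set_scope.
Local Open Scope ring_scope.
Local Open Scope complex_scope.
Local Open Scope sesquilinear_scope.

Section ComplexIntegral.
Context d (T : measurableType d) (R : realType).
Variables (mu : {measure set T -> \bar R}) (D : set T).

Definition cmeasurable (f : T -> R[i]) : Prop :=
  measurable_fun D (fun x => complex.Re (f x)) /\
  measurable_fun D (fun x => complex.Im (f x)).

Definition cintegrable (f : T -> R[i]) : Prop :=
  mu.-integrable D (fun x => (complex.Re (f x))%:E) /\
  mu.-integrable D (fun x => (complex.Im (f x))%:E).

Definition cintegral (f : T -> R[i]) : R[i] :=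
  (\int[mu]_(x in D) complex.Re (f x)) +i* (\int[mu]_(x in D) complex.Im (f x)).

End ComplexIntegral.

Section RealLine.
Context (R : realType).

Notation mu := (@lebesgue_measure R).

(* e^(j x) *)
Definition cis (x : R) : R[i] := cos x +i* sin x.

(* K(t,s) = e^(alpha0 (t+s)) K_1(t-s) *)
Definition K1 (phi1 : R -> R) (tau : R) : R :=
  2^-1 * \int[mu]_x (phi1 x * cos (x * tau)).

Definition K (alpha0 : R) (phi1 : R -> R) (t s : R) : R :=
  expR (alpha0 * (t + s)) * K1 phi1 (t - s).

(* The sampling instants 1, ..., N are the (i.+1)%:R for i : 'I_N. *)
Definition shifted_input (N : nat) (u : R -> R) (s : R) : 'cV[R[i]]_N :=
  \col_(i < N) (u (i.+1%:R - s))%:C.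

Definition Ufreq (N : nat) (alpha0 : R) (u : R -> R) (x : R) : 'cV[R[i]]_N :=
  \col_(i < N) (2^-1 * cintegral mu `[0, +oo[
    (fun s => (expR (alpha0 * s))%:C * shifted_input N u s i 0 * cis (x * s))).

(* The factor 2 is forced by [K1]: for s-integrals over [0, +oo[,
   \int\int K(s,s') u_s^N (u_s'^N)^T = 2 \int phi1 U U^*. *)
Definition Vmat (N : nat) (alpha0 sigma : R) (phi1 u : R -> R) : 'M[R[i]]_N :=
  \matrix_(i, j) (2 * cintegral mu setT (fun x =>
     (phi1 x)%:C * (Ufreq N alpha0 u x *m (Ufreq N alpha0 u x) ^t*) i j))
  + ((sigma ^+ 2)%:C)%:M.

Definition Gpost (N : nat) (alpha0 sigma : R) (phi1 u : R -> R)
    (y : 'cV[R[i]]_N) (x : R) : R[i] :=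
  (phi1 x)%:C * ((Ufreq N alpha0 u x) ^t*
                 *m invmx (Vmat N alpha0 sigma phi1 u) *m y) 0 0.

(* Square-integrability against phi dx: the functions f for which the white
   noise integral \int f(x) c(x) dx below makes sense. *)
Definition test_fun (phi : R -> R) (f : R -> R[i]) : Prop :=
  cmeasurable setT f /\
  mu.-integrable setT
    (fun x => (phi x * (complex.Re (f x) ^+ 2 + complex.Im (f x) ^+ 2))%:E).

End RealLine.

Section Probability.
Context d (Omega : measurableType d) (R : realType).
Variable P : probability Omega R.

Notation mu := (@lebesgue_measure R).

(* X ~ N(0, s^2). The case split is needed because [normal_prob 0 0] is not
   the Dirac mass at 0. *)
Definition centered_gaussian (X : Omega -> R) (s : R) : Prop :=
  measurable_fun setT X /\
  forall B : set R, measurable B ->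
    P (X @^-1` B) = if s == 0 then \d_(0 : R) B else normal_prob 0 s B.

(* Zero-mean joint Gaussianity of the subfamily indexed by D. *)
Definition centered_gaussian_family (I : Type) (D : set I)
    (X : I -> Omega -> R) : Prop :=
  forall (n : nat) (i : 'I_n -> I) (a : 'I_n -> R),
    (forall k, D (i k)) ->
    exists s : R, centered_gaussian (fun w => \sum_(k < n) a k * X (i k) w) s.

Definition sigma_family (I : Type) (D : set I) (X : I -> Omega -> R) :
    set (set Omega) :=
  <<s [set A | exists i B, [/\ D i, measurable B & A = X i @^-1` B]] >>.

Definition independent_salgebras (F G : set (set Omega)) : Prop :=
  forall A B, F A -> G B -> P (A `&` B) = (P A * P B)%E.

Definition mutually_independent (N : nat) (X : 'I_N -> Omega -> R) : Prop :=
  forall (J : {set 'I_N}) (B : 'I_N -> set R), (forall i, measurable (B i)) ->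
    P (\bigcap_(i in [set i | i \in J]) (X i @^-1` B i)) =
    (\prod_(i in J) P (X i @^-1` B i))%E.

(* Z is a version of E[X | F]. *)
Definition is_cond_exp (F : set (set Omega)) (X Z : Omega -> R) : Prop :=
  [/\ P.-integrable setT (EFin \o X),
      P.-integrable setT (EFin \o Z),
      forall B : set R, measurable B -> F (Z @^-1` B) &
      forall A, F A -> \int[P]_(w in A) Z w = \int[P]_(w in A) X w].

Definition is_ccond_exp (F : set (set Omega)) (X Z : Omega -> R[i]) : Prop :=
  is_cond_exp F (fun w => complex.Re (X w)) (fun w => complex.Re (Z w)) /\
  is_cond_exp F (fun w => complex.Im (X w)) (fun w => complex.Im (Z w)).

(* A delta-correlated process has no point values; it is represented by its
   action c f = \int f(x) c(x) dx on test functions. *)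
Definition gen_process := (R -> R[i]) -> Omega -> R[i].

Definition re_im (c : gen_process) (p : (R -> R[i]) * bool) (w : Omega) : R :=
  if p.2 then complex.Re (c p.1 w) else complex.Im (c p.1 w).

(* c is zero-mean complex Gaussian with
     E[c(x) conj(c(x'))] = phi(x) delta(x - x'),  E[c(x) c(x')] = 0,
   i.e., integrated against f(x) conj(h(x')), resp. f(x) h(x'). *)
Definition complex_white_noise (phi : R -> R) (c : gen_process) : Prop :=
  [/\ forall f h (a b : R[i]), test_fun phi f -> test_fun phi h ->
        {ae P, forall w,
           c (fun x => a * f x + b * h x) w = a * c f w + b * c h w},
      centered_gaussian_family [set p | test_fun phi p.1] (re_im c),
      forall f h, test_fun phi f -> test_fun phi h ->
        cintegral P setT (fun w => c f w * (c h w)^*%R) =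
        cintegral mu setT (fun x => f x * (h x)^*%R * (phi x)%:C) &
      forall f h, test_fun phi f -> test_fun phi h ->
        cintegral P setT (fun w => c f w * c h w) = 0].

(* G(x) = (c(x) + conj(c(-x))) / 2, integrated against f; note that
   \int f(x) conj(c(-x)) dx = conj(\int conj(f(-x)) c(x) dx). *)
Definition Gproc (c : gen_process) : gen_process := fun f w =>
  (c f w + (c (fun x => (f (- x))^*%R) w)^*%R) / 2.

(* The function m is the conditional expectation of the generalized process
   G: E[\int f(x) G(x) dx | F] = \int f(x) m(x) dx for all test functions. *)
Definition is_gen_cond_exp (F : set (set Omega)) (phi : R -> R)
    (G : gen_process) (m : R -> Omega -> R[i]) : Prop :=
  forall f, test_fun phi f ->
    (forall w, cintegrable mu setT (fun x => f x * m x w)) /\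
    is_ccond_exp F (G f) (fun w => cintegral mu setT (fun x => f x * m x w)).

(* g(t) = \int |c1(x)| e^(alpha0 t) cos(x t + arg c1(x)) dx
        = e^(alpha0 t) Re (\int c1(x) e^(j x t) dx),
   the dense sum of decaying sinusoids once the Dirac mass at alpha0 has been
   integrated out. *)
Definition dense_sum (alpha0 : R) (c : gen_process) (g : R -> Omega -> R) :
    Prop :=
  forall t, 0 <= t ->
    {ae P, forall w, g t w =
       expR (alpha0 * t) * complex.Re (c (fun x => cis (x * t)) w)}.

Definition output (g : R -> Omega -> R) (u : R -> R) (t : R) (w : Omega) : R :=
  \int[mu]_(s in `[0, +oo[) (g s w * u (t - s)).

Definition meas (N : nat) (g : R -> Omega -> R) (u : R -> R)
    (e : 'I_N -> Omega -> R) (i : 'I_N) (w : Omega) : R :=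
  output g u i.+1%:R w + e i w.

End Probability.

(* Main.v *)
Require Import Defs.
From HB Require Import structures.
From mathcomp Require Import all_boot all_order all_algebra.
From mathcomp Require Import complex.
From mathcomp Require Import all_classical all_reals all_analysis.
From mathcomp Require Import measurable_realfun ring lra.

(** The computation takes place in the real Hilbert space of complex functions
with inner product Re \int phi1 F conj(F').  A centered Gaussian family is
represented there when each of its members X has a function F with
E[X X'] = 1/2 Re \int phi1 F conj(F').  For the impulse response this is the
prescribed kernel: g(t) is represented by e^(alpha0 t) e^(j x t).  For the
white noise c1, the variables Re (\int f c1) and Im (\int f c1) are represented
by f and -j f.

Integrating g against the shifted input integrates its representatives, so that
the noise-free output at time i is represented by 2 U_i.  Hence a variable X
with representative F satisfies
E[X y_i] = Re \int phi1 F conj(U_i) =: r_i, and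
E[y_i y_k] = 2 Re \int phi1 U_i conj(U_k) + sigma^2 [i = k] = V_ik: the
imaginary part of V vanishes because phi1 is even and U(-x) = conj(U(x)).  As
sigma > 0, V is positive definite, hence invertible ([gram_unit], [VmatE]).
Gaussian regression gives E[X | y] = r^T V^-1 y ([posterior_mean]), and since
the estimate is phi1 U^* V^-1 y, the number r^T V^-1 y is the real part of its
integral against F ([cintegral_Ghat]).

Both formulas are instances.  The posterior mean of g(t) is the case
F = e^(alpha0 t) e^(j x t).  For a test function f, \int f G is the half-sum of
\int f c1 and of the conjugate of \int f~ c1, where f~(x) = conj(f(-x)).  Its real
part is represented by (f + f~)/2, and its imaginary part by (-j f + j f~)/2, which
is likewise the average of -j f with its reflected conjugate.  Such an average has
the same pairing with U_i as the function itself, since phi1 is even and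
U(-x) = conj(U(x)) ([pairing_symmetrize]).

Joint laws are handled through characteristic functions with a phase,
E cos(Z + th) = cos th e^(-Q/2) for all th, which encodes a real Fourier
transform without complex-valued integrals.  Stein's identity gives it for a
Gaussian variable ([stein], [normal_cos]), independence multiplies the
exponentials ([cos_indep]), and the output, which is not a finite combination of
values of g, is reached as a limit in L^1 of such combinations along step
functions ([process_integral_L1], [output_char]).

For the regression itself, let E = X - r^T V^-1 y.  The quadratic form Q of the
pair (E, y) has no cross term, so that E sin(a E) cos(l.y + th) = 0; dividing by
a and letting a tend to 0, E is orthogonal to every cos(l.y + th)
([residual_trig_null]).  The bounded variables by which such an E can be multiplied
without losing this property form an algebra closed under bounded limits; it
contains the functions cos(l.y + th), hence the sign of y_k - z, hence the
indicator of every event of sigma(y) ([trig_null_integral_eq0]). *)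

Set Implicit Arguments.
Unset Strict Implicit.
Unset Printing Implicit Defensive.
Import Order.TTheory GRing.Theory Num.Theory.
Import numFieldNormedType.Exports.
Local Open Scope classical_set_scope.
Local Open Scope ring_scope.
Local Open Scope complex_scope.

(** * Real-valued integrals *)

Section RealIntegral.
Context d (T : measurableType d) (R : realType).
Variables (mu : {measure set T -> \bar R}) (D : set T).
Hypothesis mD : measurable D.
Implicit Types f g h : T -> R.

Lemma integrable_ext f g : (forall x, D x -> f x = g x) ->
  mu.-integrable D (EFin \o f) -> mu.-integrable D (EFin \o g).
Proof.
by move=> fg; apply: eq_integrable => // x /[!inE] Dx /=; rewrite fg.
Qed.

Lemma integrable_dom f g : measurable_fun D f ->
  (forall x, D x -> `|f x| <= g x) ->
  mu.-integrable D (EFin \o g) -> mu.-integrable D (EFin \o f).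
Proof.
move=> mf fg ig; apply: le_integrable ig => //; first exact/measurable_EFinP.
move=> x Dx /=; rewrite lee_fin (le_trans (fg x Dx))//.
exact: ler_norm.
Qed.

Lemma integrable_mulr_bounded f h (C : R) : mu.-integrable D (EFin \o f) ->
  measurable_fun D h -> (forall x, D x -> `|h x| <= C) ->
  mu.-integrable D (EFin \o (fun x => f x * h x)).
Proof.
move=> fi mh hC.
have mf : measurable_fun D f by apply/measurable_EFinP; exact: measurable_int fi.
apply: (@integrable_dom _ (fun x => `|f x| * C)).
- exact: measurable_funM.
- by move=> x Dx; rewrite normrM ler_wpM2l// hC.
- exact: (integrableZr mD C (integrable_norm fi)).
Qed.

Lemma Rintegral_sum (I : Type) (s : seq I) (F : I -> T -> R) :
  (forall i, mu.-integrable D (EFin \o F i)) ->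
  mu.-integrable D (EFin \o (fun x => \sum_(i <- s) F i x)) /\
  \int[mu]_(x in D) (\sum_(i <- s) F i x) = \sum_(i <- s) \int[mu]_(x in D) F i x.
Proof.
move=> Fi; elim: s => [|i s [IHi IHe]].
  split.
    apply: (@integrable_ext (cst 0)); last exact: integrable0.
    by move=> x _; rewrite big_nil.
  under eq_Rintegral do rewrite big_nil.
  by rewrite big_nil Rintegral_cst// mul0r.
split.
  apply: (@integrable_ext (fun x => F i x + \sum_(j <- s) F j x)).
    by move=> x _; rewrite big_cons.
  exact: (integrableD mD (Fi i) IHi).
rewrite big_cons -IHe -RintegralD//.
by apply: eq_Rintegral => x _; rewrite big_cons.
Qed.

Lemma Rintegral_dominated_cvg (F : nat -> T -> R) f g :
  (forall n, measurable_fun D (F n)) ->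
  (forall x, D x -> F n x @[n --> \oo] --> f x) ->
  mu.-integrable D (EFin \o g) ->
  (forall n x, D x -> `|F n x| <= g x) ->
  mu.-integrable D (EFin \o f) /\
  \int[mu]_(x in D) F n x @[n --> \oo] --> \int[mu]_(x in D) f x.
Proof.
move=> mF Ff ig Fg.
have mf : measurable_fun D f by exact: measurable_fun_cvg Ff.
have mEF n : measurable_fun D (EFin \o F n) by exact/measurable_EFinP.
have mEf : measurable_fun D (EFin \o f) by exact/measurable_EFinP.
have aeF : {ae mu, forall x, D x -> (EFin \o F n) x @[n --> \oo] --> (EFin \o f) x}.
  by apply: aeW => x Dx; apply: cvg_EFin; [exact: nearW|exact: Ff].
have aeg : {ae mu, forall x n, D x -> (`|(EFin \o F n) x| <= (EFin \o g) x)%E}.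
  by apply: aeW => x n Dx; rewrite lee_fin; exact: Fg.
have [fi _ cF] := dominated_convergence mD mEF mEf aeF ig aeg.
by split => //; apply: fine_cvg; rewrite fineK//; exact: integrable_fin_num.
Qed.

End RealIntegral.

Arguments integrable_ext {d T R mu D} mD f {g}.
Arguments integrable_dom {d T R mu D} mD {f} g.
Arguments integrable_mulr_bounded {d T R mu D} mD {f h} C.
Arguments Rintegral_sum {d T R mu D} mD {I} s {F}.
Arguments Rintegral_dominated_cvg {d T R mu D} mD {F f} g.

Lemma integrable_bounded d (T : measurableType d) (R : realType)
    (P : {finite_measure set T -> \bar R}) (f : T -> R) (C : R) :
  measurable_fun setT f -> (forall x, `|f x| <= C) ->
  P.-integrable setT (EFin \o f).
Proof.
move=> mf fC; apply: (integrable_dom measurableT (cst C)) => //.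
exact: finite_measure_integrable_cst.
Qed.

Lemma measurable_sum_cond d (T : measurableType d) (R : realType) (D : set T)
    (I : Type) (s : seq I) (Q : pred I) (h : I -> T -> R) :
  (forall i, Q i -> measurable_fun D (h i)) ->
  measurable_fun D (fun x => \sum_(i <- s | Q i) h i x).
Proof.
move=> mh.
rewrite (_ : (fun x => _) = fun x => \sum_(i <- s) (if Q i then h i x else 0)); last first.
  by apply/funext => x; rewrite -big_mkcond.
apply: measurable_sum => i; case Qi: (Q i); first exact: mh.
exact: measurable_cst.
Qed.

Lemma Rintegral_prob_cst d (T : measurableType d) (R : realType)
    (P : probability T R) (r : R) : \int[P]_w r = r.
Proof.
rewrite Rintegral_cst//.
have -> : fine (P setT) = 1 by rewrite probability_setT.
by rewrite mulr1.
Qed.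

Lemma cvg_sumr (R : realType) (I : Type) (s : seq I) (F : I -> nat -> R) (l : I -> R) :
  (forall i, F i n @[n --> \oo] --> l i) ->
  \sum_(i <- s) F i n @[n --> \oo] --> \sum_(i <- s) l i.
Proof.
move=> Fl; elim: s => [|i s IH].
  by under eq_fun do rewrite big_nil; rewrite big_nil; exact: cvg_cst.
by under eq_fun do rewrite big_cons; rewrite big_cons; exact: cvgD.
Qed.

(** * The centered Gaussian density *)

Section Gaussian.
Context (R : realType).
Notation mu := (@lebesgue_measure R).
Variable s : R.
Hypothesis s0 : s != 0.
Notation p := (normal_pdf 0 s).

Lemma normal_pdf0E x : p x = normal_peak s * expR (- (x ^+ 2 / (s ^+ 2 *+ 2))).
Proof.
by rewrite normal_pdfE// /normal_fun subr0 mulNr.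
Qed.

(** Doubling the standard deviation absorbs a quadratic factor: the quotient of
the two densities decays like e^(-3 x^2 / (8 s^2)), which beats 1 + x^2.
Functions of quadratic growth are thereby integrable against the density. *)
Lemma normal_pdf_moment2 : exists2 C : R, 0 <= C &
  forall x, (1 + x ^+ 2) * p x <= C * normal_pdf 0 (2 * s) x.
Proof.
have ss : 0 < s ^+ 2 by rewrite exprn_even_gt0.
have ps := normal_peak_gt0 s0.
have s20 : 2 * s != 0 by rewrite mulf_neq0// pnatr_eq0.
have ps2 := normal_peak_gt0 s20.
(* With y = 3 x^2 / (8 s^2) one has x^2 = (8 / 3) s^2 y and e^y >= 1 + y. *)
pose K := 1 + 8 / 3 * s ^+ 2.
have K0 : 0 < K by rewrite /K; nra.
exists (K * normal_peak s / normal_peak (2 * s)).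
  by rewrite divr_ge0 ?mulr_ge0 ?ltW.
move=> x; rewrite normal_pdf0E normal_pdfE// /normal_fun subr0.
rewrite (_ : expR (- (x ^+ 2 / (s ^+ 2 *+ 2))) =
  expR (- x ^+ 2 / ((2 * s) ^+ 2 *+ 2)) * expR (- (3 / 8 * x ^+ 2 / s ^+ 2))); last first.
  rewrite -expRD; congr expR.
  by field.
set E := expR (- x ^+ 2 / _); set E' := expR (- (_ / _)).
have E'b : (1 + x ^+ 2) * E' <= K.
  rewrite /E' expRN ler_pdivrMr ?expR_gt0//.
  have := expR_ge1Dx (3 / 8 * x ^+ 2 / s ^+ 2).
  set y := 3 / 8 * x ^+ 2 / s ^+ 2 => yb.
  have ys : y * s ^+ 2 = 3 / 8 * x ^+ 2 by rewrite /y divfK// gt_eqF.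
  have y0 : 0 <= y by rewrite /y; apply: divr_ge0; rewrite ?sqr_ge0// mulr_ge0 ?sqr_ge0// divr_ge0.
  apply: (@le_trans _ _ (K * (1 + y))); last exact: (ler_wpM2l (ltW K0)).
  have := mulr_ge0 (ltW ss) y0; rewrite /K; nra.
have E0 : 0 < E := expR_gt0 _.
rewrite [leRHS](_ : _ = normal_peak s * E * K); last first.
  by field; rewrite gt_eqF.
rewrite [leLHS](_ : _ = normal_peak s * E * ((1 + x ^+ 2) * E')); last by ring.
by apply: ler_wpM2l => //; rewrite ltW// mulr_gt0.
Qed.

Lemma integrable_normal_pdf_moment2 :
  mu.-integrable setT (EFin \o (fun x => (1 + x ^+ 2) * p x)).
Proof.
have [C C0 Cp] := normal_pdf_moment2.
apply: (integrable_dom (mu := mu) measurableT (fun x => C * normal_pdf 0 (2 * s) x)) => //.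
- apply: measurable_funM; last exact: measurable_normal_pdf.
  by apply: measurable_funD => //; exact: exprn_measurable.
- by move=> x _; rewrite ger0_norm ?Cp// mulr_ge0 ?normal_pdf_ge0// addr_ge0 ?sqr_ge0.
- exact: (integrableZl _ C (integrable_normal_pdf 0 (2 * s))).
Qed.

Lemma integrable_quadratic_normal (f : R -> R) (C : R) : measurable_fun setT f ->
  (forall x, `|f x| <= C * (1 + x ^+ 2)) ->
  mu.-integrable setT (EFin \o (fun x => f x * p x)).
Proof.
move=> mf fC.
apply: (integrable_dom (mu := mu) measurableT (fun x => C * ((1 + x ^+ 2) * p x))) => //.
- by apply: measurable_funM => //; exact: measurable_normal_pdf.
- move=> x _; rewrite normrM mulrA (ger0_norm (normal_pdf_ge0 _ _ _)).
  by rewrite ler_wpM2r// normal_pdf_ge0.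
- exact: (integrableZl _ C integrable_normal_pdf_moment2).
Qed.

Lemma is_derive_normal_pdf x : is_derive x (1 : R) p (- (x / s ^+ 2) * p x).
Proof.
have -> : p = fun x => normal_peak s * expR (- (s ^+ 2 *+ 2)^-1 * x ^+ 2).
  by apply/funext => y; rewrite normal_pdf0E mulNr (mulrC (y ^+ 2)).
apply: is_derive_eq; rewrite /GRing.scale /=.
by field.
Qed.

(** Stein's identity E[Z f(Z)] = s^2 E[f'(Z)].  As p' = - x p / s^2, the function
k = f' p - x f p / s^2 is the derivative of f p, which vanishes at infinity; so
the integral of k, the limit of its integrals over [-n, n], is 0. *)
Lemma stein (f f' : R -> R) (C : R) :
  (forall x, is_derive x (1 : R) f (f' x)) -> continuous f' ->
  (forall x, `|f x| <= C * (1 + `|x|)) -> (forall x, `|f' x| <= C) ->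
  \int[mu]_x (x * f x * p x) = s ^+ 2 * \int[mu]_x (f' x * p x).
Proof.
move=> df cf' fC f'C.
have C0 : 0 <= C by exact: le_trans (f'C 0).
have cf : continuous f.
  by move=> x; apply/differentiable_continuous/derivable1_diffP; exact: ex_derive.
have mf : measurable_fun setT f by exact: continuous_measurable_fun.
have mf' : measurable_fun setT f' by exact: continuous_measurable_fun.
have i1 : mu.-integrable setT (EFin \o (fun x => x * f x * p x)).
  apply: (@integrable_quadratic_normal _ (2 * C)); first exact: measurable_funM.
  move=> x; rewrite normrM.
  have := fC x; have := normr_ge0 x; have := normr_ge0 (f x).
  have : `|x| ^+ 2 = x ^+ 2 by rewrite real_normK ?num_real.
  move: (`|x|) (`|f x|) => a b <- b0 a0 ab.
  apply: (@le_trans _ _ (a * (C * (1 + a)))); first by rewrite ler_wpM2l.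
  have : 0 <= C * (1 - a) ^+ 2 by rewrite mulr_ge0 ?sqr_ge0.
  have : 0 <= C * a ^+ 2 by rewrite mulr_ge0 ?sqr_ge0.
  by nra.
have i2 : mu.-integrable setT (EFin \o (fun x => f' x * p x)).
  apply: (@integrable_quadratic_normal _ C) => // x.
  by apply: (le_trans (f'C x)); rewrite ler_peMr// lerDl sqr_ge0.
pose k x := f' x * p x - (x * f x * p x) / s ^+ 2.
have i3 : mu.-integrable setT (EFin \o (fun x => (x * f x * p x) / s ^+ 2)).
  exact: (integrableZr _ (s ^+ 2)^-1 i1).
have ik : mu.-integrable setT (EFin \o k) by exact: (integrableB _ i2 i3).
have dF x : is_derive x (1 : R) (fun x => f x * p x) (k x).
  have dfx := df x; have dpx := is_derive_normal_pdf x.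
  apply: is_derive_eq; rewrite /GRing.scale /= /k.
  by field.
have ck : continuous k.
  move=> x; apply: cvgB; [apply: cvgM; [exact: cf'|exact: continuous_normal_pdf]|].
  apply: cvgM; last exact: cvg_cst.
  apply: cvgM; last exact: continuous_normal_pdf.
  by apply: cvgM; [exact: cvg_id|exact: cf].
have cF : continuous (fun x => f x * p x).
  by move=> x; apply: cvgM; [exact: cf|exact: continuous_normal_pdf].
have FTC n : \int[mu]_x (k x * \1_(`[(- n.+1%:R), n.+1%:R]%classic : set R) x) =
    f n.+1%:R * p n.+1%:R - f (- n.+1%:R) * p (- n.+1%:R).
  have nn : - n.+1%:R < n.+1%:R :> R by rewrite gtrN ?ltr0n.
  have := @continuous_FTC2 R k (fun x => f x * p x) _ _ nn.
  rewrite /Rintegral => H.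
  have -> : (\int[mu]_x (k x * \1_(`[(- n.+1%:R), n.+1%:R]%classic : set R) x)%R%:E =
     \int[mu]_(x in `[(- n.+1%:R)%R, n.+1%:R%R]) (k x)%:E)%E.
    rewrite [RHS]integral_mkcond; apply: eq_integral => x _.
    by rewrite patchE indicE; case: ifP => _; rewrite ?mulr1 ?mulr0.
  rewrite H//.
  - exact: continuous_subspaceT.
  - split.
    + by move=> x _; exact: ex_derive.
    + by apply: cvg_at_right_filter; exact: cF.
    + by apply: cvg_at_left_filter; exact: cF.
  - by move=> x _; rewrite derive1E; exact: derive_val.
have lim0 : f n.+1%:R * p n.+1%:R - f (- n.+1%:R) * p (- n.+1%:R) @[n --> \oo] --> 0.
  have [D D0 Dp] := normal_pdf_moment2.
  have s20 : 2 * s != 0 by rewrite mulf_neq0// pnatr_eq0.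
  pose M := 2 * C * (D * normal_peak (2 * s)).
  have bd x : 0 < `|x| -> `|f x * p x| <= M / `|x|.
    move=> x0; rewrite ler_pdivlMr// normrM (ger0_norm (normal_pdf_ge0 _ _ _)).
    have := normal_pdf_ge0 0 s x; have := Dp x.
    have := ler_wpM2l D0 (normal_pdf_ub 0 x s20).
    set q := normal_pdf 0 (2 * s) x => Dq xq p0.
    have fp : `|f x| * p x * `|x| <= C * (1 + `|x|) * p x * `|x|.
      by rewrite ler_wpM2r// ler_wpM2r.
    apply: (le_trans fp).
    have h : C * (1 + `|x|) * p x * `|x| <= 2 * C * ((1 + x ^+ 2) * p x).
      rewrite (_ : x ^+ 2 = `|x| ^+ 2); last by rewrite real_normK ?num_real.
      have : 0 <= (C * p x) * ((1 - `|x|) ^+ 2 + `|x| ^+ 2 + 1 + `|x|).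
        by rewrite mulr_ge0// ?mulr_ge0// !addr_ge0// sqr_ge0.
      by nra.
    apply: (le_trans h); rewrite /M ler_wpM2l ?mulr_ge0//.
    exact: le_trans xq Dq.
  have bd2 x : 0 < x -> `|f x * p x - f (- x) * p (- x)| <= 2 * M / x.
    move=> x0; apply: (le_trans (ler_normB _ _)).
    have := bd x; have := bd (- x); rewrite normrN gtr0_norm// => /(_ x0) h1 /(_ x0) h2.
    by move: (lerD h2 h1) => /le_trans; apply; lra.
  apply/norm_cvg0P.
  apply: (@squeeze_cvgr _ _ _ _ (cst 0) (fun n : nat => 2 * M * n.+1%:R^-1)).
  - by apply: nearW => n; rewrite normr_ge0 /= bd2.
  - exact: cvg_cst.
  - rewrite -[X in _ --> X](mulr0 (2 * M)); apply: cvgM; first exact: cvg_cst.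
    exact: cvg_harmonic.
have [_ limk] : mu.-integrable setT (EFin \o k) /\
    \int[mu]_x (k x * \1_(`[(- n.+1%:R), n.+1%:R]%classic : set R) x) @[n --> \oo]
      --> \int[mu]_x k x.
  apply: (Rintegral_dominated_cvg (mu := mu) measurableT (fun x => `|k x|)) => //.
  - move=> n; apply: measurable_funM; first exact: continuous_measurable_fun.
    exact: measurable_indic.
  - move=> x _; apply: cvg_near_cst.
    near=> n; rewrite indicE mem_set ?mulr1//= in_itv/= -ler_norml.
    rewrite (@le_trans _ _ n%:R)// ?ler_nat//.
    by near: n; exact: nbhs_infty_ger.
  - exact: integrable_norm.
  - move=> n x _; rewrite normrM ler_piMr// indicE.
    by case: (_ \in _); rewrite ?normr1 ?normr0.
have : \int[mu]_x k x = 0.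
  apply: (cvg_unique _ limk) => //.
  by move: lim0; apply: cvg_trans; apply: near_eq_cvg; apply: nearW => n; rewrite FTC.
rewrite /k RintegralB// RintegralZr// => /eqP; rewrite subr_eq0 => /eqP ->.
by rewrite mulrC divfK// expf_neq0.
Unshelve. all: end_near. Qed.

End Gaussian.

(** * Characteristic functions of centered Gaussian variables *)

Section GaussianCos.
Context (R : realType).
Notation mu := (@lebesgue_measure R).
Variable s : R.
Hypothesis s0 : s != 0.
Notation p := (normal_pdf 0 s).

Lemma integrable_bounded_normal (f : R -> R) (C : R) : measurable_fun setT f ->
  (forall x, `|f x| <= C) -> mu.-integrable setT (EFin \o (fun x => f x * p x)).
Proof.
move=> mf fC; apply: (@integrable_quadratic_normal _ _ s0 _ C) => // x.
by apply: (le_trans (fC x)); rewrite ler_peMr ?lerDl ?sqr_ge0// (le_trans _ (fC 0)).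
Qed.

Lemma measurable_cos_affine (l th : R) : measurable_fun setT (fun x : R => cos (l * x + th)).
Proof.
apply: continuous_measurable_fun => x; apply: continuous_comp; last exact: continuous_cos.
by apply: cvgD; [apply: cvgM; [exact: cvg_cst|exact: cvg_id]|exact: cvg_cst].
Qed.

Lemma stein_cos (l th : R) :
  \int[mu]_x (x * sin (l * x + th) * p x) =
  s ^+ 2 * (l * \int[mu]_x (cos (l * x + th) * p x)).
Proof.
have d1 x : is_derive x (1 : R) (fun x => sin (l * x + th)) (l * cos (l * x + th)).
  by apply: is_derive_eq; rewrite /GRing.scale /=; ring.
have c1 : continuous (fun x => l * cos (l * x + th)).
  move=> x; apply: cvgM; first exact: cvg_cst.
  apply: continuous_comp; last exact: continuous_cos.
  by apply: cvgD; [apply: cvgM; [exact: cvg_cst|exact: cvg_id]|exact: cvg_cst].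
have b1 x : `|sin (l * x + th)| <= (1 + `|l|) * (1 + `|x|).
  apply: (le_trans (sin_max _)).
  have := normr_ge0 l; have := normr_ge0 x; nra.
have b2 x : `|l * cos (l * x + th)| <= 1 + `|l|.
  rewrite normrM.
  have := cos_max (l * x + th); have := normr_ge0 l; have := normr_ge0 (cos (l * x + th)).
  nra.
rewrite (stein s0 d1 c1 b1 b2); congr (_ * _); rewrite -RintegralZl//.
  by apply: eq_Rintegral => x _; rewrite mulrA.
apply: (@integrable_bounded_normal _ 1); first exact: measurable_cos_affine.
by move=> x; exact: cos_max.
Qed.

(** As a function of l, the left-hand side psi solves psi' = - s^2 l psi:
differentiate under the integral and apply Stein's identity.  Hence
psi(l) e^(s^2 l^2 / 2) is constant. *)
Lemma normal_cos (l th : R) :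
  \int[mu]_x (cos (l * x + th) * p x) = cos th * expR (- (s ^+ 2 * l ^+ 2 / 2)).
Proof.
pose f (l x : R) := cos (l * x + th) * p x.
pose psi l := \int[mu]_x f l x.
have df k x : is_derive k (1 : R) (f ^~ x) (- (x * sin (k * x + th)) * p x).
  by apply: is_derive_eq; rewrite /GRing.scale /=; ring.
have p1E k x : partial1of2 f k x = - (x * sin (k * x + th)) * p x.
  by rewrite partial1of2E; have := df k x => ?; exact: derive_val.
have dpsi k : is_derive k (1 : R) psi (- (s ^+ 2 * k * psi k)).
  have kI : `]k - 1, k + 1[%classic k by rewrite /= in_itv /=; lra.
  have If x : `]k - 1, k + 1[%classic x -> mu.-integrable setT (EFin \o f x).
    move=> _; apply: (@integrable_bounded_normal _ 1); first exact: measurable_cos_affine.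
    by move=> y; exact: cos_max.
  have Df x y : `]k - 1, k + 1[%classic x -> setT y -> derivable (f ^~ y) x 1.
    by move=> _ _; have := df x y => ?; exact: ex_derive.
  have G0 (y : R) : 0 <= (1 + y ^+ 2) * p y.
    by rewrite mulr_ge0 ?normal_pdf_ge0// addr_ge0 ?sqr_ge0.
  have Gub x y : `]k - 1, k + 1[%classic x -> setT y ->
      `|partial1of2 f x y| <= (1 + y ^+ 2) * p y.
    move=> _ _; rewrite p1E normrM (ger0_norm (normal_pdf_ge0 _ _ _)) ler_wpM2r ?normal_pdf_ge0//.
    rewrite normrN normrM.
    have := sin_max (x * y + th); have := normr_ge0 (sin (x * y + th)); have := normr_ge0 y.
    have : `|y| ^+ 2 = y ^+ 2 by rewrite real_normK ?num_real.
    by move: `|y| `|sin _| => a b <-; nra.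
  have IG := integrable_normal_pdf_moment2 s0.
  apply: DeriveDef; first exact: (derivable_under_integral measurableT kI If Df G0 IG Gub).
  rewrite -derive1E (differentiation_under_integral measurableT kI If Df G0 IG Gub).
  rewrite (_ : - _ = (-1) * (s ^+ 2 * (k * \int[mu]_x (cos (k * x + th) * p x)))); last first.
    by rewrite /psi /f; ring.
  rewrite -stein_cos -RintegralZl//.
    by apply: eq_Rintegral => x _; rewrite p1E; ring.
  apply: (@integrable_quadratic_normal _ _ s0 _ 1).
    apply: measurable_funM => //.
    under eq_fun do rewrite -cosBpihalf -addrA.
    exact: measurable_cos_affine.
  move=> x; rewrite normrM.
  have := sin_max (k * x + th); have := normr_ge0 (sin (k * x + th)); have := normr_ge0 x.
  have : `|x| ^+ 2 = x ^+ 2 by rewrite real_normK ?num_real.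
  by move: `|x| `|sin _| => a b <-; nra.
have dh (k : R) : is_derive k (1 : R) (fun k => psi k * expR (s ^+ 2 * k ^+ 2 / 2)) 0.
  have := dpsi k => ?.
  by apply: is_derive_eq; rewrite /GRing.scale /=; field.
have := is_derive_0_is_cst l 0 dh.
rewrite [psi 0](_ : _ = cos th).
  rewrite expr0n /= mulr0 mul0r expR0 mulr1 => <-.
  by rewrite -/(psi l) expRN mulfK// gt_eqF// expR_gt0.
rewrite /psi /f; under eq_Rintegral do rewrite mul0r add0r.
rewrite RintegralZl//; last exact: integrable_normal_pdf.
by rewrite /Rintegral integral_normal_pdf mulr1.
Qed.

Lemma normal_moment2 : \int[mu]_x (x ^+ 2 * p x) = s ^+ 2.
Proof.
transitivity (\int[mu]_x (x * x * p x)).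
  by apply: eq_Rintegral => x _; rewrite expr2.
have d1 (x : R) : is_derive x (1 : R) id (1 : R) by exact: is_derive_id.
have c1 : continuous (cst (1 : R) : R -> R) by move=> x; exact: cvg_cst.
have b1 (x : R) : `|id x| <= 1 * (1 + `|x|) by rewrite mul1r lerDr.
have b2 (x : R) : `|cst (1 : R) x| <= 1 by rewrite normr1.
rewrite (stein s0 d1 c1 b1 b2).
under eq_Rintegral do rewrite mul1r.
by rewrite /Rintegral integral_normal_pdf mulr1.
Qed.

End GaussianCos.

Section Law.
Context d (Omega : measurableType d) (R : realType) (P : probability Omega R).

Lemma integral_law (X : Omega -> R) (nu : {measure set (measurableTypeR R) -> \bar R})
    (f : R -> R) :
  measurable_fun setT X -> (forall B : set R, measurable B -> P (X @^-1` B) = nu B) ->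
  measurable_fun setT f -> nu.-integrable setT (EFin \o f) ->
  P.-integrable setT (EFin \o (f \o X)) /\
  \int[P]_w f (X w) = \int[nu]_x f x.
Proof.
move=> mX PX mf fi.
have mEf : measurable_fun setT (EFin \o f : measurableTypeR R -> \bar R) by exact/measurable_EFinP.
have i1 : P.-integrable setT (EFin \o (f \o X)).
  apply/integrableP; split; first by apply/measurable_EFinP; exact: measurableT_comp.
  move/integrableP : fi => [_]; apply: le_lt_trans.
  rewrite (eq_measure_integral (pushforward P (X : Omega -> measurableTypeR R))); last first.
    by move=> A mA _; rewrite -PX.
  rewrite ge0_integral_pushforward//.
  exact: measurableT_comp.
split => //; rewrite /Rintegral; congr fine.
rewrite [RHS](eq_measure_integral (pushforward P (X : Omega -> measurableTypeR R))); last first.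
  by move=> A mA _; rewrite -PX.
by rewrite integral_pushforward.
Qed.

Lemma ge0_integral_normal_prob (s : R) (f : R -> R) : measurable_fun setT f ->
  (forall x, 0 <= f x) ->
  (\int[normal_prob 0 s]_x (f x)%:E =
   \int[@lebesgue_measure R]_x (f x * normal_pdf 0 s x)%R%:E)%E.
Proof.
move=> mf f0; set mu := @lebesgue_measure R.
have dom := @normal_prob_dominates R 0 s.
have mEf : measurable_fun setT (EFin \o f : measurableTypeR R -> \bar R) by exact/measurable_EFinP.
pose h := Radon_Nikodym_SigmaFinite.f (normal_prob (0 : R) s) mu.
have hi : mu.-integrable setT h by exact: Radon_Nikodym_SigmaFinite.f_integrable.
have mh : measurable_fun setT h by exact: measurable_int hi.
have mp : measurable_fun setT (EFin \o normal_pdf 0 s : measurableTypeR R -> \bar R).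
  by apply/measurable_EFinP; exact: measurable_normal_pdf.
have hE : ae_eq mu setT h (EFin \o normal_pdf 0 s).
  apply: integral_ae_eq => //.
  by move=> E _ mE; rewrite -Radon_Nikodym_SigmaFinite.f_integral.
rewrite -(@Radon_Nikodym_SigmaFinite.change_of_variables _ _ _ _ mu dom (EFin \o f))//.
apply: ae_eq_integral => //.
- exact: emeasurable_funM.
- by apply/measurable_EFinP; apply: measurable_funM => //; exact: measurable_normal_pdf.
- have := @ae_eqe_mul2l _ _ _ mu setT h (EFin \o normal_pdf 0 s) (EFin \o f) hE.
  by apply: filterS => x /(_ I) /= e _; rewrite e EFinM.
Qed.

Lemma integral_normal_prob (s : R) (f : R -> R) : measurable_fun setT f ->
  (@lebesgue_measure R).-integrable setT (EFin \o (fun x => f x * normal_pdf 0 s x)) ->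
  (normal_prob 0 s).-integrable setT (EFin \o f) /\
  \int[normal_prob 0 s]_x f x =
  \int[@lebesgue_measure R]_x (f x * normal_pdf 0 s x).
Proof.
move=> mf /integrableP[mfp fi].
have mEf : measurable_fun setT (EFin \o f : measurableTypeR R -> \bar R) by exact/measurable_EFinP.
split.
  apply/integrableP; split => //.
  move: fi; apply: le_lt_trans.
  rewrite (@ge0_integral_normal_prob s (fun x => `|f x|)) //; last exact: measurableT_comp.
  rewrite le_eqVlt; apply/orP; left; apply/eqP.
  by apply: eq_integral => x _ /=; rewrite normrM (ger0_norm (normal_pdf_ge0 _ _ _)).
rewrite /Rintegral; congr fine; rewrite integralE [RHS]integralE.
have mpos : measurable_fun setT (fun x : R => Num.max (f x) 0) by exact: measurable_maxr.
have mneg : measurable_fun setT (fun x : R => Num.max (- f x) 0).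
  by apply: measurable_maxr => //; exact: measurableT_comp.
have pos0 (g : R -> R) x : 0 <= Num.max (g x) 0 by rewrite le_max lexx orbT.
have Ep (g : R -> R) x : ((fun x => (g x)%:E)^\+ x = (Num.max (g x) 0)%:E)%E.
  by rewrite funeposE EFin_max.
have En (g : R -> R) x : ((fun x => (g x)%:E)^\- x = (Num.max (- g x) 0)%:E)%E.
  by rewrite funenegE EFin_max EFinN.
congr (_ - _)%E.
- under eq_integral do rewrite Ep; rewrite (ge0_integral_normal_prob s mpos (pos0 _)).
  apply: eq_integral => x _; rewrite Ep maxr_pMl ?normal_pdf_ge0// mul0r//.
- under eq_integral do rewrite En; rewrite (ge0_integral_normal_prob s mneg (pos0 (-%R \o f))).
  apply: eq_integral => x _; rewrite En -mulNr maxr_pMl ?normal_pdf_ge0// mul0r//.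
Qed.

(** For s = 0 the law is a Dirac mass, which has no density. *)
Lemma gaussian_law (X : Omega -> R) (s : R) (f : R -> R) (C : R) :
  centered_gaussian P X s -> measurable_fun setT f ->
  (forall x, `|f x| <= C * (1 + x ^+ 2)) ->
  P.-integrable setT (EFin \o (f \o X)) /\
  \int[P]_w f (X w) = if s == 0 then f 0 else
     \int[@lebesgue_measure R]_x (f x * normal_pdf 0 s x).
Proof.
move=> [mX PX] mf fC; case: (eqVneq s 0) PX => [s0|s0] PX; last first.
  have [] := @integral_normal_prob s f mf.
    exact: (integrable_quadratic_normal s0 mf fC).
  by move=> i1 <-; apply: integral_law.
have mEf : measurable_fun setT (EFin \o f : measurableTypeR R -> \bar R) by exact/measurable_EFinP.
have [] := @integral_law X (dirac (0 : measurableTypeR R) : {measure set (measurableTypeR R) -> \bar R}) f mX PX mf.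
  apply/integrableP; split => //; rewrite integral_dirac//=.
    by rewrite diracE in_setT mul1e ltry.
  by apply/measurable_EFinP; exact: (measurableT_comp (@normr_measurable R setT) mf).
move=> ? ->; split => //; rewrite /Rintegral (integral_dirac (0 : measurableTypeR R) measurableT mEf).
by rewrite diracT mul1e.
Qed.

Lemma gaussian_cos (X : Omega -> R) (s l th : R) : centered_gaussian P X s ->
  \int[P]_w cos (l * X w + th) = cos th * expR (- (s ^+ 2 * l ^+ 2 / 2)).
Proof.
move=> gX; have [|x|_ ->] := @gaussian_law X s (fun x => cos (l * x + th)) 1 gX.
- exact: measurable_cos_affine.
- by rewrite mul1r (le_trans (cos_max _))// lerDl sqr_ge0.
have [->|s0] := eqVneq s 0; last exact: normal_cos.
by rewrite mulr0 add0r expr0n /= !mul0r oppr0 expR0 mulr1.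
Qed.

Lemma gaussian_moment2 (X : Omega -> R) (s : R) : centered_gaussian P X s ->
  P.-integrable setT (EFin \o (fun w => X w ^+ 2)) /\ \int[P]_w (X w ^+ 2) = s ^+ 2.
Proof.
move=> gX; have [|x|? ->] := @gaussian_law X s (fun x => x ^+ 2) 1 gX.
- exact: exprn_measurable.
- by rewrite mul1r ger0_norm ?sqr_ge0// lerDr.
by split => //; have [->|s0] := eqVneq s 0; rewrite ?normal_moment2.
Qed.

Lemma gaussian_integrable (X : Omega -> R) (s : R) : centered_gaussian P X s ->
  P.-integrable setT (EFin \o X).
Proof.
move=> gX; have [||//] := @gaussian_law X s id 1 gX.
- exact: measurable_id.
- move=> x; rewrite mul1r -(real_normK (num_real x)).
  by have := sqr_ge0 (`|x| - 1); nra.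
Qed.

End Law.

(** * Independence *)

Section SigmaFamily.
Context d (Omega : measurableType d) (R : realType).
Variables (I : Type) (D : set I) (X : I -> Omega -> R).

Lemma sigma_family_sub (S : set (set Omega)) : sigma_algebra setT S ->
  (forall i B, D i -> measurable B -> S (X i @^-1` B)) -> sigma_family D X `<=` S.
Proof.
by move=> sS XS; apply: smallest_sub => // _ [i [B [Di mB ->]]]; exact: XS.
Qed.

Lemma sigma_family_measurable : (forall i, D i -> measurable_fun setT (X i)) ->
  sigma_family D X `<=` measurable.
Proof.
move=> mX; apply: sigma_family_sub; first exact: sigma_algebra_measurable.
by move=> i B Di mB; rewrite -[_ @^-1` _]setTI; exact: mX.
Qed.

Lemma sigma_family_lincomb (J : Type) (l : seq J) (Q : pred J) (a : J -> R)
    (i : J -> I) (B : set R) :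
  (forall j, Q j -> D (i j)) -> measurable B ->
  sigma_family D X ((fun w => \sum_(j <- l | Q j) a j * X (i j) w) @^-1` B).
Proof.
move=> Di mB.
pose G := [set A | exists i B, [/\ D i, measurable B & A = X i @^-1` B]].
have mX j : Q j -> measurable_fun (setT : set (g_sigma_algebraType G)) (X (i j)).
  move=> Qj _ C mC; rewrite setTI; apply: sub_sigma_algebra.
  by exists (i j), C; split => //; exact: Di.
have : measurable_fun (setT : set (g_sigma_algebraType G))
    (fun w => \sum_(j <- l | Q j) a j * X (i j) w).
  by apply: measurable_sum_cond => j Qj; apply: measurable_funM => //; exact: mX.
by move=> /(_ measurableT B mB); rewrite setTI.
Qed.

End SigmaFamily.

Section Independence.
Context d (Omega : measurableType d) (R : realType) (P : probability Omega R).

(** The hypotheses say that a and b are the characteristic functions of S and T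
at 1, both real; for all phases at once, they determine E cos(S + T + th) by
integrating out T first, with S + th as its phase. *)
Lemma cos_indep (S T : Omega -> R) (a b : R) :
  measurable_fun setT S -> measurable_fun setT T ->
  (forall A B : set R, measurable A -> measurable B ->
     P (S @^-1` A `&` T @^-1` B) = (P (S @^-1` A) * P (T @^-1` B))%E) ->
  (forall th, \int[P]_w cos (S w + th) = cos th * a) ->
  (forall th, \int[P]_w cos (T w + th) = cos th * b) ->
  forall th, \int[P]_w cos (S w + T w + th) = cos th * (a * b).
Proof.
move=> mS mT ind Sa Tb th.
pose S' : {mfun Omega >-> R} := mfun_Sub (mem_set mS).
pose T' : {mfun Omega >-> R} := mfun_Sub (mem_set mT).
pose m1 : probability R R := distribution P S'; pose m2 : probability R R := distribution P T'.
pose f (z : R * R) : R := cos (z.1 + z.2 + th).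
have mcos : measurable_fun setT (@cos R).
  by apply: continuous_measurable_fun; exact: continuous_cos.
have mf : measurable_fun setT f.
  apply: (measurableT_comp mcos); apply: measurable_funD => //.
  by apply: measurable_funD; [exact: measurable_fst|exact: measurable_snd].
have mST : measurable_fun setT (fun w => (S w, T w) : R * R).
  exact: measurable_fun_pair.
have fi : (m1 \x m2)%E.-integrable setT (EFin \o f).
  by apply: (@integrable_bounded _ _ _ ((m1 \x m2)%E : probability _ R) _ 1) => // z; exact: cos_max.
have joint : \int[P]_w f (S w, T w) = \int[(m1 \x m2)%E]_z f z.
  rewrite /Rintegral; congr fine.
  rewrite [RHS](eq_measure_integral (pushforward P (fun w => (S w, T w) : R * R))); last first.
    move=> A mA _; exact: product_measure_unique.
  rewrite integral_pushforward//; first exact/measurable_EFinP.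
  apply: (@integrable_bounded _ _ _ P _ 1); last by move=> z; exact: cos_max.
  exact: (measurableT_comp mf mST).
transitivity (\int[(m1 \x m2)%E]_z f z); first by rewrite -joint.
rewrite /Rintegral -integral12_prod_meas1//.
have inner (x : R) : (\int[m2]_y (f (x, y))%:E = (cos (x + th) * b)%R%:E)%E.
  have mfx : measurable_fun setT (fun y : R => cos (x + y + th)).
    apply: (measurableT_comp mcos); apply: measurable_funD => //.
    exact: measurable_funD.
  rewrite integral_distribution//=; last 2 first.
  - exact/measurable_EFinP.
  - apply: (@integrable_bounded _ _ _ P _ 1); last by move=> z; exact: cos_max.
    exact: (measurableT_comp mfx mT).
  rewrite -Tb /Rintegral fineK; last first.
    apply: integrable_fin_num => //; apply: (@integrable_bounded _ _ _ P _ 1).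
      apply: (measurableT_comp mcos); exact: measurable_funD.
    by move=> z; exact: cos_max.
  by apply: eq_integral => w _ /=; rewrite /f /=; congr (cos _)%:E; ring.
rewrite /fubini_F.
under eq_integral do rewrite inner.
have mc : measurable_fun setT (fun y : R => cos (y + th) * b).
  apply: measurable_funM => //.
  by apply: (measurableT_comp mcos); exact: measurable_funD.
rewrite integral_distribution//=; last 2 first.
- exact/measurable_EFinP.
- apply: (@integrable_bounded _ _ _ P _ `|b|); first exact: (measurableT_comp mc mS).
  by move=> w; rewrite normrM ler_piMl// cos_max.
have := @RintegralZr _ _ _ P setT (fun w => cos (S w + th)) b measurableT.
rewrite /Rintegral => ->.
  by have := Sa th; rewrite /Rintegral => ->; rewrite mulrA.
apply: (@integrable_bounded _ _ _ P _ 1); last by move=> z; exact: cos_max.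
by apply: (measurableT_comp mcos); exact: measurable_funD.
Qed.

(** The product rule of [mutually_independent] only concerns cylinder events;
these are stable under intersection, and the events independent of X k form a
Dynkin system. *)
Lemma indep_sigma_prefix (N : nat) (X : 'I_N -> Omega -> R) (k : 'I_N) (B : set R) :
  (forall i, measurable_fun setT (X i)) -> mutually_independent P X -> measurable B ->
  forall A, sigma_family [set i : 'I_N | (i < k)%N] X A ->
  P (A `&` X k @^-1` B) = (P A * P (X k @^-1` B))%E.
Proof.
move=> mX indX mB.
have mpre i C : measurable C -> measurable (X i @^-1` C).
  by move=> mC; rewrite -[_ @^-1` _]setTI; exact: mX.
pose J := [set i : 'I_N | (i < k)%N]%SET.
pose cyl (C : 'I_N -> set R) := \bigcap_(i in [set i | i \in J]) (X i @^-1` C i).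
pose Pi : set (set Omega) := [set A | exists2 C : 'I_N -> set R,
   (forall i, measurable (C i)) & A = cyl C].
pose L := [set A | measurable A /\
   P (A `&` X k @^-1` B) = (P A * P (X k @^-1` B))%E].
have mcyl C : (forall i, measurable (C i)) -> measurable (cyl C).
  move=> mC; apply: fin_bigcap_measurable => [|i _]; [exact: finite_finset|exact: mpre].
have dL : dynkin L.
  split.
  - split; first exact: measurableT.
    by rewrite setTI probability_setT mul1e.
  - move=> A [mA PA]; split; first exact: measurableC.
    rewrite setIC -setDE measureD//; last 2 first.
    + exact: mpre.
    + by rewrite (le_lt_trans (probability_le1 P _)) ?ltry//; exact: mpre.
    rewrite [X in (_ - P X)%E]setIC PA probability_setC//.
    have fA : P A \is a fin_num by exact: fin_num_measure.
    have fX : P (X k @^-1` B) \is a fin_num by apply: fin_num_measure; exact: mpre.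
    by rewrite muleBl ?mul1e// fin_num_adde_defl.
  - move=> F tF LF; have mF n : measurable (F n) by have [] := LF n.
    split; first exact: bigcup_measurable.
    rewrite setI_bigcupl measure_bigcup//; last 2 first.
    + by move=> n _; apply: measurableI => //; exact: mpre.
    + apply: trivIset_setIr; exact: tF.
    have fX : P (X k @^-1` B) \is a fin_num by apply: fin_num_measure; exact: mpre.
    rewrite measure_bigcup// -(fineK fX) muleC -nneseriesZl//.
    by apply: eq_eseriesr => n _; have [_ PF] := LF n; rewrite fineK// muleC; exact: PF.
have Pisub : Pi `<=` L.
  move=> _ [C mC ->]; split; first exact: mcyl.
  pose C' i := if i == k then B else C i.
  have mC' i : measurable (C' i) by rewrite /C'; case: ifP.
  have kJ : k \notin J by rewrite inE ltnn.
  have := indX (k |: J)%SET C' mC'.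
  rewrite (_ : [set i | i \in (k |: J)%SET] = [set k] `|` [set i | i \in J]); last first.
    apply/seteqP; split => i /=; rewrite in_setU1.
      by move=> /orP[/eqP|]; [left|right].
    by move=> [->|->]; rewrite ?eqxx ?orbT.
  rewrite bigcap_setU bigcap_set1 {1}/C' eqxx setIC.
  have -> : \bigcap_(i in [set i | i \in J]) X i @^-1` C' i = cyl C.
    apply: eq_bigcapr => i /= iJ; rewrite /C'; case: eqP => // ik.
    by rewrite ik (negbTE kJ) in iJ.
  move=> ->; rewrite big_setU1//= {1}/C' eqxx muleC; congr (_ * _)%E.
  rewrite -(indX J C' mC'); congr (P _).
  apply: eq_bigcapr => i /= iJ; rewrite /C'; case: eqP => // ik.
  by rewrite ik (negbTE kJ) in iJ.
have PiI : setI_closed Pi.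
  move=> _ _ [C mC ->] [C' mC' ->]; exists (fun i => C i `&` C' i).
    by move=> i; exact: measurableI.
  by rewrite /cyl -bigcapI.
have gen : <<s Pi >> `<=` L.
  by rewrite -setI_closed_g_dynkin_g_sigma_algebra//; exact: smallest_sub.
move=> A sA; have [] // : L A.
apply: gen; move: A sA; apply: sigma_family_sub; first exact: smallest_sigma_algebra.
move=> i C /= ik mC; apply: sub_sigma_algebra.
exists (fun j => if j == i then C else setT); first by move=> j; case: ifP.
apply/seteqP; split => w /=.
  by move=> XC j /= jJ; case: eqP => // ->.
by move=> /(_ i); rewrite /= inE eqxx; exact.
Qed.

Lemma cos_gaussian_sum (N : nat) (X : 'I_N -> Omega -> R) (s : R) (b : 'I_N -> R) :
  (forall i, centered_gaussian P (X i) s) -> mutually_independent P X ->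
  forall th, \int[P]_w cos (\sum_(i < N) b i * X i w + th) =
    cos th * expR (- (s ^+ 2 * (\sum_(i < N) b i ^+ 2) / 2)).
Proof.
move=> gX indX.
have mX i : measurable_fun setT (X i) by have [] := gX i.
suff H k : (k <= N)%N -> forall th,
    \int[P]_w cos (\sum_(i < N | (i < k)%N) b i * X i w + th) =
    cos th * expR (- (s ^+ 2 * (\sum_(i < N | (i < k)%N) b i ^+ 2) / 2)).
  move=> th; have := H N (leqnn N) th.
  have sumT (F : 'I_N -> R) : \sum_(i < N | (i < N)%N) F i = \sum_(i < N) F i.
    by apply: eq_bigl => i; rewrite ltn_ord.
  by rewrite sumT; under eq_Rintegral do rewrite sumT.
elim: k => [_ th|k IH kN th].
  have sum0 (F : 'I_N -> R) : \sum_(i < N | (i < 0)%N) F i = 0 by rewrite big_pred0.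
  rewrite sum0; under eq_Rintegral do rewrite sum0 add0r.
  by rewrite Rintegral_prob_cst mulr0 mul0r oppr0 expR0 mulr1.
have splitk (F : 'I_N -> R) : \sum_(i < N | (i < k.+1)%N) F i =
    \sum_(i < N | (i < k)%N) F i + F (Ordinal kN).
  rewrite (bigD1 (Ordinal kN))//= addrC; congr (_ + _).
  by apply: eq_bigl => i; rewrite -val_eqE /= ltnS leq_eqVlt; case: ltngtP.
rewrite splitk; under eq_Rintegral do rewrite splitk.
rewrite (_ : expR _ = expR (- (s ^+ 2 * (\sum_(i < N | (i < k)%N) b i ^+ 2) / 2)) *
   expR (- (s ^+ 2 * b (Ordinal kN) ^+ 2 / 2))); last first.
  by rewrite -expRD; congr expR; ring.
apply: (@cos_indep (fun w => \sum_(i < N | (i < k)%N) b i * X i w)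
  (fun w => b (Ordinal kN) * X (Ordinal kN) w)).
- by apply: measurable_sum_cond => i _; exact: measurable_funM.
- exact: measurable_funM.
- move=> A B mA mB.
  rewrite (_ : (fun w => b (Ordinal kN) * X (Ordinal kN) w) @^-1` B =
    X (Ordinal kN) @^-1` ((fun x => b (Ordinal kN) * x) @^-1` B))//.
  apply: indep_sigma_prefix => //.
    rewrite -[_ @^-1` _]setTI; have : measurable_fun setT (fun x : R => b (Ordinal kN) * x).
      exact: measurable_funM.
    exact.
  exact: (@sigma_family_lincomb _ Omega R _ [set i : 'I_N | (i < k)%N] X _ _ _ b id).
- by move=> th'; exact: IH (ltnW kN) th'.
- move=> th'; exact: gaussian_cos.
Qed.

End Independence.

(** * Orthogonality to trigonometric functions of a random vector *)

Section TrigNull.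
Context d (Omega : measurableType d) (R : realType) (P : probability Omega R).
Variables (N : nat) (Y : 'I_N -> Omega -> R).
Hypothesis mY : forall i, measurable_fun setT (Y i).
Implicit Types V W : Omega -> R.

Definition trig (l : 'I_N -> R) (th : R) (w : Omega) : R :=
  cos (\sum_(i < N) l i * Y i w + th).

Definition trig_null W := P.-integrable setT (EFin \o W) /\
  forall l th, \int[P]_w (W w * trig l th w) = 0.

(** The multipliers form an algebra of bounded variables closed under bounded
pointwise limits, as in the functional form of the monotone class theorem. *)
Definition trig_multiplier V := [/\ measurable_fun setT V,
  exists C, forall w, `|V w| <= C &
  forall W, trig_null W -> trig_null (fun w => W w * V w)].

Lemma measurable_trig l th : measurable_fun setT (trig l th).
Proof.
apply: (measurableT_comp (continuous_measurable_fun (@continuous_cos R))).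
apply: measurable_funD => //.
by apply: measurable_sum => i; exact: measurable_funM.
Qed.

Lemma integrable_trig W l th : P.-integrable setT (EFin \o W) ->
  P.-integrable setT (EFin \o (fun w => W w * trig l th w)).
Proof.
move=> iW; apply: (integrable_mulr_bounded measurableT 1) => //.
  exact: measurable_trig.
by move=> w _; exact: cos_max.
Qed.

Lemma trig_nullD W W' : trig_null W -> trig_null W' -> trig_null (fun w => W w + W' w).
Proof.
move=> [iW nW] [iW' nW']; split; first exact: (integrableD _ iW iW').
move=> l th; under eq_Rintegral do rewrite mulrDl.
by rewrite RintegralD ?nW ?nW' ?addr0//; exact: integrable_trig.
Qed.

Lemma trig_nullZ (a : R) W : trig_null W -> trig_null (fun w => a * W w).
Proof.
move=> [iW nW]; split; first exact: (integrableZl _ a iW).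
move=> l th; under eq_Rintegral do rewrite -mulrA.
by rewrite RintegralZl ?nW ?mulr0//; exact: integrable_trig.
Qed.

Lemma trig_multiplier_cst (a : R) : trig_multiplier (fun=> a).
Proof.
split; [exact: measurable_cst|by exists `|a| |] => W nW.
rewrite (_ : (fun w => _) = (fun w => a * W w)); first exact: trig_nullZ.
by apply/funext => w; rewrite mulrC.
Qed.

Lemma trig_multiplierD V V' : trig_multiplier V -> trig_multiplier V' ->
  trig_multiplier (fun w => V w + V' w).
Proof.
move=> [mV [C VC] nV] [mV' [C' VC'] nV']; split; first exact: measurable_funD.
  by exists (C + C') => w; rewrite (le_trans (ler_normD _ _))// lerD.
move=> W nW; rewrite (_ : (fun w => _) = (fun w => W w * V w + W w * V' w)).
  by apply: trig_nullD; [exact: nV|exact: nV'].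
by apply/funext => w; rewrite mulrDr.
Qed.

Lemma trig_multiplierM V V' : trig_multiplier V -> trig_multiplier V' ->
  trig_multiplier (fun w => V w * V' w).
Proof.
move=> [mV [C VC] nV] [mV' [C' VC'] nV']; split; first exact: measurable_funM.
  by exists (C * C') => w; rewrite normrM ler_pM.
move=> W nW; rewrite (_ : (fun w => _) = (fun w => (W w * V w) * V' w)).
  by apply: nV'; exact: nV.
by apply/funext => w; rewrite mulrA.
Qed.

(** By the product formula 2 cos x cos y = cos(x + y) + cos(x - y), the trigonometric
functions span an algebra. *)
Lemma trig_multiplier_trig l th : trig_multiplier (trig l th).
Proof.
split; [exact: measurable_trig|by exists 1 => w; exact: cos_max|].
move=> W [iW nW]; split; first exact: integrable_trig.
move=> l' th'.
have cc (x y : R) : cos x * cos y = 2^-1 * (cos (x + y) + cos (x - y)).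
  by rewrite cosB cosD; field.
have E w : W w * trig l th w * trig l' th' w =
    2^-1 * (W w * trig (fun i => l i + l' i) (th + th') w +
            W w * trig (fun i => l i - l' i) (th - th') w).
  rewrite -mulrDr mulrCA -mulrA cc; congr (_ * (_ * (cos _ + cos _))).
    rewrite addrACA -big_split /=; congr (_ + _).
    by apply: eq_bigr => i _; rewrite mulrDl.
  rewrite opprD addrACA -sumrB; congr (_ + _).
  by apply: eq_bigr => i _; rewrite mulrBl.
under eq_Rintegral do rewrite E.
rewrite RintegralZl//; last first.
  exact: (integrableD measurableT (integrable_trig _ _ iW) (integrable_trig _ _ iW)).
by rewrite RintegralD ?nW ?addr0 ?mulr0//; exact: integrable_trig.
Qed.

Lemma trig_multiplier_lim (F : nat -> Omega -> R) V (C : R) :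
  (forall n, trig_multiplier (F n)) -> (forall n w, `|F n w| <= C) ->
  (forall w, F n w @[n --> \oo] --> V w) -> trig_multiplier V.
Proof.
move=> mF FC FV.
have mFn n : measurable_fun setT (F n) by have [] := mF n.
have mV : measurable_fun setT V.
  by apply: (@measurable_fun_cvg _ _ _ _ F) => // w _; exact: FV.
have VC w : `|V w| <= C.
  by apply: (cvgr_to_le (cvg_norm (FV w))); apply: nearW => n; exact: FC.
split => //; first by exists C.
move=> W [iW nW]; have iWV : P.-integrable setT (EFin \o (fun w => W w * V w)).
  by apply: (integrable_mulr_bounded measurableT C).
split => // l th.
have mW : measurable_fun setT W by apply/measurable_EFinP; exact: measurable_int iW.
have H : \int[P]_w (W w * F n w * trig l th w) @[n --> \oo] -->
    \int[P]_w (W w * V w * trig l th w).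
  apply: (Rintegral_dominated_cvg measurableT (fun w => `|W w| * C) _ _ _ _).2.
- move=> n; apply: measurable_funM; first exact: measurable_funM.
  exact: measurable_trig.
- move=> w _; apply: cvgM; last exact: cvg_cst.
  by apply: cvgM; [exact: cvg_cst|exact: FV].
- exact: (integrableZr _ C (integrable_norm iW)).
- move=> n w _; rewrite -mulrA normrM ler_wpM2l// normrM.
  by rewrite (le_trans _ (FC n w))// ler_piMr// cos_max.
apply: cvg_unique H _ => //.
rewrite (_ : (fun n => _) = cst 0); first exact: cvg_cst.
by apply/funext => n; have [_ _ /(_ W (conj iW nW))[_ ->]] := mF n.
Qed.

(** The iterates of this polynomial converge to the sign on [-1, 1]: its fixed points
there are -1, 0 and 1, of which 0 is repelling and the other two attracting.  A
polynomial in a multiplier is a multiplier, so the sign of a multiplier bounded by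
1 is one too. *)
Definition smoothstep (x : R) : R := 2^-1 * (3 * x - x ^+ 3).

Lemma smoothstep_itv x : 0 <= x <= 1 -> 0 <= 1 - smoothstep x <= (1 - x) * (1 - x / 2).
Proof.
move=> /andP[x0 x1].
have -> : 1 - smoothstep x = (1 - x) * ((1 - x) * (2 + x) / 2) by rewrite /smoothstep; field.
apply/andP; split.
  by rewrite !mulr_ge0 ?subr_ge0// addr_ge0.
rewrite ler_wpM2l ?subr_ge0//; nra.
Qed.

Lemma smoothstepN x : smoothstep (- x) = - smoothstep x.
Proof. by rewrite /smoothstep; ring. Qed.

(** The iterates stay above x, so each step shrinks the distance to 1 by a factor
at most 1 - x / 2. *)
Lemma iter_smoothstep_pos x n : 0 < x <= 1 ->
  [/\ x <= iter n smoothstep x, iter n smoothstep x <= 1 &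
      1 - iter n smoothstep x <= (1 - x / 2) ^+ n].
Proof.
move=> /andP[x0 x1]; elim: n => [|n [h1 h2 h3]].
  by split => //=; rewrite expr0; lra.
have itv : 0 <= iter n smoothstep x <= 1 by rewrite h2 (le_trans _ h1)// ltW.
have /andP[g1 g2] := smoothstep_itv itv.
rewrite iterS; move: (iter n smoothstep x) h1 h2 h3 {itv} g1 g2 => y h1 h2 h3 g1 g2.
split; [|lra|].
  rewrite /smoothstep; nra.
apply: (le_trans g2); rewrite exprSr.
apply: ler_pM => //; lra.
Qed.

Lemma iter_smoothstepN x n : iter n smoothstep (- x) = - iter n smoothstep x.
Proof. by elim: n => //= n ->; rewrite smoothstepN. Qed.

Lemma iter_smoothstep0 n : iter n smoothstep 0 = 0.
Proof. by elim: n => //= n ->; rewrite /smoothstep expr0n /=; ring. Qed.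

Lemma iter_smoothstep_bound x n : `|x| <= 1 -> `|iter n smoothstep x| <= 1.
Proof.
move=> x1; have [x0|x0|->] := ltgtP x 0; last by rewrite iter_smoothstep0 normr0.
- have [|h1 h2 _] := @iter_smoothstep_pos (- x) n.
    by rewrite oppr_gt0 x0 /= -(ltr0_norm x0).
  rewrite -[x]opprK iter_smoothstepN normrN ger0_norm//.
  by rewrite (le_trans _ h1)// ltW// oppr_gt0.
- have [|h1 h2 _] := @iter_smoothstep_pos x n; first by rewrite x0 /= -(gtr0_norm x0).
  by rewrite ger0_norm// (le_trans _ h1)// ltW.
Qed.

Lemma cvg_iter_smoothstep x : `|x| <= 1 -> iter n smoothstep x @[n --> \oo] --> Num.sg x.
Proof.
have pos y : 0 < y -> y <= 1 -> iter n smoothstep y @[n --> \oo] --> (1 : R).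
  move=> y0 y1; apply/cvgrPdist_le => e e0.
  have : (1 - y / 2) ^+ n @[n --> \oo] --> (0 : R).
    by apply: cvg_expr; rewrite ger0_norm; lra.
  move=> /cvgrPdist_le /(_ e e0); apply: filterS => n.
  rewrite sub0r normrN => h.
  have [|h1 h2 h3] := @iter_smoothstep_pos y n; first by rewrite y0.
  rewrite ger0_norm ?subr_ge0//; apply: (le_trans h3); apply: le_trans h.
  exact: ler_norm.
move=> x1; have [x0|x0|->] := ltgtP x 0.
- rewrite ltr0_sg// -[x]opprK.
  under eq_cvg do rewrite iter_smoothstepN.
  by apply: cvgN; apply: pos; rewrite ?oppr_gt0// -(ltr0_norm x0).
- by rewrite gtr0_sg//; apply: pos => //; rewrite -(gtr0_norm x0).
- rewrite sgr0; under eq_cvg do rewrite iter_smoothstep0.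
  exact: cvg_cst.
Qed.

Lemma trig_multiplier_sg_trig (l : 'I_N -> R) th :
  trig_multiplier (fun w => Num.sg (trig l th w)).
Proof.
apply: (@trig_multiplier_lim (fun n w => iter n smoothstep (trig l th w)) _ 1).
- elim => [|n IH]; first exact: trig_multiplier_trig.
  rewrite (_ : (fun w => _) = (fun w => 2^-1 * (3 * iter n smoothstep (trig l th w)
    + (-1) * (iter n smoothstep (trig l th w) *
      (iter n smoothstep (trig l th w) * iter n smoothstep (trig l th w)))))); last first.
    by apply/funext => w; rewrite iterS {1}/smoothstep; ring.
  apply: trig_multiplierM; first exact: trig_multiplier_cst.
  apply: trig_multiplierD; apply: trig_multiplierM => //; try exact: trig_multiplier_cst.
  by do 2 apply: trig_multiplierM => //.
- by move=> n w; apply: iter_smoothstep_bound; exact: cos_max.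
- by move=> w; apply: cvg_iter_smoothstep; exact: cos_max.
Qed.

(** For large n, (Y k - z) / n lies in ]-pi, pi[, where sin has the sign of its
argument. *)
Lemma trig_multiplier_sg (k : 'I_N) (z : R) :
  trig_multiplier (fun w => Num.sg (Y k w - z)).
Proof.
apply: (@trig_multiplier_lim (fun n w => Num.sg (sin ((Y k w - z) / n.+1%:R))) _ 1).
- move=> n; rewrite (_ : (fun w => _) = (fun w => Num.sg
      (trig (fun i => if i == k then n.+1%:R^-1 else 0) (- (z / n.+1%:R) - pi / 2) w))).
    exact: trig_multiplier_sg_trig.
  apply/funext => w; congr Num.sg; rewrite /trig addrA cosBpihalf; congr sin.
  rewrite (bigD1 k)//= eqxx big1 ?addr0; first by ring.
  by move=> i ik; rewrite (negbTE ik) mul0r.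
- by move=> n w; rewrite normr_sg; case: eqP => //; rewrite ?ler01.
- move=> w; apply: cvg_near_cst.
  near=> n.
  have h : `|Y k w - z| < pi * n.+1%:R.
    have p2 : 2 <= pi :> R by exact: pi_ge2.
    have : `|Y k w - z| <= n%:R by near: n; exact: nbhs_infty_ger.
    rewrite -natr1 => hh; have : 0 <= n%:R :> R by [].
    nra.
  set x := Y k w - z in h *.
  have n0 : 0 < n.+1%:R :> R by rewrite ltr0n.
  have [x0|x0|->] := ltgtP x 0; last by rewrite mul0r sin0.
  + rewrite !ltr0_sg// -oppr_gt0 -sinN -mulNr; apply: sin_gt0_pi.
    by rewrite divr_gt0 ?oppr_gt0//= ltr_pdivrMr// -(ltr0_norm x0).
  + rewrite !gtr0_sg//; apply: sin_gt0_pi.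
    by rewrite divr_gt0//= ltr_pdivrMr// -(gtr0_norm x0).
Unshelve. all: end_near. Qed.

(** The events whose indicator is a multiplier form a sigma-algebra, which contains
the half-lines Y k > z because their indicators are polynomials in the sign of
Y k - z. *)
Lemma trig_null_integral_eq0 W : trig_null W ->
  forall A, sigma_family setT Y A -> \int[P]_(w in A) W w = 0.
Proof.
move=> nW A sA.
pose S := [set A : set Omega | trig_multiplier \1_A].
have S1 (B : set Omega) : S B -> S (~` B).
  move=> SB; rewrite /S /=.
  rewrite (_ : \1_(~` B) = (fun w => 1 + (-1) * \1_B w)).
    apply: trig_multiplierD; first exact: trig_multiplier_cst.
    by apply: trig_multiplierM => //; exact: trig_multiplier_cst.
  apply/funext => w; rewrite !indicE in_setC.
  by case: (w \in B); rewrite /= ?mulr1 ?mulr0 ?subrr ?addr0.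
have S2 (B C : set Omega) : S B -> S C -> S (B `&` C).
  by move=> SB SC; rewrite /S /= indicI; exact: trig_multiplierM.
have sS : sigma_algebra setT S.
  split.
  - by rewrite /S /= indic0; exact: trig_multiplier_cst.
  - by move=> B SB; rewrite setTD; exact: S1.
  - move=> F SF.
    have SU n : S (\bigcup_(k < n) F k).
      elim: n => [|n IH].
        by rewrite bigcup_mkord big_ord0 /S /= indic0; exact: trig_multiplier_cst.
      rewrite bigcup_mkord big_ord_recr /= -bigcup_mkord -[_ `|` _]setCK setCU.
      by apply: (S1); apply: (S2); exact: S1.
    apply: (@trig_multiplier_lim (fun n => \1_(\bigcup_(k < n) F k)) _ 1) => //.
      by move=> n w; rewrite indicE; case: (_ \in _); rewrite ?normr1 ?normr0.
    move=> w; apply: cvg_near_cst.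
    have [[k _ Fkw]|nF] := pselect ((\bigcup_k F k) w).
      near=> n; rewrite !indicE !mem_set//; first by exists k.
      by exists k => //=; near: n; exact: nbhs_infty_gt.
    apply: nearW => n; rewrite !indicE !memNset// => -[k _ Fk]; apply: nF.
    by exists k.
(* (sgn + 1) sgn / 2 rather than (sgn + 1) / 2, which is 1/2 where Y k = z. *)
have Shalf k z : S (Y k @^-1` `]z, +oo[).
  rewrite /S /=.
  rewrite (_ : \1_ _ = (fun w => 2^-1 * (Num.sg (Y k w - z) * (Num.sg (Y k w - z) + 1)))).
    apply: trig_multiplierM; first exact: trig_multiplier_cst.
    apply: trig_multiplierM; first exact: trig_multiplier_sg.
    by apply: trig_multiplierD; [exact: trig_multiplier_sg|exact: trig_multiplier_cst].
  apply/funext => w; rewrite indicE.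
  have [zY|Yz|zY] := ltgtP z (Y k w).
  - rewrite mem_set /= ?in_itv /= ?zY// gtr0_sg ?subr_gt0// mul1r.
    by rewrite mulVf.
  - rewrite memNset /= ?in_itv /= ?andbT; last by apply/negP; rewrite -leNgt ltW.
    by rewrite ltr0_sg ?subr_lt0// addNr !mulr0.
  - rewrite memNset /= ?in_itv /= ?andbT; last by apply/negP; rewrite zY ltxx.
    by rewrite -zY subrr sgr0 mul0r mulr0.
have {}sA : S A.
  move: A sA; apply: sigma_family_sub => // k B _.
  have -> : (measurable : set (set R)) = (@RGenOInfty.G R).-sigma.-measurable.
    exact: RGenOInfty.measurableE.
  move: B.
  apply: smallest_sub; last by move=> _ [z ->]; exact: Shalf.
  case: sS => s0 sC sU; split.
  - by rewrite /= preimage_set0.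
  - by move=> B SB; rewrite /= setTD -preimage_setC; exact: S1.
  - by move=> F SF; rewrite /= preimage_bigcup; exact: sU.
have tr1 w : trig (fun=> 0) 0 w = 1.
  by rewrite /trig big1 ?addr0 ?cos0// => i _; rewrite mul0r.
case: sA => _ _ /(_ W nW)[_ /(_ (fun=> 0) 0)].
under eq_Rintegral do rewrite tr1 mulr1.
move=> nWA; rewrite Rintegral_mkcond -[RHS]nWA; apply: eq_Rintegral => w _.
by rewrite patchE indicE; case: ifP => _; rewrite ?mulr1 ?mulr0.
Unshelve. all: end_near. Qed.

End TrigNull.

(** * Gaussian regression *)

Section TrigBounds.
Context (R : realType).
Implicit Types x y : R.

Lemma cos_lipschitz x y : `|cos x - cos y| <= `|x - y|.
Proof.
wlog xy : x y / y <= x.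
  by move=> H; case: (leP y x) => [/H//|/ltW/H]; rewrite distrC (distrC y).
have [|z _ ->] := @MVT_segment R cos (fun z => - sin z) y x xy.
  by apply: continuous_subspaceT; exact: continuous_cos.
by rewrite normrM normrN ler_piMl// sin_max.
Qed.

Lemma sin_lipschitz x y : `|sin x - sin y| <= `|x - y|.
Proof.
have -> : x - y = (x - pi / 2) - (y - pi / 2) by ring.
by rewrite -!cosBpihalf; exact: cos_lipschitz.
Qed.

Lemma norm_sin_le x : `|sin x| <= `|x|.
Proof. by have := sin_lipschitz x 0; rewrite sin0 !subr0. Qed.

Lemma sin_sub_le x : `|sin x - x| <= x ^+ 2.
Proof.
wlog x0 : x / 0 <= x.
  move=> H; case: (leP 0 x) => [/H//|/ltW x0].
  by have := H (- x); rewrite oppr_ge0 x0 sinN opprK sqrrN addrC distrC; exact.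
have [|z zx] := @MVT_segment R (fun z => sin z - z) (fun z => cos z - 1) 0 x x0.
  apply: continuous_subspaceT => z; apply: cvgB; [exact: continuous_sin|exact: cvg_id].
rewrite sin0 subrr !subr0 => ->.
rewrite normrM expr2 (ger0_norm x0) ler_wpM2r//.
have := cos_lipschitz z 0; rewrite cos0 subr0 => /le_trans; apply.
by move: zx; rewrite in_itv /= => /andP[z0 zx]; rewrite ger0_norm.
Qed.

Lemma cvg_sin_scaled x : n.+1%:R * sin (n.+1%:R^-1 * x) @[n --> \oo] --> x.
Proof.
apply/subr_cvg0/norm_cvg0P.
apply: (@squeeze_cvgr _ _ _ _ (cst 0) (fun n : nat => x ^+ 2 * n.+1%:R^-1)).
- apply: nearW => n; rewrite normr_ge0 /=.
  have n0 : 0 < n.+1%:R :> R by rewrite ltr0n.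
  rewrite (_ : _ - x = n.+1%:R * (sin (n.+1%:R^-1 * x) - n.+1%:R^-1 * x)); last first.
    by rewrite mulrBr mulrA mulfV ?mul1r// gt_eqF.
  rewrite normrM (gtr0_norm n0).
  apply: (le_trans (ler_wpM2l (ltW n0) (sin_sub_le _))).
  by rewrite le_eqVlt; apply/orP; left; apply/eqP; field; rewrite nat1r gt_eqF.
- exact: cvg_cst.
- rewrite -[X in _ --> X](mulr0 (x ^+ 2)); apply: cvgM; first exact: cvg_cst.
  exact: cvg_harmonic.
Qed.

End TrigBounds.

Section Regression.
Context d (Omega : measurableType d) (R : realType) (P : probability Omega R).
Variables (N : nat) (X : Omega -> R) (Y : 'I_N -> Omega -> R).
Hypothesis iX : P.-integrable setT (EFin \o X).
Hypothesis iY : forall i, P.-integrable setT (EFin \o Y i).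
Variable Q : R -> ('I_N -> R) -> R.
Hypothesis charE : forall a b th,
  \int[P]_w cos (a * X w + \sum_(i < N) b i * Y i w + th) = cos th * expR (- (Q a b / 2)).
Variable q : 'I_N -> R.
Hypothesis Qq : forall a b,
  Q a (fun i => b i - a * q i) = Q (- a) (fun i => b i + a * q i).

Let mX : measurable_fun setT X.
Proof. by apply/measurable_EFinP; exact: measurable_int iX. Qed.

Let mY i : measurable_fun setT (Y i).
Proof. by apply/measurable_EFinP; exact: measurable_int (iY i). Qed.

Let Z w := \sum_(i < N) q i * Y i w.

Let iZ : P.-integrable setT (EFin \o Z).
Proof.
apply: (Rintegral_sum measurableT _ _).1 => i.
exact: (integrableZl _ (q i) (iY i)).
Qed.

Let E w := X w - Z w.

Let iE : P.-integrable setT (EFin \o E).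
Proof. exact: (integrableB _ iX iZ). Qed.

Let mE : measurable_fun setT E.
Proof. by apply/measurable_EFinP; exact: measurable_int iE. Qed.

(** [Qq] makes the law of (E, Y) invariant under changing the sign of E, and
2 sin y cos(L + th) is the difference of the cosines of L - y + th + pi/2 and
L + y + th + pi/2. *)
Lemma residual_orthogonal_trig a l th :
  \int[P]_w (sin (a * E w) * trig Y l th w) = 0.
Proof.
have cE (c th' : R) : \int[P]_w cos (\sum_(i < N) l i * Y i w + c * E w + th') =
    cos th' * expR (- (Q c (fun i => l i - c * q i) / 2)).
  rewrite -charE; apply: eq_Rintegral => w _; congr cos; congr (_ + _).
  rewrite /E /Z mulrBr mulr_sumr addrC -addrA; congr (_ + _).
  rewrite addrC -sumrB; apply: eq_bigr => i _; ring.
have eqE th' : \int[P]_w cos (\sum_(i < N) l i * Y i w + a * E w + th') =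
    \int[P]_w cos (\sum_(i < N) l i * Y i w + (- a) * E w + th').
  rewrite !cE Qq (_ : (fun i => l i + a * q i) = (fun i => l i - - a * q i))//.
  by apply/funext => i; ring.
have mL : measurable_fun setT (fun w => \sum_(i < N) l i * Y i w).
  by apply: measurable_sum => i; exact: measurable_funM.
have icos c th' : P.-integrable setT
    (EFin \o (fun w => cos (\sum_(i < N) l i * Y i w + c * E w + th'))).
  apply: (@integrable_bounded _ _ _ _ _ 1); last by move=> w; exact: cos_max.
  apply: (measurableT_comp (continuous_measurable_fun (@continuous_cos R))).
  by apply: measurable_funD => //; apply: measurable_funD => //; exact: measurable_funM.
have H w : sin (a * E w) * trig Y l th w =
  2^-1 * (cos (\sum_(i < N) l i * Y i w + (- a) * E w + (th + pi / 2)) -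
          cos (\sum_(i < N) l i * Y i w + a * E w + (th + pi / 2))).
  rewrite /trig !addrA !cosDpihalf.
  set L := \sum_(i < N) _; set y := a * E w.
  rewrite mulNr -/y (_ : L - y + th = (L + th) - y); last by ring.
  rewrite (_ : L + y + th = (L + th) + y); last by ring.
  by rewrite (sinB (L + th)) (sinD (L + th)); field.
under eq_Rintegral do rewrite H.
rewrite RintegralZl//; last exact: (integrableB _ (icos _ _) (icos _ _)).
by rewrite RintegralB// -eqE subrr mulr0.
Qed.

(** Divide [residual_orthogonal_trig] by a = 1/n: n sin(E / n) tends to E and is
dominated by |E|. *)
Lemma residual_trig_null : trig_null P Y E.
Proof.
split => // l th.
have H : \int[P]_w (n.+1%:R * sin (n.+1%:R^-1 * E w) * trig Y l th w) @[n --> \oo] -->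
    \int[P]_w (E w * trig Y l th w).
  apply: (Rintegral_dominated_cvg measurableT (fun w => `|E w|) _ _ _ _).2.
  - move=> n; apply: measurable_funM; last exact: measurable_trig.
    apply: measurable_funM => //.
    apply: (measurableT_comp (continuous_measurable_fun (@continuous_sin R))).
    exact: measurable_funM.
  - by move=> w _; apply: cvgM; [exact: cvg_sin_scaled|exact: cvg_cst].
  - exact: integrable_norm.
  - move=> n w _; rewrite normrM.
    apply: (@le_trans _ _ (`|n.+1%:R * sin (n.+1%:R^-1 * E w)|)).
      by rewrite ler_piMr// cos_max.
    rewrite normrM; apply: (@le_trans _ _ (`|n.+1%:R| * `|n.+1%:R^-1 * E w|)).
      by rewrite ler_wpM2l// norm_sin_le.
    by rewrite -normrM mulrA mulfV ?mul1r// pnatr_eq0.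
apply: cvg_unique H _ => //.
rewrite (_ : (fun n => _) = cst 0); first exact: cvg_cst.
apply/funext => n; under eq_Rintegral do rewrite -mulrA.
rewrite RintegralZl ?residual_orthogonal_trig ?mulr0//.
apply: (@integrable_bounded _ _ _ P _ 1).
  apply: measurable_funM; last exact: measurable_trig.
  apply: (measurableT_comp (continuous_measurable_fun (@continuous_sin R))).
  exact: measurable_funM.
by move=> w; rewrite normrM mulr_ile1// ?sin_max ?cos_max.
Qed.

(** When [Q] is the covariance form of a Gaussian vector (X, Y), [charE] is its
characteristic function, and [Qq] says that the residual X - q.Y is uncorrelated
with Y. *)
Lemma gaussian_regression : is_cond_exp P (sigma_family setT Y) X Z.
Proof.
split => //.
- by move=> B mB; exact: sigma_family_lincomb.
- move=> A sA.
  have mA : measurable A by apply: sigma_family_measurable sA.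
  have := trig_null_integral_eq0 mY residual_trig_null sA.
  rewrite /E RintegralB//.
  + by move=> /eqP; rewrite subr_eq0 => /eqP.
  + exact: (integrableS _ _ _ iX).
  + exact: (integrableS _ _ _ iZ).
Qed.

End Regression.

(** * Step functions on the half-line *)

Section Step.
Context (R : realType).
Notation mu := (@lebesgue_measure R).
Notation D := (`[0, +oo[%classic : set R).

Definition node (n k : nat) : R := k%:R / n.+1%:R.

Definition cell (n k : nat) : set R := `[node n k, node n k.+1[%classic.

(** The grid has mesh 1 / (n + 1) and covers [0, n + 1[: both the resolution and
the range improve with n. *)
Definition step (n : nat) (G : R -> R) (s : R) : R :=
  \sum_(k < n.+1 * n.+1) \1_(cell n k) s * G (node n k).

Lemma node_ge0 n k : 0 <= node n k.
Proof. by rewrite divr_ge0. Qed.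

Lemma step_out n G (s : R) : n.+1%:R <= s -> step n G s = 0.
Proof.
move=> ns; rewrite /step big1// => k _; rewrite indicE memNset ?mul0r// /cell /= in_itv /=.
apply/negP; rewrite negb_and -leNgt orbC (le_trans _ ns)//.
by rewrite /node ler_pdivrMr ?ltr0n// -natrM ler_nat.
Qed.

Lemma step_in n (s : R) : 0 <= s < n.+1%:R -> exists p,
  [/\ 0 <= p, p <= s, s - p <= n.+1%:R^-1 & forall G, step n G s = G p].
Proof.
move=> /andP[s0 sn].
have n0 : 0 < n.+1%:R :> R by rewrite ltr0n.
have sn0 : 0 <= s * n.+1%:R by rewrite mulr_ge0.
pose k := Num.truncn (s * n.+1%:R).
have /andP[k1 k2] := truncn_itv sn0; rewrite -/k in k1 k2.
have kn : (k < n.+1 * n.+1)%N.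
  rewrite -(ltr_nat R) (le_lt_trans k1)// natrM ltr_pM2r//.
have cellE (j : nat) : (s \in cell n j) = (j == k).
  rewrite /cell mem_setE /= in_itv /= /node ler_pdivrMr// ltr_pdivlMr//.
  by rewrite eq_sym /k truncn_eq.
exists (node n k); split.
- exact: node_ge0.
- by rewrite /node ler_pdivrMr.
- rewrite lerBlDr /node -[X in _ <= X + _]mul1r -mulrDl ler_pdivlMr// nat1r.
  exact: ltW.
- move=> G; rewrite /step (bigD1 (Ordinal kn))//= indicE cellE eqxx mul1r.
  rewrite big1 ?addr0// => j jk; rewrite indicE cellE.
  by rewrite -val_eqE /= in jk; rewrite (negbTE jk) mul0r.
Qed.

(* In the application h is the shifted input, integrable only against the weight
   e^(a s), and the functions approximated decay at least like this weight. *)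
Variables (a : R) (h : R -> R).
Hypothesis a0 : a < 0.
Hypothesis ih : mu.-integrable D (EFin \o (fun s => expR (a * s) * h s)).

Lemma measurable_weight : measurable_fun D h.
Proof.
have -> : h = (fun s => expR (- (a * s)) * (expR (a * s) * h s)).
  by apply/funext => s; rewrite mulrA -expRD addNr expR0 mul1r.
apply: measurable_funM.
  apply: measurable_funTS; apply: (measurableT_comp (@measurable_expR R)).
  by apply: measurableT_comp => //; exact: measurable_funM.
by apply/measurable_EFinP; exact: measurable_int ih.
Qed.

Definition weight_norm := \int[mu]_(s in D) `|expR (a * s) * h s|.

Lemma integrable_cell n k : mu.-integrable D (EFin \o (fun s => \1_(cell n k) s * h s)).
Proof.
apply: (integrable_dom (mu := mu) _ (fun s => expR (- a * node n k.+1) * `|expR (a * s) * h s|)) => //.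
- apply: measurable_funM; last exact: measurable_weight.
  by apply: measurable_indic; exact: measurable_itv.
- move=> s; rewrite /= in_itv /= andbT => s0; rewrite !normrM indicE.
  have [|_] := boolP (s \in _); last by rewrite normr0 mul0r ?mulr_ge0 ?expR_ge0.
  rewrite /cell mem_setE /= in_itv /= => /andP[_ sn].
  rewrite normr1 mul1r mulrA ler_peMl// (ger0_norm (expR_ge0 _)) -expRD -expR0 ler_expR.
  rewrite (_ : _ + _ = - a * (node n k.+1 - s)); last by rewrite mulrBr !mulNr opprK.
  by apply: mulr_ge0; rewrite ?oppr_ge0 ?subr_ge0 ltW.
- exact: (integrableZl _ _ (integrable_norm ih)).
Qed.

Lemma integrable_step n G : mu.-integrable D (EFin \o (fun s => step n G s * h s)) /\
  \int[mu]_(s in D) (step n G s * h s) =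
  \sum_(k < n.+1 * n.+1) (\int[mu]_(s in D) (\1_(cell n k) s * h s)) * G (node n k).
Proof.
have stepE s : step n G s * h s =
    \sum_(k < n.+1 * n.+1) (\1_(cell n k) s * h s) * G (node n k).
  by rewrite /step mulr_suml; apply: eq_bigr => k _; rewrite mulrAC.
have i1 (k : 'I_(n.+1 * n.+1)) : mu.-integrable D
    (EFin \o (fun s => (\1_(cell n k) s * h s) * G (node n k))).
  exact: (integrableZr _ _ (integrable_cell n k)).
have mD : measurable (D : set (measurableTypeR R)) by exact: measurable_itv.
have [i2 e2] := Rintegral_sum mD (index_enum 'I_(n.+1 * n.+1)) i1.
split; first by apply: (integrable_ext mD _ _ i2) => s _; rewrite stepE.
under eq_Rintegral do rewrite stepE.
rewrite e2; apply: eq_bigr => k _.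
by rewrite RintegralZr//; exact: integrable_cell.
Qed.

(** Sampling at most 1 to the left of s costs a factor e^(-a), uniformly in n: this
provides the domination for all the limits along step functions. *)
Lemma step_bound (G : R -> R) (M : R) : (forall t : R, 0 <= t -> `|G t| <= M * expR (a * t)) ->
  forall n (s : R), 0 <= s -> `|step n G s| <= M * expR (- a) * expR (a * s).
Proof.
move=> GM n s s0.
have M0 : 0 <= M.
  by have := le_trans (normr_ge0 _) (GM 0 (lexx _)); rewrite mulr0 expR0 mulr1.
have [sn|ns] := ltP s n.+1%:R; last first.
  by rewrite step_out// normr0 !mulr_ge0 ?expR_ge0.
have [|p [p0 ps sp ->]] := @step_in n s; first by rewrite s0.
apply: (le_trans (GM p p0)); rewrite -mulrA ler_wpM2l// -expRD ler_expR.
have : n.+1%:R^-1 <= 1 :> R by rewrite invf_le1 ?ltr0n// ler1n.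
move=> /(le_trans sp) sp1.
rewrite -subr_ge0 (_ : _ - _ = - a * (1 - (s - p))); last by ring.
by rewrite mulr_ge0// ?oppr_ge0 ?subr_ge0// ltW.
Qed.

Lemma cvg_step (G : R -> R) (s : R) : 0 <= s ->
  (forall p : nat -> R, (forall n, 0 <= p n) -> p n @[n --> \oo] --> s ->
     G (p n) @[n --> \oo] --> G s) ->
  step n G s @[n --> \oo] --> G s.
Proof.
move=> s0 cG.
have hp n : exists p, [/\ 0 <= p, `|p - s| <= n.+1%:R^-1 & s < n.+1%:R -> step n G s = G p].
  have [sn|ns] := ltP s n.+1%:R; last first.
    exists s; split => //; first by rewrite subrr normr0 invr_ge0.
  have [|p [p0 ps sp E]] := @step_in n s; first by rewrite s0.
  by exists p; split => //; rewrite distrC ger0_norm// subr_ge0.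
have [p hp'] := choice hp.
have cp : p n @[n --> \oo] --> s.
  apply/subr_cvg0/norm_cvg0P.
  apply: (@squeeze_cvgr _ _ _ _ (cst 0) (fun n : nat => n.+1%:R^-1)).
  - by apply: nearW => n; have [_ h1 _] := hp' n; rewrite normr_ge0.
  - exact: cvg_cst.
  - exact: cvg_harmonic.
have := cG p (fun n => let: And3 h1 _ _ := hp' n in h1) cp.
apply: cvg_trans; apply: near_eq_cvg; near=> n.
have [_ _ ->//] := hp' n.
rewrite (@le_lt_trans _ _ n%:R)// ?ltr_nat//.
by near: n; exact: nbhs_infty_ger.
Unshelve. all: end_near. Qed.

Lemma cvg_Rintegral_step (G : R -> R) (M : R) :
  continuous G -> (forall t : R, 0 <= t -> `|G t| <= M * expR (a * t)) ->
  [/\ mu.-integrable D (EFin \o (fun s => G s * h s)),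
      \int[mu]_(s in D) (step n G s * h s) @[n --> \oo] --> \int[mu]_(s in D) (G s * h s) &
      forall n, `|\int[mu]_(s in D) (step n G s * h s)| <= M * expR (- a) * weight_norm].
Proof.
move=> cG GM.
have mD : measurable (D : set (measurableTypeR R)) by exact: measurable_itv.
have bd n (s : R) : D s -> `|step n G s * h s| <= M * expR (- a) * `|expR (a * s) * h s|.
  rewrite /= in_itv /= andbT => s0; rewrite !normrM (ger0_norm (expR_ge0 _)) mulrA.
  by rewrite ler_wpM2r// step_bound.
have ib : mu.-integrable D (EFin \o (fun s => M * expR (- a) * `|expR (a * s) * h s|)).
  exact: (integrableZl _ _ (integrable_norm ih)).
have [i1 c1] : mu.-integrable D (EFin \o (fun s => G s * h s)) /\
    \int[mu]_(s in D) (step n G s * h s) @[n --> \oo] --> \int[mu]_(s in D) (G s * h s).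
  apply: (Rintegral_dominated_cvg mD _ _ _ ib bd).
  - move=> n; apply/measurable_EFinP.
    by have [] := integrable_step n G => /measurable_int.
  - move=> s; rewrite /= in_itv /= andbT => s0; apply: cvgM; last exact: cvg_cst.
    apply: cvg_step => // p _ ps; by apply: (cvg_comp _ _ ps); exact: cG.
split => // n.
have [i2 _] := integrable_step n G.
apply: (le_trans (le_normr_Rintegral mD i2)).
rewrite /weight_norm -RintegralZl//; last exact: integrable_norm.
apply: le_Rintegral => //; [exact: (integrable_norm i2)|exact: bd].
Qed.

End Step.

(** * Weighted integrals of a process *)

Section Process.
Context d (Omega : measurableType d) (R : realType) (P : probability Omega R).
Notation mu := (@lebesgue_measure R).
Notation D := (`[0, +oo[%classic : set R).
Variables (a : R) (h : R -> R) (g : R -> Omega -> R) (M : R).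
Hypothesis a0 : a < 0.
Hypothesis ih : mu.-integrable D (EFin \o (fun s => expR (a * s) * h s)).
Hypothesis g_meas : measurable_fun [set p : measurableTypeR R * Omega | 0 <= p.1]
  (fun p : measurableTypeR R * Omega => g p.1 p.2).
Hypothesis ig : forall t, 0 <= t -> P.-integrable setT (EFin \o g t).
Hypothesis gM : forall t, 0 <= t -> \int[P]_w `|g t w| <= M * expR (a * t).
Hypothesis gc : forall (s : R) (p : nat -> R), 0 <= s -> (forall n, 0 <= p n) ->
  p n @[n --> \oo] --> s -> \int[P]_w `|g s w - g (p n) w| @[n --> \oo] --> 0.

Let T1 := measurableTypeR R.
Let D2 : set (T1 * Omega) := [set p | 0 <= p.1].

Definition step_coef n k := \int[mu]_(s in D) (\1_(cell n k) s * h s).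

Definition step_sum n w := \sum_(k < n.+1 * n.+1) step_coef n k * g (node R n k) w.

Let mD : measurable (D : set T1).
Proof. exact: measurable_itv. Qed.

Let mD2 : measurable D2.
Proof.
rewrite (_ : D2 = fst @^-1` (D : set T1)).
  by rewrite -[_ @^-1` _]setTI; apply: measurable_fst.
by apply/seteqP; split => z /=; rewrite in_itv /= andbT.
Qed.

Let DE (s : R) : 0 <= s -> D s.
Proof. by rewrite /= in_itv /= andbT. Qed.

Let mg t : 0 <= t -> measurable_fun setT (g t).
Proof. by move=> t0; apply/measurable_EFinP; exact: measurable_int (ig t0). Qed.

Let mh2 : measurable_fun D2 (fun z : T1 * Omega => h z.1).
Proof.
apply: (measurable_comp mD) => //.
- by move=> _ [z z0 <-]; exact: DE.
- exact: measurable_weight ih.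
- by apply: measurable_funTS; exact: measurable_fst.
Qed.

Section Kernel.
Variables (k : R -> Omega -> R) (C : R).
Hypothesis mk : measurable_fun D2 (fun z => k z.1 z.2).
Hypothesis ik : forall s, 0 <= s -> P.-integrable setT (EFin \o k s).
Hypothesis kC : forall s, 0 <= s -> \int[P]_w `|k s w| <= C * expR (a * s).

(** Extension by 0 to the whole line, so that Fubini's theorem applies to the
product of Lebesgue measure and P. *)
Definition weighted_kernel := (fun z : T1 * Omega => k z.1 z.2 * h z.1) \_ D2.
Definition kernel_norm (s : R) := \int[P]_w `|k s w| * `|h s|.
Notation K := weighted_kernel.
Notation r := kernel_norm.

Lemma measurable_weighted_kernel : measurable_fun setT K.
Proof.
have m1 : measurable_fun D2 (fun z : T1 * Omega => k z.1 z.2 * h z.1).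
  exact: measurable_funM.
exact/(measurable_restrictT _ mD2).
Qed.

Lemma weighted_kernel_normE s : (\int[P]_w `|(K (s, w))%:E| = ((r \_ D) s)%:E)%E.
Proof.
rewrite patchE.
have -> : (s \in D) = (0 <= s) by rewrite mem_setE /= in_itv /= andbT.
have KE w : K (s, w) = if 0 <= s then k s w * h s else 0.
  by rewrite /K patchE; have -> : ((s, w) \in D2) = (0 <= s) by rewrite mem_setE.
case: ifP => s0; last first.
  under eq_integral do rewrite KE s0 abse0.
  by rewrite integral0.
rewrite /r -RintegralZr//; last exact: (integrable_norm (ik s0)).
rewrite /Rintegral fineK; last first.
  apply: integrable_fin_num => //.
  exact: (integrableZr _ _ (integrable_norm (ik s0))).
by apply: eq_integral => w _; rewrite KE s0 /= normrM.
Qed.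

Lemma measurable_kernel_norm : measurable_fun D r.
Proof.
suff H : measurable_fun setT (r \_ D : T1 -> R) by exact/(measurable_restrictT _ mD).
suff H : measurable_fun setT (EFin \o (r \_ D) : T1 -> \bar R) by exact/measurable_EFinP.
have -> : EFin \o (r \_ D) = (fun s => \int[P]_w `|(K (s, w))%:E|)%E.
  by apply/funext => s; rewrite weighted_kernel_normE.
apply: (@measurable_fun_fubini_tonelli_F _ _ T1 Omega _ P (fun z => `|(K z)%:E|%E)).
  apply: measurableT_comp => //; apply/measurable_EFinP.
  exact: measurable_weighted_kernel.
by move=> z; exact: abse_ge0.
Qed.

Lemma kernel_norm_bound (s : R) : D s -> `|r s| <= C * `|expR (a * s) * h s|.
Proof.
rewrite /= in_itv /= andbT => s0.
have d0 : 0 <= \int[P]_w `|k s w| by exact: Rintegral_ge0.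
rewrite /r !normrM normr_id (ger0_norm d0) (ger0_norm (expR_ge0 _)) mulrA.
by rewrite ler_wpM2r// kC.
Qed.

Lemma integrable_kernel_norm : mu.-integrable D (EFin \o r).
Proof.
apply: (integrable_dom mD _ measurable_kernel_norm kernel_norm_bound).
exact: (integrableZl _ _ (integrable_norm ih)).
Qed.

Lemma integral_weighted_kernel :
  (\int[mu]_s \int[P]_w `|(K (s, w))%:E| = (\int[mu]_(s in D) r s)%:E)%E.
Proof.
under eq_integral do rewrite weighted_kernel_normE.
rewrite Rintegral_mkcond /Rintegral fineK//.
apply: integrable_fin_num => //.
have := (@integrable_mkcond _ T1 R mu D (EFin \o (r : T1 -> R)) mD).1 integrable_kernel_norm.
by rewrite restrict_EFin.
Qed.

Lemma integrable_weighted_kernel : (mu \x P)%E.-integrable setT (EFin \o K).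
Proof.
apply/integrable12ltyP; last by rewrite integral_weighted_kernel ltry.
by apply/measurable_EFinP; exact: measurable_weighted_kernel.
Qed.

End Kernel.

Let m_step n : measurable_fun D2 (fun z : T1 * Omega => step n (g ^~ z.2) z.1).
Proof.
rewrite /step; apply: measurable_sum => k; apply: measurable_funTS.
apply: measurable_funM.
  apply: measurableT_comp => //.
  by apply: measurable_indic; exact: measurable_itv.
apply: measurableT_comp => //; apply: mg; exact: node_ge0.
Qed.

Let delta n (s : R) := \int[P]_w `|g s w - step n (g ^~ w) s|.

Let istep n (s : R) : 0 <= s -> P.-integrable setT (EFin \o (fun w => step n (g ^~ w) s)).
Proof.
move=> s0; rewrite /step; apply: (Rintegral_sum measurableT _ _).1 => k.
apply: (integrableZl _ _ (ig _)) => //; exact: node_ge0.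
Qed.

Let idelta n (s : R) : 0 <= s ->
  P.-integrable setT (EFin \o (fun w => `|g s w - step n (g ^~ w) s|)).
Proof. by move=> s0; exact: (integrable_norm (integrableB measurableT (ig s0) (istep n s0))). Qed.

Let M0 : 0 <= M.
Proof.
have := gM (lexx 0); rewrite mulr0 expR0 mulr1; apply: le_trans.
by apply: Rintegral_ge0.
Qed.

(* The domination, uniform in n, of the mean deviation of the sampled process. *)
Let delta_bound n (s : R) : 0 <= s -> delta n s <= M * (1 + expR (- a)) * expR (a * s).
Proof.
move=> s0; have [sn|ns] := ltP s n.+1%:R.
  have [|p [p0 ps sp E]] := @step_in _ n s; first by rewrite s0.
  apply: (@le_trans _ _ (\int[P]_w (`|g s w| + `|g p w|))).
    apply: le_Rintegral => //; first exact: idelta.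
      exact: (integrableD measurableT (integrable_norm (ig s0)) (integrable_norm (ig p0))).
    by move=> w _; rewrite E ler_normB.
  rewrite RintegralD//; last 2 first.
  - by apply: integrable_norm; exact: ig.
  - by apply: integrable_norm; exact: ig.
  rewrite mulrDr mulr1 mulrDl lerD ?gM//.
  apply: (le_trans (gM p0)); rewrite -mulrA ler_wpM2l// -expRD ler_expR.
  have : n.+1%:R^-1 <= 1 :> R by rewrite invf_le1 ?ltr0n// ler1n.
  move=> /(le_trans sp) sp1.
  rewrite -subr_ge0 (_ : _ - _ = - a * (1 - (s - p))); last by ring.
  by rewrite mulr_ge0// ?oppr_ge0 ?subr_ge0// ltW.
rewrite /delta; under eq_Rintegral do rewrite step_out// subr0.
apply: (le_trans (gM s0)).
by rewrite ler_wpM2r ?expR_ge0// mulrDr mulr1 lerDl mulr_ge0 ?expR_ge0.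
Qed.

Let cvg_delta (s : R) : 0 <= s -> delta n s @[n --> \oo] --> 0.
Proof.
move=> s0.
pose G t := \int[P]_w `|g s w - g t w|.
have G0 : G s = 0.
  by rewrite /G; under eq_Rintegral do rewrite subrr normr0; rewrite Rintegral_prob_cst.
rewrite -G0; have := @cvg_step _ G s s0.
have cG p : (forall n, 0 <= p n) -> p n @[n --> \oo] --> s -> G (p n) @[n --> \oo] --> G s.
  by move=> p0 ps; rewrite G0; exact: gc.
move=> /(_ cG); apply: cvg_trans; apply: near_eq_cvg; near=> n.
have [|p [p0 ps sp E]] := @step_in _ n s.
  rewrite s0 /= (@le_lt_trans _ _ n%:R)// ?ltr_nat//.
  by near: n; exact: nbhs_infty_ger.
by rewrite E /G /delta; apply: eq_Rintegral => w _; rewrite E.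
Unshelve. all: end_near. Qed.

Let kn n s w := g s w - step n (g ^~ w) s.

Let m_kn n : measurable_fun D2 (fun z : T1 * Omega => kn n z.1 z.2).
Proof. exact: measurable_funB. Qed.

Let i_kn n (s : R) : 0 <= s -> P.-integrable setT (EFin \o kn n s).
Proof. by move=> s0; exact: (integrableB measurableT (ig s0) (istep n s0)). Qed.

Let cvg_kernel_norm : \int[mu]_(s in D) kernel_norm (kn n) s @[n --> \oo] --> 0.
Proof.
have ib : mu.-integrable D (EFin \o (fun s => M * (1 + expR (- a)) * `|expR (a * s) * h s|)).
  exact: (integrableZl _ _ (integrable_norm ih)).
have H : \int[mu]_(s in D) kernel_norm (kn n) s @[n --> \oo] --> \int[mu]_(s in D) cst 0 s.
  apply: (Rintegral_dominated_cvg mD _ _ _ ib _).2.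
  - by move=> n; exact: measurable_kernel_norm (m_kn n) (i_kn n).
  - move=> s; rewrite /= in_itv /= andbT => s0.
    by rewrite -(mul0r `|h s|); apply: cvgM; [exact: cvg_delta|exact: cvg_cst].
  - by move=> n s Ds; apply: kernel_norm_bound => // t t0; exact: delta_bound.
by move: H; rewrite Rintegral_cst// mul0r.
Qed.

Let ZE w : (fun s => g s w * h s) \_ D = (fun s => weighted_kernel g (s, w)).
Proof.
apply/funext => s; rewrite /weighted_kernel !patchE.
by have -> : (s \in D) = ((s, w) \in D2) by rewrite !mem_setE /= in_itv /= andbT.
Qed.

Let iF := integrable_weighted_kernel g_meas ig gM.

Let mZ : measurable_fun setT (fun w => \int[mu]_(s in D) (g s w * h s)).
Proof.
have -> : (fun w => \int[mu]_(s in D) (g s w * h s)) =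
    fine \o (fun w => \int[mu]_s (weighted_kernel g (s, w))%:E)%E.
  by apply/funext => w; rewrite Rintegral_mkcond ZE.
apply: measurableT_comp; first exact: fine_measurable.
exact: measurable_fubini_G iF.
Qed.

Let step_sumE n w : step_sum n w = \int[mu]_(s in D) (step n (g ^~ w) s * h s).
Proof. by have [_ ->] := integrable_step a0 ih n (g ^~ w). Qed.

Let i_step_sum n : P.-integrable setT (EFin \o step_sum n).
Proof.
apply: (Rintegral_sum measurableT _ _).1 => k.
apply: (integrableZl _ _ (ig _)) => //; exact: node_ge0.
Qed.

Let L1_bound n : (\int[P]_w `|\int[mu]_(s in D) (g s w * h s) - step_sum n w|%:E <=
  (\int[mu]_(s in D) kernel_norm (kn n) s)%:E)%E.
Proof.
have bk s : 0 <= s -> \int[P]_w `|kn n s w| <= M * (1 + expR (- a)) * expR (a * s).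
  exact: delta_bound.
rewrite -(integral_weighted_kernel (m_kn n) (i_kn n) bk).
rewrite (@fubini_tonelli _ _ T1 Omega _ mu P (fun z => `|(weighted_kernel (kn n) z)%:E|%E))//; last first.
  apply: measurableT_comp => //; apply/measurable_EFinP.
  exact: measurable_weighted_kernel (m_kn n).
apply: ae_ge0_le_integral => //.
- apply/measurable_EFinP; apply: measurableT_comp => //; apply: measurable_funB => //.
  by apply/measurable_EFinP; exact: measurable_int (i_step_sum n).
- by move=> w _; exact: integral_ge0.
- apply: (@measurable_fun_fubini_tonelli_G _ _ T1 Omega _ mu (fun z => `|(weighted_kernel (kn n) z)%:E|%E)) => //.
  apply: measurableT_comp => //; apply/measurable_EFinP.
  exact: measurable_weighted_kernel (m_kn n).
have := ae_integrable2 iF; apply: filterS => w iw _.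
have iw' : mu.-integrable D (EFin \o (fun s => g s w * h s)).
  apply/(integrable_mkcond _ mD); rewrite restrict_EFin ZE.
  exact: iw.
have [is_ _] := integrable_step a0 ih n (g ^~ w).
rewrite step_sumE -RintegralB//.
have i3 := integrableB mD iw' is_.
apply: (@le_trans _ _ (\int[mu]_(s in D) `|g s w * h s - step n (g ^~ w) s * h s|)%:E).
  by rewrite lee_fin; exact: le_normr_Rintegral.
rewrite /Rintegral fineK; last by apply: integrable_fin_num => //; exact: (integrable_norm i3).
rewrite integral_mkcond le_eqVlt; apply/orP; left; apply/eqP.
apply: eq_integral => s _; rewrite /weighted_kernel /kn !patchE.
have -> : (s \in D) = ((s, w) \in D2) by rewrite !mem_setE /= in_itv /= andbT.
by case: ifP => _; rewrite ?abse0//= mulrBl.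
Qed.

(** By Fubini's theorem the L^1 error is at most the integral over s of
|h s| E|g_s - step_n g_s|, and the inner mean tends to 0 by continuity of g in the
mean.  The limit is thereby identified without any regularity of the sample paths
of g. *)
Lemma process_integral_L1 :
  P.-integrable setT (EFin \o (fun w => \int[mu]_(s in D) (g s w * h s))) /\
  \int[P]_w `|\int[mu]_(s in D) (g s w * h s) - step_sum n w| @[n --> \oo] --> 0.
Proof.
set Z := fun w => \int[mu]_(s in D) (g s w * h s).
have iZB n : P.-integrable setT (EFin \o (fun w => Z w - step_sum n w)).
  apply/integrableP; split.
    apply/measurable_EFinP; apply: measurable_funB => //.
    by apply/measurable_EFinP; exact: measurable_int (i_step_sum n).
  by apply: (le_lt_trans (L1_bound n)); rewrite ltry.
split.
  apply: (integrable_ext measurableT (fun w => (Z w - step_sum 0 w) + step_sum 0 w)).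
    by move=> w _; rewrite subrK.
  exact: (integrableD measurableT (iZB 0%N) (i_step_sum 0%N)).
apply: (@squeeze_cvgr _ _ _ _ (cst 0) (fun n => \int[mu]_(s in D) kernel_norm (kn n) s)).
- apply: nearW => n; apply/andP; split; first exact: Rintegral_ge0.
  rewrite -lee_fin; apply: le_trans (L1_bound n).
  rewrite /Rintegral fineK//; apply: integrable_fin_num => //; exact: (integrable_norm (iZB n)).
- exact: cvg_cst.
- exact: cvg_kernel_norm.
Qed.

End Process.

(** * Continuity in the mean of the impulse response *)

Section SecondMoment.
Context d (Omega : measurableType d) (R : realType) (P : probability Omega R).
Implicit Types X Y : Omega -> R.

Lemma integrable_prod X Y : measurable_fun setT X -> measurable_fun setT Y ->
  P.-integrable setT (EFin \o (fun w => X w ^+ 2)) ->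
  P.-integrable setT (EFin \o (fun w => Y w ^+ 2)) ->
  P.-integrable setT (EFin \o (fun w => X w * Y w)).
Proof.
move=> mX mY iX iY.
apply: (integrable_dom measurableT (fun w => X w ^+ 2 + Y w ^+ 2)).
- exact: measurable_funM.
- move=> w _; rewrite normrM -(real_normK (num_real (X w))) -(real_normK (num_real (Y w))).
  by have := sqr_ge0 (`|X w| - `|Y w|); have := normr_ge0 (X w); have := normr_ge0 (Y w); nra.
- exact: (integrableD measurableT iX iY).
Qed.

Lemma integrable_of_sqr X : measurable_fun setT X ->
  P.-integrable setT (EFin \o (fun w => X w ^+ 2)) -> P.-integrable setT (EFin \o X).
Proof.
move=> mX iX; apply: (integrable_dom measurableT (fun w => 1 + X w ^+ 2)) => //.
  move=> w _; rewrite -(real_normK (num_real (X w))).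
  by have := sqr_ge0 (`|X w| - 1); nra.
have i1 : P.-integrable setT (EFin \o cst (1 : R)) by exact: finite_measure_integrable_cst.
exact: (integrableD measurableT i1 iX).
Qed.

(** The variance of |X| is nonnegative. *)
Lemma Rintegral_norm_le_sqrt X : measurable_fun setT X ->
  P.-integrable setT (EFin \o (fun w => X w ^+ 2)) ->
  \int[P]_w `|X w| <= Num.sqrt (\int[P]_w (X w ^+ 2)).
Proof.
move=> mX iX2; have iX := integrable_norm (integrable_of_sqr mX iX2).
set m := \int[P]_w `|X w|.
have m0 : 0 <= m by exact: Rintegral_ge0.
rewrite -(ger0_norm m0) -sqrtr_sqr ler_wsqrtr//.
have i1 : P.-integrable setT (EFin \o (fun w => X w ^+ 2 - (m *+ 2) * `|X w|)).
  exact: (integrableB measurableT iX2 (integrableZl measurableT (m *+ 2) iX)).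
have ic : P.-integrable setT (EFin \o (cst (m ^+ 2))) by exact: finite_measure_integrable_cst.
have : 0 <= \int[P]_w (X w ^+ 2 - (m *+ 2) * `|X w| + m ^+ 2).
  apply: Rintegral_ge0 => w _.
  rewrite -(real_normK (num_real (X w))).
  by rewrite (_ : _ + _ = (`|X w| - m) ^+ 2) ?sqr_ge0//; ring.
rewrite RintegralD// Rintegral_prob_cst RintegralB//; last first.
  exact: (integrableZl measurableT (m *+ 2) iX).
by rewrite RintegralZl// -/m mulrnAl -expr2; lra.
Qed.

End SecondMoment.

Section KernelProcess.
Context d (Omega : measurableType d) (R : realType) (P : probability Omega R).
Notation mu := (@lebesgue_measure R).
Variables (alpha0 : R) (phi1 : R -> R) (g : R -> Omega -> R).
Hypothesis phi1_ge0 : forall x, 0 <= phi1 x.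
Hypothesis phi1_int : mu.-integrable setT (EFin \o phi1).
Hypothesis g_gauss : centered_gaussian_family P [set t : R | 0 <= t] g.
Hypothesis g_kernel : forall t s, 0 <= t -> 0 <= s ->
  ('E_P[fun w => (g t w * g s w)%R] = (K alpha0 phi1 t s)%:E)%E.

Lemma gaussian_family1 (I : Type) (D : set I) (X : I -> Omega -> R) i :
  centered_gaussian_family P D X -> D i -> exists s, centered_gaussian P (X i) s.
Proof.
move=> gX Di; have [//|s Xs] := gX 1%N (fun=> i) (fun=> 1) _.
exists s; move: Xs; rewrite (_ : (fun w => _) = X i)//.
by apply/funext => w; rewrite big_ord_recl big_ord0 addr0 mul1r.
Qed.

Let gs t : 0 <= t -> exists s, centered_gaussian P (g t) s.
Proof. exact: gaussian_family1 g_gauss. Qed.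

Lemma measurable_process t : 0 <= t -> measurable_fun setT (g t).
Proof. by move=> /gs[s []]. Qed.

Lemma integrable_process_sqr t : 0 <= t -> P.-integrable setT (EFin \o (fun w => g t w ^+ 2)).
Proof. by move=> /gs[s /gaussian_moment2[]]. Qed.

Lemma integrable_process t : 0 <= t -> P.-integrable setT (EFin \o g t).
Proof. by move=> /gs[s /gaussian_integrable]. Qed.

Lemma process_covariance t s : 0 <= t -> 0 <= s ->
  P.-integrable setT (EFin \o (fun w => g t w * g s w)) /\
  \int[P]_w (g t w * g s w) = K alpha0 phi1 t s.
Proof.
move=> t0 s0; split.
  by apply: integrable_prod; [exact: measurable_process..|exact: integrable_process_sqr|
    exact: integrable_process_sqr].
by have := g_kernel t0 s0; rewrite unlock /Rintegral => ->.
Qed.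

Lemma process_norm_le t : 0 <= t ->
  \int[P]_w `|g t w| <= Num.sqrt (K1 phi1 0) * expR (alpha0 * t).
Proof.
move=> t0; apply: (le_trans (Rintegral_norm_le_sqrt (measurable_process t0) (integrable_process_sqr t0))).
have [_] := process_covariance t0 t0.
under eq_Rintegral do rewrite -expr2.
move=> ->; rewrite /K subrr mulrDr expRD -expr2 sqrtrM ?sqr_ge0// sqrtr_sqr.
by rewrite (ger0_norm (expR_ge0 _)) mulrC.
Qed.

Lemma cvg_K1 (p : nat -> R) (l : R) : p n @[n --> \oo] --> l ->
  K1 phi1 (p n) @[n --> \oo] --> K1 phi1 l.
Proof.
move=> pl; rewrite /K1; apply: cvgM; first exact: cvg_cst.
have mphi : measurable_fun setT phi1 by apply/measurable_EFinP; exact: measurable_int phi1_int.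
apply: (Rintegral_dominated_cvg (mu := mu) measurableT phi1 _ _ _ _).2 => //.
- move=> n; apply: measurable_funM => //.
  apply: (measurableT_comp (continuous_measurable_fun (@continuous_cos R))).
  exact: measurable_funM.
- move=> x _; apply: cvgM; first exact: cvg_cst.
  have H : x * p n @[n --> \oo] --> x * l.
    by apply: cvgM; [exact: cvg_cst|exact: pl].
  by apply: (cvg_comp _ _ H); exact: continuous_cos.
- by move=> n x _; rewrite normrM ger0_norm// ler_piMr// cos_max.
Qed.

(** The second moment of g_s - g_t is K(s,s) - 2 K(s,t) + K(t,t), and K is continuous
because phi1 is integrable. *)
Lemma process_L1_continuous (s : R) (p : nat -> R) : 0 <= s -> (forall n, 0 <= p n) ->
  p n @[n --> \oo] --> s -> \int[P]_w `|g s w - g (p n) w| @[n --> \oo] --> 0.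
Proof.
move=> s0 p0 ps.
pose v n := K alpha0 phi1 s s - 2 * K alpha0 phi1 s (p n) + K alpha0 phi1 (p n) (p n).
have sqE n : P.-integrable setT (EFin \o (fun w => (g s w - g (p n) w) ^+ 2)) /\
    \int[P]_w ((g s w - g (p n) w) ^+ 2) = v n.
  have E w : (g s w - g (p n) w) ^+ 2 = g s w * g s w - 2 * (g s w * g (p n) w) +
     g (p n) w * g (p n) w by ring.
  have [i1 e1] := process_covariance s0 s0.
  have [i2 e2] := process_covariance s0 (p0 n).
  have [i3 e3] := process_covariance (p0 n) (p0 n).
  have i2' := integrableZl measurableT 2 i2.
  have i4 := integrableB measurableT i1 i2'.
  split.
    apply: (integrable_ext measurableT (fun w => g s w * g s w - 2 * (g s w * g (p n) w) +
      g (p n) w * g (p n) w)); first by move=> w _; rewrite E.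
    exact: (integrableD measurableT i4 i3).
  under eq_Rintegral do rewrite E.
  by rewrite RintegralD// RintegralB// RintegralZl// e1 e2 e3.
have v0 : v n @[n --> \oo] --> 0.
  have -> : 0 = K alpha0 phi1 s s - 2 * K alpha0 phi1 s s + K alpha0 phi1 s s by ring.
  have cexp (f : nat -> R) (l : R) : f n @[n --> \oo] --> l ->
      expR (alpha0 * f n) @[n --> \oo] --> expR (alpha0 * l).
    move=> fl; have H : alpha0 * f n @[n --> \oo] --> alpha0 * l.
      by apply: cvgM; [exact: cvg_cst|exact: fl].
    by apply: (cvg_comp _ _ H); exact: continuous_expR.
  apply: cvgD; first apply: cvgB; first exact: cvg_cst.
    apply: cvgM; first exact: cvg_cst.
    apply: cvgM; first by apply: (cexp (fun n => s + p n) (s + s)); apply: cvgD; [exact: cvg_cst|exact: ps].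
    by apply: (@cvg_K1 (fun n => s - p n)); apply: cvgB; [exact: cvg_cst|exact: ps].
  apply: cvgM; first by apply: (cexp (fun n => p n + p n) (s + s)); apply: cvgD; exact: ps.
  by apply: (@cvg_K1 (fun n => p n - p n)); apply: cvgB; exact: ps.
apply: (@squeeze_cvgr _ _ _ _ (cst 0) (fun n => Num.sqrt (v n))).
- apply: nearW => n; rewrite Rintegral_ge0//=.
  have [i e] := sqE n; rewrite -e; apply: Rintegral_norm_le_sqrt => //.
  by apply: measurable_funB; exact: measurable_process.
- exact: cvg_cst.
- rewrite -sqrtr0; apply: (cvg_comp _ _ v0); exact: sqrt_continuous.
Qed.

End KernelProcess.

(** * Spectral description of the measurements *)

Section Spectrum.
Context (R : realType).
Notation mu := (@lebesgue_measure R).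
Notation D := (`[0, +oo[%classic : set R).

(** Real and imaginary parts of the entry of U with input h.  The estimates are
carried out on these two real functions. *)
Definition Ure (alpha : R) (h : R -> R) (x : R) : R :=
  2^-1 * \int[mu]_(s in D) (expR (alpha * s) * cos (x * s) * h s).

Definition Uim (alpha : R) (h : R -> R) (x : R) : R :=
  2^-1 * \int[mu]_(s in D) (expR (alpha * s) * sin (x * s) * h s).

Variables (alpha : R) (h : R -> R).
Hypothesis alpha0 : alpha < 0.
Hypothesis ih : mu.-integrable D (EFin \o (fun s => expR (alpha * s) * h s)).

(** The representative of the approximating sum [step_sum] of the process: the
same sum, with e^(alpha t) cos(x t) or e^(alpha t) sin(x t) in place of g(t). *)
Definition step_freq (trigf : R -> R) (n : nat) (x : R) : R :=
  \sum_(k < n.+1 * n.+1) step_coef h n k *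
    (expR (alpha * node R n k) * trigf (x * node R n k)).

Lemma step_freq_cvg (trigf : R -> R) (x : R) :
  continuous trigf -> (forall y, `|trigf y| <= 1) ->
  [/\ mu.-integrable D (EFin \o (fun s => expR (alpha * s) * trigf (x * s) * h s)),
      step_freq trigf n x @[n --> \oo] -->
        \int[mu]_(s in D) (expR (alpha * s) * trigf (x * s) * h s) &
      forall n, `|step_freq trigf n x| <= expR (- alpha) * weight_norm alpha h].
Proof.
move=> ct t1.
have cG : continuous (fun s => expR (alpha * s) * trigf (x * s)).
  move=> s; apply: cvgM.
    have H : alpha * t @[t --> s] --> alpha * s by apply: cvgM; [exact: cvg_cst|exact: cvg_id].
    by apply: (cvg_comp _ _ H); exact: continuous_expR.
  have H : x * t @[t --> s] --> x * s by apply: cvgM; [exact: cvg_cst|exact: cvg_id].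
  by apply: (cvg_comp _ _ H); exact: ct.
have GM (t : R) : 0 <= t -> `|expR (alpha * t) * trigf (x * t)| <= 1 * expR (alpha * t).
  by move=> _; rewrite normrM (ger0_norm (expR_ge0 _)) mul1r ler_piMr// expR_ge0.
have [i1 c1 b1] := cvg_Rintegral_step alpha0 ih cG GM.
have E n : step_freq trigf n x =
    \int[mu]_(s in D) (step n (fun s => expR (alpha * s) * trigf (x * s)) s * h s).
  by have [_ ->] := integrable_step alpha0 ih n (fun s => expR (alpha * s) * trigf (x * s)).
split => //.
- by move: c1; apply: cvg_trans; apply: near_eq_cvg; apply: nearW => n; rewrite E.
- by move=> n; rewrite E -[X in _ <= X * _]mul1r; exact: b1.
Qed.

Lemma measurable_step_freq trigf n : continuous trigf ->
  measurable_fun setT (step_freq trigf n).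
Proof.
move=> ct; apply: measurable_sum => k; apply: measurable_funM => //.
apply: measurable_funM => //.
apply: (measurableT_comp (continuous_measurable_fun ct)).
exact: measurable_funM.
Qed.

Lemma cvg_step_freq_cos x : step_freq cos n x @[n --> \oo] --> 2 * Ure alpha h x.
Proof.
have [_ H _] := step_freq_cvg x (@continuous_cos R) (@cos_max R).
by rewrite /Ure mulrA divff ?mul1r ?pnatr_eq0.
Qed.

Lemma cvg_step_freq_sin x : step_freq sin n x @[n --> \oo] --> 2 * Uim alpha h x.
Proof.
have [_ H _] := step_freq_cvg x (@continuous_sin R) (@sin_max R).
by rewrite /Uim mulrA divff ?mul1r ?pnatr_eq0.
Qed.

Lemma measurable_Ure : measurable_fun setT (Ure alpha h).
Proof.
have -> : Ure alpha h = (fun x => 2^-1 * (2 * Ure alpha h x)).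
  by apply/funext => x; rewrite mulKf ?pnatr_eq0.
apply: measurable_funM => //.
apply: (@measurable_fun_cvg _ _ _ _ (step_freq cos)) => [n|x _].
  exact: measurable_step_freq (@continuous_cos R).
exact: cvg_step_freq_cos.
Qed.

Lemma measurable_Uim : measurable_fun setT (Uim alpha h).
Proof.
have -> : Uim alpha h = (fun x => 2^-1 * (2 * Uim alpha h x)).
  by apply/funext => x; rewrite mulKf ?pnatr_eq0.
apply: measurable_funM => //.
apply: (@measurable_fun_cvg _ _ _ _ (step_freq sin)) => [n|x _].
  exact: measurable_step_freq (@continuous_sin R).
exact: cvg_step_freq_sin.
Qed.

Lemma Ure_bound x : `|Ure alpha h x| <= expR (- alpha) * weight_norm alpha h.
Proof.
have [_ _ b] := step_freq_cvg x (@continuous_cos R) (@cos_max R).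
have H : `|2 * Ure alpha h x| <= expR (- alpha) * weight_norm alpha h.
  have c : `|step_freq cos n x| @[n --> \oo] --> `|2 * Ure alpha h x|.
    by apply: cvg_norm; exact: cvg_step_freq_cos.
  by apply: (cvgr_to_le c); apply: nearW => n; exact: b.
by apply: le_trans H; rewrite [leRHS]normrM normr_nat ler_peMl// ler1n.
Qed.

Lemma Uim_bound x : `|Uim alpha h x| <= expR (- alpha) * weight_norm alpha h.
Proof.
have [_ _ b] := step_freq_cvg x (@continuous_sin R) (@sin_max R).
have H : `|2 * Uim alpha h x| <= expR (- alpha) * weight_norm alpha h.
  have c : `|step_freq sin n x| @[n --> \oo] --> `|2 * Uim alpha h x|.
    by apply: cvg_norm; exact: cvg_step_freq_sin.
  by apply: (cvgr_to_le c); apply: nearW => n; exact: b.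
by apply: le_trans H; rewrite [leRHS]normrM normr_nat ler_peMl// ler1n.
Qed.

Lemma Ure_even x : Ure alpha h (- x) = Ure alpha h x.
Proof. by rewrite /Ure; congr (_ * _); apply: eq_Rintegral => s _; rewrite mulNr cosN. Qed.

Lemma Uim_odd x : Uim alpha h (- x) = - Uim alpha h x.
Proof.
have [i _ _] := step_freq_cvg x (@continuous_sin R) (@sin_max R).
rewrite /Uim -mulrN; congr (_ * _); rewrite -[RHS]mulN1r -RintegralZl//.
by apply: eq_Rintegral => s _; rewrite mulNr sinN; ring.
Qed.

End Spectrum.

Section Gram.
Context (R : realType).
Notation mu := (@lebesgue_measure R).
Notation D := (`[0, +oo[%classic : set R).
Variables (N : nat) (alpha sigma : R) (phi : R -> R) (h : 'I_N -> R -> R).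
Hypothesis alpha0 : alpha < 0.
Hypothesis phi_ge0 : forall x, 0 <= phi x.
Hypothesis iphi : mu.-integrable setT (EFin \o phi).
Hypothesis ih : forall i, mu.-integrable D (EFin \o (fun s => expR (alpha * s) * h i s)).

(** The real part of V, which is V itself when phi is even; it is the covariance
matrix of the measurements. *)
Definition gram : 'M[R]_N := \matrix_(i, j)
  (2 * \int[mu]_x (phi x * (Ure alpha (h i) x * Ure alpha (h j) x +
                            Uim alpha (h i) x * Uim alpha (h j) x)))
  + (sigma ^+ 2)%:M.

Lemma gramC i j : gram i j = gram j i.
Proof.
rewrite !mxE (eq_sym j i); congr (_ * _ + _); apply: eq_Rintegral => x _.
by rewrite (mulrC (Ure _ _ _)) (mulrC (Uim _ _ _)).
Qed.

Let mphi : measurable_fun setT phi.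
Proof. by apply/measurable_EFinP; exact: measurable_int iphi. Qed.

Let mUre i := measurable_Ure alpha0 (ih i).
Let mUim i := measurable_Uim alpha0 (ih i).

Lemma integrable_spectral_prod (p q : R -> R) i :
  measurable_fun setT p -> measurable_fun setT q ->
  mu.-integrable setT (EFin \o (fun x => phi x * (p x ^+ 2 + q x ^+ 2))) ->
  mu.-integrable setT
    (EFin \o (fun x => phi x * (p x * Ure alpha (h i) x + q x * Uim alpha (h i) x))).
Proof.
move=> mp mq ipq; pose C := expR (- alpha) * weight_norm alpha (h i).
have mUr := mUre i; have mUi := mUim i.
apply: (integrable_dom (mu := mu) measurableT
  (fun x => phi x * (p x ^+ 2 + q x ^+ 2) + 2 * C ^+ 2 * phi x)).
- by apply: measurable_funM => //; apply: measurable_funD; exact: measurable_funM.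
- move=> x _; rewrite normrM (ger0_norm (phi_ge0 x)).
  rewrite [leRHS](_ : _ = phi x * ((p x ^+ 2 + C ^+ 2) + (q x ^+ 2 + C ^+ 2))); last by ring.
  have sq (u v : R) : `|v| <= C -> `|u * v| <= u ^+ 2 + C ^+ 2.
    move=> vC; rewrite normrM -(real_normK (num_real u)).
    have := sqr_ge0 (`|u| - C); have := normr_ge0 u; have := normr_ge0 v; nra.
  rewrite ler_wpM2l// (le_trans (ler_normD _ _))// lerD// sq//.
    exact: Ure_bound.
  exact: Uim_bound.
- exact: (integrableD measurableT ipq (integrableZl measurableT (2 * C ^+ 2) iphi)).
Qed.

Lemma integrable_U_sqr i : mu.-integrable setT
  (EFin \o (fun x => phi x * (Ure alpha (h i) x ^+ 2 + Uim alpha (h i) x ^+ 2))).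
Proof.
have mUr := mUre i; have mUi := mUim i.
pose C := expR (- alpha) * weight_norm alpha (h i).
apply: (integrable_mulr_bounded measurableT (C ^+ 2 + C ^+ 2)) => //.
  by apply: measurable_funD; exact: measurable_funX.
move=> x _; rewrite ger0_norm ?addr_ge0 ?sqr_ge0//.
have sq (v : R) : `|v| <= C -> v ^+ 2 <= C ^+ 2.
  by move=> vC; rewrite -(real_normK (num_real v)) ler_sqr// nnegrE// (le_trans _ vC).
by rewrite lerD// sq//; [exact: Ure_bound|exact: Uim_bound].
Qed.

Lemma integrable_gram i j : mu.-integrable setT
  (EFin \o (fun x => phi x * (Ure alpha (h i) x * Ure alpha (h j) x +
                              Uim alpha (h i) x * Uim alpha (h j) x))).
Proof.
by apply: (integrable_spectral_prod j); [exact: mUre|exact: mUim|exact: integrable_U_sqr].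
Qed.

Lemma gram_quadratic (b : 'I_N -> R) :
  \sum_(i < N) \sum_(j < N) b i * b j * gram i j =
  2 * \int[mu]_x (phi x * ((\sum_(i < N) b i * Ure alpha (h i) x) ^+ 2 +
                           (\sum_(i < N) b i * Uim alpha (h i) x) ^+ 2))
  + sigma ^+ 2 * \sum_(i < N) b i ^+ 2.
Proof.
pose c i j x := phi x * (Ure alpha (h i) x * Ure alpha (h j) x +
                              Uim alpha (h i) x * Uim alpha (h j) x).
have E x : phi x * ((\sum_(i < N) b i * Ure alpha (h i) x) ^+ 2 +
                    (\sum_(i < N) b i * Uim alpha (h i) x) ^+ 2) =
   \sum_(i < N) \sum_(j < N) b i * b j * c i j x.
  rewrite !expr2 !mulr_suml -big_split mulr_sumr; apply: eq_bigr => i _ /=.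
  rewrite !mulr_sumr -big_split mulr_sumr; apply: eq_bigr => j _ /=.
  by rewrite /c; ring.
under eq_Rintegral do rewrite E.
have ic i j : mu.-integrable setT (EFin \o (fun x => b i * b j * c i j x)).
  exact: (integrableZl measurableT _ (integrable_gram i j)).
have s1 i := Rintegral_sum (mu := mu) measurableT (index_enum 'I_N) (ic i).
have [_ ->] := Rintegral_sum (mu := mu) measurableT (index_enum 'I_N) (fun i => (s1 i).1).
rewrite !mulr_sumr -big_split; apply: eq_bigr => i _ /=.
rewrite (s1 i).2 (_ : sigma ^+ 2 * b i ^+ 2 =
    \sum_(j < N) b i * b j * ((sigma ^+ 2)%:M : 'M[R]_N) i j); last first.
  rewrite (bigD1 i)//= !mxE eqxx mulr1n big1 ?addr0; first by ring.
  by move=> j ji; rewrite !mxE eq_sym (negbTE ji) mulr0n mulr0.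
rewrite mulr_sumr -big_split; apply: eq_bigr => j _ /=.
by rewrite RintegralZl ?integrable_gram// !mxE; rewrite -/(c i j); ring.
Qed.

(** The spectral part is positive semidefinite, and the noise part is definite. *)
Lemma gram_unit : 0 < sigma -> gram \in unitmx.
Proof.
move=> s0; rewrite -row_free_unit; apply: inj_row_free => v vG.
pose b i := v 0 i.
have : \sum_(i < N) \sum_(j < N) b i * b j * gram i j = 0.
  rewrite exchange_big big1//= => j _.
  have := congr1 (fun A : 'rV_N => A 0 j) vG; rewrite !mxE => H.
  rewrite (eq_bigr (fun i => b j * (v 0 i * gram i j))).
    by rewrite -mulr_sumr H mulr0.
  by move=> i _; rewrite /b; ring.
rewrite gram_quadratic => H.
have I0 : 0 <= 2 * \int[mu]_x (phi x * ((\sum_(i < N) b i * Ure alpha (h i) x) ^+ 2 +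
                           (\sum_(i < N) b i * Uim alpha (h i) x) ^+ 2)).
  by rewrite mulr_ge0//; apply: Rintegral_ge0 => x _; rewrite mulr_ge0// addr_ge0 ?sqr_ge0.
have S0 : 0 <= \sum_(i < N) b i ^+ 2 by apply: sumr_ge0 => i _; exact: sqr_ge0.
have s2 : 0 < sigma ^+ 2 by exact: exprn_gt0.
have /eqP : \sum_(i < N) b i ^+ 2 = 0.
  apply/eqP; rewrite eq_le S0 andbT -(pmulr_rle0 _ s2).
  by move: H I0; set A := 2 * _; set B := sigma ^+ 2 * _ => H I0; rewrite -H lerDr.
rewrite psumr_eq0; last by move=> i _; exact: sqr_ge0.
move=> /allP b0; apply/rowP => i; rewrite mxE.
by have /= := b0 i (mem_index_enum i); rewrite sqrf_eq0 => /eqP.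
Qed.

End Gram.

Section Filter.
Context d (Omega : measurableType d) (R : realType) (P : probability Omega R).
Notation mu := (@lebesgue_measure R).
Notation D := (`[0, +oo[%classic : set R).
Variables (N : nat) (alpha sigma M : R) (phi : R -> R) (h : 'I_N -> R -> R).
Variables (g : R -> Omega -> R) (e : 'I_N -> Omega -> R).
Hypothesis alpha0 : alpha < 0.
Hypothesis phi_ge0 : forall x, 0 <= phi x.
Hypothesis iphi : mu.-integrable setT (EFin \o phi).
Hypothesis ih : forall i, mu.-integrable D (EFin \o (fun s => expR (alpha * s) * h i s)).
Hypothesis g_meas : measurable_fun [set p : measurableTypeR R * Omega | 0 <= p.1]
  (fun p : measurableTypeR R * Omega => g p.1 p.2).
Hypothesis ig : forall t, 0 <= t -> P.-integrable setT (EFin \o g t).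
Hypothesis gM : forall t, 0 <= t -> \int[P]_w `|g t w| <= M * expR (alpha * t).
Hypothesis gc : forall (s : R) (p : nat -> R), 0 <= s -> (forall n, 0 <= p n) ->
  p n @[n --> \oo] --> s -> \int[P]_w `|g s w - g (p n) w| @[n --> \oo] --> 0.
Hypothesis ie : forall i, P.-integrable setT (EFin \o e i).
Variables (X : Omega -> R) (p q : R -> R).
Hypothesis iX : P.-integrable setT (EFin \o X).
Hypotheses (mp : measurable_fun setT p) (mq : measurable_fun setT q).
Hypothesis ipq : mu.-integrable setT (EFin \o (fun x => phi x * (p x ^+ 2 + q x ^+ 2))).

(** Variance of the Gaussian variable represented by A + jB. *)
Definition spec_var (A B : R -> R) : R :=
  2^-1 * \int[mu]_x (phi x * (A x ^+ 2 + B x ^+ 2)).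

(* The finite combinations of X, of values of g and of noise are Gaussian, with X
   represented by p + jq and g(t) by e^(alpha t) e^(jxt). *)
Hypothesis charH : forall (m : nat) (c tau : nat -> R) (a : R) (b : 'I_N -> R) (th : R),
  (forall k, 0 <= tau k) ->
  \int[P]_w cos (a * X w + \sum_(k < m) c k * g (tau k) w + \sum_(i < N) b i * e i w + th) =
  cos th * expR (- ((spec_var
     (fun x => a * p x + \sum_(k < m) c k * (expR (alpha * tau k) * cos (x * tau k)))
     (fun x => a * q x + \sum_(k < m) c k * (expR (alpha * tau k) * sin (x * tau k)))
   + sigma ^+ 2 * \sum_(i < N) b i ^+ 2) / 2)).

Let Y (i : 'I_N) w := \int[mu]_(s in D) (g s w * h i s) + e i w.

Let mphi : measurable_fun setT phi.
Proof. by apply/measurable_EFinP; exact: measurable_int iphi. Qed.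

Let mX : measurable_fun setT X.
Proof. by apply/measurable_EFinP; exact: measurable_int iX. Qed.

Let mcos : measurable_fun setT (@cos R).
Proof. exact: continuous_measurable_fun (@continuous_cos R). Qed.

Let zi i := process_integral_L1 alpha0 (ih i) g_meas ig gM gc.

Let iY i : P.-integrable setT (EFin \o Y i).
Proof. by have [iz _] := zi i; exact: (integrableD measurableT iz (ie i)). Qed.

Definition output_spec_var (a : R) (b : 'I_N -> R) : R :=
  spec_var (fun x => a * p x + 2 * \sum_(i < N) b i * Ure alpha (h i) x)
           (fun x => a * q x + 2 * \sum_(i < N) b i * Uim alpha (h i) x)
  + sigma ^+ 2 * \sum_(i < N) b i ^+ 2.

(** Dominated convergence: p and q are square-integrable against phi, and the
representatives of the sums are bounded uniformly in n. *)
Lemma cvg_spec_var (a : R) (b : 'I_N -> R) :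
  spec_var (fun x => a * p x + \sum_(i < N) b i * step_freq alpha (h i) cos n x)
           (fun x => a * q x + \sum_(i < N) b i * step_freq alpha (h i) sin n x) @[n --> \oo]
  --> spec_var (fun x => a * p x + 2 * \sum_(i < N) b i * Ure alpha (h i) x)
           (fun x => a * q x + 2 * \sum_(i < N) b i * Uim alpha (h i) x).
Proof.
rewrite /spec_var; apply: cvgM; first exact: cvg_cst.
pose C := \sum_(i < N) `|b i| * (expR (- alpha) * weight_norm alpha (h i)).
have sb trigf n x : continuous trigf -> (forall y, `|trigf y| <= 1) ->
    `|\sum_(i < N) b i * step_freq alpha (h i) trigf n x| <= C.
  move=> ct t1; apply: (le_trans (ler_norm_sum _ _ _)); apply: ler_sum => i _.
  rewrite normrM ler_wpM2l//.
  by have [_ _ ->] := step_freq_cvg alpha0 (ih i) x ct t1.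
have sq (u v : R) : `|v| <= C -> (u + v) ^+ 2 <= 2 * u ^+ 2 + 2 * C ^+ 2.
  move=> vC; have : v ^+ 2 <= C ^+ 2.
    rewrite -(real_normK (num_real v)) ler_sqr// nnegrE// (le_trans _ vC)//.
  have := sqr_ge0 (u - v); nra.
pose bnd x := 2 * a ^+ 2 * (phi x * (p x ^+ 2 + q x ^+ 2)) + 4 * C ^+ 2 * phi x.
have ib : mu.-integrable setT (EFin \o bnd).
  exact: (integrableD measurableT (integrableZl measurableT (2 * a ^+ 2) ipq)
    (integrableZl measurableT (4 * C ^+ 2) iphi)).
apply: (Rintegral_dominated_cvg (mu := mu) measurableT _ _ _ ib _).2.
- move=> n; apply: measurable_funM => //; apply: measurable_funD;
  (apply: measurable_funX; apply: measurable_funD; first exact: measurable_funM);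
  apply: measurable_sum => i; apply: measurable_funM => //.
  + exact: measurable_step_freq (@continuous_cos R).
  + exact: measurable_step_freq (@continuous_sin R).
- move=> x _; apply: cvgM; first exact: cvg_cst.
  apply: cvgD; rewrite expr2.
    under eq_cvg do rewrite expr2.
    have H : a * p x + \sum_(i < N) b i * step_freq alpha (h i) cos n x @[n --> \oo] -->
       a * p x + 2 * \sum_(i < N) b i * Ure alpha (h i) x.
      apply: cvgD; first exact: cvg_cst.
      rewrite mulr_sumr; apply: cvg_sumr => i.
      rewrite mulrCA; apply: cvgM; first exact: cvg_cst.
      exact: cvg_step_freq_cos.
    exact: cvgM.
  under eq_cvg do rewrite expr2.
  have H : a * q x + \sum_(i < N) b i * step_freq alpha (h i) sin n x @[n --> \oo] -->
     a * q x + 2 * \sum_(i < N) b i * Uim alpha (h i) x.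
    apply: cvgD; first exact: cvg_cst.
    rewrite mulr_sumr; apply: cvg_sumr => i.
    rewrite mulrCA; apply: cvgM; first exact: cvg_cst.
    exact: cvg_step_freq_sin.
  exact: cvgM.
- move=> n x _; rewrite normrM (ger0_norm (phi_ge0 x)) ger0_norm ?addr_ge0 ?sqr_ge0//.
  have h1 := sq (a * p x) _ (sb cos n x (@continuous_cos R) (@cos_max R)).
  have h2 := sq (a * q x) _ (sb sin n x (@continuous_sin R) (@sin_max R)).
  apply: (le_trans (ler_wpM2l (phi_ge0 x) (lerD h1 h2))).
  by rewrite le_eqVlt; apply/orP; left; apply/eqP; rewrite /bnd; ring.
Qed.

(** Replacing the output by its step sums changes the left-hand side by at most the
L^1 error, cos being 1-Lipschitz; the step sums fall under [charH], and their
variances converge by [cvg_spec_var]. *)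
Lemma output_char a b th :
  \int[P]_w cos (a * X w + \sum_(i < N) b i * Y i w + th) =
  cos th * expR (- (output_spec_var a b / 2)).
Proof.
pose Z i w := \int[mu]_(s in D) (g s w * h i s).
have iZ i : P.-integrable setT (EFin \o Z i) by have [] := zi i.
have is_ i n : P.-integrable setT (EFin \o step_sum (h i) g n).
  apply: (Rintegral_sum measurableT _ _).1 => k.
  apply: (integrableZl _ _ (ig _)) => //; exact: node_ge0.
have me i : measurable_fun setT (e i) by apply/measurable_EFinP; exact: measurable_int (ie i).
pose W w := a * X w + \sum_(i < N) b i * e i w + th.
have mW : measurable_fun setT W.
  apply: measurable_funD => //; apply: measurable_funD; first exact: measurable_funM.
  by apply: measurable_sum => i; exact: measurable_funM.
pose T w := \sum_(i < N) b i * Z i w + W w.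
pose Tn n w := \sum_(i < N) b i * step_sum (h i) g n w + W w.
have mT : measurable_fun setT T.
  apply: measurable_funD => //; apply: measurable_sum => i; apply: measurable_funM => //.
  by apply/measurable_EFinP; exact: measurable_int (iZ i).
have mTn n : measurable_fun setT (Tn n).
  apply: measurable_funD => //; apply: measurable_sum => i; apply: measurable_funM => //.
  by apply/measurable_EFinP; exact: measurable_int (is_ i n).
have icos (V : Omega -> R) : measurable_fun setT V -> P.-integrable setT (EFin \o (cos \o V)).
  move=> mV; apply: (@integrable_bounded _ _ _ P _ 1); first exact: measurableT_comp.
  by move=> w; exact: cos_max.
have cT : \int[P]_w cos (Tn n w) @[n --> \oo] --> \int[P]_w cos (T w).
  apply/subr_cvg0/norm_cvg0P.
  apply: (@squeeze_cvgr _ _ _ _ (cst 0)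
    (fun n => \sum_(i < N) `|b i| * \int[P]_w `|Z i w - step_sum (h i) g n w|)).
  - apply: nearW => n; rewrite normr_ge0 /=.
    have iB i := integrable_norm (integrableB measurableT (iZ i) (is_ i n)).
    have iBb i := integrableZl measurableT `|b i| (iB i).
    have [i2 e2] := Rintegral_sum measurableT (index_enum 'I_N) iBb.
    rewrite -RintegralB ?icos//.
    have i3 := integrableB measurableT (icos _ (mTn n)) (icos _ mT).
    apply: (le_trans (le_normr_Rintegral measurableT i3)).
    apply: (@le_trans _ _ (\int[P]_w \sum_(i < N) `|b i| * `|Z i w - step_sum (h i) g n w|)).
      apply: le_Rintegral => //; first exact: integrable_norm.
      move=> w _; apply: (le_trans (cos_lipschitz _ _)).
      rewrite /Tn /T opprD addrACA subrr addr0 -sumrB.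
      apply: (le_trans (ler_norm_sum _ _ _)); apply: ler_sum => i _.
      by rewrite -mulrBr normrM distrC.
    by rewrite e2; apply: ler_sum => i _; rewrite RintegralZl.
  - exact: cvg_cst.
  - have z0 : \sum_(i < N) `|b i| * 0 = 0 by rewrite big1// => i _; rewrite mulr0.
    rewrite -[X in _ --> X]z0; apply: cvg_sumr => i; apply: cvgM; first exact: cvg_cst.
    by have [] := zi i.
have eT : \int[P]_w cos (a * X w + \sum_(i < N) b i * Y i w + th) = \int[P]_w cos (T w).
  apply: eq_Rintegral => w _; congr cos; rewrite /T /W /Y.
  under eq_bigr do rewrite mulrDr.
  by rewrite big_split /= /Z; ring.
rewrite eT; apply: cvg_unique cT _ => //.
pose c n (k : nat) := \sum_(i < N) b i * step_coef (h i) n k.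
have eTn n : \int[P]_w cos (Tn n w) = cos th * expR (- ((spec_var
      (fun x => a * p x + \sum_(i < N) b i * step_freq alpha (h i) cos n x)
      (fun x => a * q x + \sum_(i < N) b i * step_freq alpha (h i) sin n x) +
      sigma ^+ 2 * \sum_(i < N) b i ^+ 2) / 2)).
  have swap (V : nat -> R) : \sum_(k < n.+1 * n.+1) c n k * V k =
      \sum_(i < N) b i * \sum_(k < n.+1 * n.+1) step_coef (h i) n k * V k.
    under eq_bigr do rewrite /c mulr_suml.
    rewrite exchange_big /=; apply: eq_bigr => i _; rewrite mulr_sumr.
    by apply: eq_bigr => k _; rewrite mulrA.
  have := charH (n.+1 * n.+1) (c n) a b th (@node_ge0 R n).
  rewrite /spec_var.
  under [in X in X = _ -> _]eq_Rintegral do rewrite (swap (fun k => g (node R n k) _)).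
  under [in X in _ = X -> _]eq_Rintegral do rewrite
    (swap (fun k => expR (alpha * node R n k) * cos (_ * node R n k)))
    (swap (fun k => expR (alpha * node R n k) * sin (_ * node R n k))).
  move=> <-; apply: eq_Rintegral => w _; congr cos; rewrite /Tn /W /step_sum; ring.
have -> : (fun n => \int[P]_w cos (Tn n w)) = (fun n => _) := funext eTn.
apply: cvgM; first exact: cvg_cst.
have H : - ((spec_var
      (fun x => a * p x + \sum_(i < N) b i * step_freq alpha (h i) cos n x)
      (fun x => a * q x + \sum_(i < N) b i * step_freq alpha (h i) sin n x) +
      sigma ^+ 2 * \sum_(i < N) b i ^+ 2) / 2) @[n --> \oo] --> - (output_spec_var a b / 2).
  apply: cvgN; apply: cvgM; last exact: cvg_cst.
  by apply: cvgD; [exact: cvg_spec_var|exact: cvg_cst].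
by apply: (cvg_comp _ _ H); exact: continuous_expR.
Qed.

(** Covariance of X with the i-th measurement: the factor 1/2 of [spec_var] cancels
against the representative 2 U_i of the output. *)
Definition cross_cov (i : 'I_N) : R :=
  \int[mu]_x (phi x * (p x * Ure alpha (h i) x + q x * Uim alpha (h i) x)).

Lemma output_spec_varE a b : output_spec_var a b =
  a ^+ 2 * spec_var p q + 2 * a * \sum_(i < N) b i * cross_cov i +
  \sum_(i < N) \sum_(j < N) b i * b j * gram alpha sigma phi h i j.
Proof.
rewrite gram_quadratic// /output_spec_var /spec_var addrA; congr (_ + _).
pose u x := \sum_(i < N) b i * Ure alpha (h i) x.
pose v x := \sum_(i < N) b i * Uim alpha (h i) x.
have ic i : mu.-integrable setT (EFin \o (fun x => b i *
    (phi x * (p x * Ure alpha (h i) x + q x * Uim alpha (h i) x)))).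
  exact: (integrableZl measurableT _ (integrable_spectral_prod alpha0 phi_ge0 iphi ih i mp mq ipq)).
have [i1 e1] := Rintegral_sum (mu := mu) measurableT (index_enum 'I_N) ic.
have i2 : mu.-integrable setT (EFin \o (fun x => phi x * (u x ^+ 2 + v x ^+ 2))).
  have mU i := measurable_Ure alpha0 (ih i); have mU' i := measurable_Uim alpha0 (ih i).
  pose C := \sum_(i < N) `|b i| * (expR (- alpha) * weight_norm alpha (h i)).
  have sq (w : R) : `|w| <= C -> w ^+ 2 <= C ^+ 2.
    by move=> wC; rewrite -(real_normK (num_real w)) ler_sqr// nnegrE// (le_trans _ wC).
  apply: (integrable_mulr_bounded measurableT (C ^+ 2 + C ^+ 2)) => //.
    apply: measurable_funD; apply: measurable_funX; apply: measurable_sum => i;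
    apply: measurable_funM => //; [exact: mU|exact: mU'].
  move=> x _; rewrite ger0_norm ?addr_ge0 ?sqr_ge0// lerD// sq//.
    apply: (le_trans (ler_norm_sum _ _ _)); apply: ler_sum => i _.
    by rewrite normrM ler_wpM2l// Ure_bound.
  apply: (le_trans (ler_norm_sum _ _ _)); apply: ler_sum => i _.
  by rewrite normrM ler_wpM2l// Uim_bound.
have E x : phi x * ((a * p x + 2 * u x) ^+ 2 + (a * q x + 2 * v x) ^+ 2) =
   a ^+ 2 * (phi x * (p x ^+ 2 + q x ^+ 2)) +
   4 * a * (\sum_(i < N) b i * (phi x * (p x * Ure alpha (h i) x + q x * Uim alpha (h i) x))) +
   4 * (phi x * (u x ^+ 2 + v x ^+ 2)).
  have -> : \sum_(i < N) b i * (phi x * (p x * Ure alpha (h i) x + q x * Uim alpha (h i) x)) =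
      phi x * (p x * u x + q x * v x).
    rewrite /u /v !mulr_sumr -big_split mulr_sumr; apply: eq_bigr => i _ /=; ring.
  ring.
under eq_Rintegral do rewrite -/(u _) -/(v _) E.
have j1 := integrableZl measurableT (a ^+ 2) ipq.
have j2 := integrableZl measurableT (4 * a) i1.
have j3 := integrableZl measurableT 4 i2.
rewrite RintegralD//; last exact: (integrableD measurableT j1 j2).
rewrite RintegralD// !RintegralZl// e1.
have -> : \sum_(i < N) \int[mu]_x (b i * (phi x * (p x * Ure alpha (h i) x + q x * Uim alpha (h i) x)))
   = \sum_(i < N) b i * cross_cov i.
  apply: eq_bigr => i _; rewrite RintegralZl//.
  exact: (integrable_spectral_prod alpha0 phi_ge0 iphi ih i mp mq ipq).
by rewrite -/(u _) /u /v; field.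
Qed.

(** The normal equations gram c = cross_cov cancel the cross term of the quadratic
form of (X - c.Y, Y), which is the symmetry asked by [gaussian_regression]. *)
Lemma wiener_filter (c : 'I_N -> R) :
  (forall i, \sum_(j < N) gram alpha sigma phi h i j * c j = cross_cov i) ->
  is_cond_exp P (sigma_family setT Y) X (fun w => \sum_(i < N) c i * Y i w).
Proof.
move=> Gc; apply: (gaussian_regression iX iY output_char) => a b.
rewrite !output_spec_varE.
pose B (x y : 'I_N -> R) := \sum_(i < N) \sum_(j < N) x i * y j * gram alpha sigma phi h i j.
have Br x : B x c = \sum_(i < N) x i * cross_cov i.
  rewrite /B; apply: eq_bigr => i _; rewrite -Gc mulr_sumr.
  by apply: eq_bigr => j _; ring.
have BC x y : B x y = B y x.
  rewrite /B exchange_big /=; apply: eq_bigr => i _; apply: eq_bigr => j _.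
  by rewrite gramC; ring.
have BL (x z y : 'I_N -> R) t : B (fun i => x i + t * z i) y = B x y + t * B z y.
  rewrite /B mulr_sumr -big_split; apply: eq_bigr => i _ /=.
  rewrite mulr_sumr -big_split; apply: eq_bigr => j _ /=; ring.
have BQ t : B (fun i => b i + t * c i) (fun i => b i + t * c i) =
    B b b + 2 * t * B b c + t ^+ 2 * B c c.
  by rewrite BL (BC b) (BC c) !BL (BC c b); ring.
rewrite -!/(B _ _) -!Br BL.
have -> : (fun i => b i - a * c i) = (fun i => b i + (- a) * c i).
  by apply/funext => i; rewrite mulNr.
by rewrite BL !BQ; ring.
Qed.

End Filter.

(** * Gaussian families with a spectral covariance *)

(** Lebesgue measure is invariant under reflection. *)
Lemma Rintegral_opp (R : realType) (f : R -> R) :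
  (@lebesgue_measure R).-integrable setT (EFin \o f) ->
  (@lebesgue_measure R).-integrable setT (EFin \o (fun x => f (- x))) /\
  \int[@lebesgue_measure R]_x f (- x) = \int[@lebesgue_measure R]_x f x.
Proof.
move=> fi; set mu := @lebesgue_measure R.
have mEf : measurable_fun setT (EFin \o f : measurableTypeR R -> \bar R) by exact: measurable_int fi.
have mf : measurable_fun setT (f : measurableTypeR R -> R) by exact/measurable_EFinP.
have mN : measurable_fun setT (-%R : measurableTypeR R -> measurableTypeR R).
  exact: oppr_measurable.
have muN A : measurable A -> mu A = pushforward mu (-%R : measurableTypeR R -> measurableTypeR R) A.
  by move=> mA; rewrite lebesgue_measureN.
have i1 : mu.-integrable setT (EFin \o (fun x => f (- x))).
  apply/integrableP; split; first by apply: (measurableT_comp mEf mN).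
  move/integrableP : (fi) => [_]; apply: le_lt_trans.
  rewrite [leRHS](eq_measure_integral (pushforward mu (-%R : measurableTypeR R -> measurableTypeR R))); last first.
    by move=> A mA _; exact: muN.
  rewrite ge0_integral_pushforward//.
  exact: measurableT_comp.
split => //; rewrite /Rintegral; congr fine.
rewrite [RHS](eq_measure_integral (pushforward mu (-%R : measurableTypeR R -> measurableTypeR R))); last first.
  by move=> A mA _; exact: muN.
by rewrite (integral_pushforward mN mEf).
Qed.

Section GaussianFamily.
Context d (Omega : measurableType d) (R : realType) (P : probability Omega R).
Notation mu := (@lebesgue_measure R).
Variables (I : Type) (D : set I) (X : I -> Omega -> R).
Variables (phi : R -> R) (p q : I -> R -> R).
Hypothesis phi_ge0 : forall x, 0 <= phi x.
Hypothesis mphi : measurable_fun setT phi.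
Hypothesis mp : forall i, D i -> measurable_fun setT (p i).
Hypothesis mq : forall i, D i -> measurable_fun setT (q i).
Hypothesis ipq : forall i, D i ->
  mu.-integrable setT (EFin \o (fun x => phi x * (p i x ^+ 2 + q i x ^+ 2))).
Hypothesis gX : centered_gaussian_family P D X.
(* X i is represented by p i + j q i. *)
Hypothesis covX : forall i j, D i -> D j ->
  \int[P]_w (X i w * X j w) =
  2^-1 * \int[mu]_x (phi x * (p i x * p j x + q i x * q j x)).

Let X2 i : D i -> measurable_fun setT (X i) /\
  P.-integrable setT (EFin \o (fun w => X i w ^+ 2)).
Proof.
by move=> Di; have [s gs] := gaussian_family1 gX Di; have [] := gaussian_moment2 gs; case: gs.
Qed.

Let ipp i j : D i -> D j ->
  mu.-integrable setT (EFin \o (fun x => phi x * (p i x * p j x + q i x * q j x))).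
Proof.
move=> Di Dj; have mpi := mp Di; have mpj := mp Dj; have mqi := mq Di; have mqj := mq Dj.
apply: (integrable_dom (mu := mu) measurableT (fun x => phi x * (p i x ^+ 2 + q i x ^+ 2) +
   phi x * (p j x ^+ 2 + q j x ^+ 2))).
- by apply: measurable_funM => //; apply: measurable_funD; exact: measurable_funM.
- move=> x _; rewrite normrM (ger0_norm (phi_ge0 x)) -mulrDr ler_wpM2l//.
  have am (u v : R) : `|u * v| <= u ^+ 2 + v ^+ 2.
    rewrite normrM -(real_normK (num_real u)) -(real_normK (num_real v)).
    by have := sqr_ge0 (`|u| - `|v|); have := normr_ge0 u; have := normr_ge0 v; nra.
  apply: (le_trans (ler_normD _ _)).
  by have := am (p i x) (p j x); have := am (q i x) (q j x); lra.
- exact: (integrableD measurableT (ipq Di) (ipq Dj)).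
Qed.

Lemma lincomb_moment2 (m : nat) (i : nat -> I) (c : nat -> R) : (forall k, D (i k)) ->
  \int[P]_w ((\sum_(k < m) c k * X (i k) w) ^+ 2) =
  spec_var phi (fun x => \sum_(k < m) c k * p (i k) x) (fun x => \sum_(k < m) c k * q (i k) x).
Proof.
move=> Di; rewrite /spec_var.
have E1 w : (\sum_(k < m) c k * X (i k) w) ^+ 2 =
    \sum_(k < m) \sum_(l < m) c k * c l * (X (i k) w * X (i l) w).
  rewrite expr2 mulr_suml; apply: eq_bigr => k _; rewrite mulr_sumr.
  by apply: eq_bigr => l _; ring.
have E2 x : phi x * ((\sum_(k < m) c k * p (i k) x) ^+ 2 + (\sum_(k < m) c k * q (i k) x) ^+ 2) =
    \sum_(k < m) \sum_(l < m) c k * c l * (phi x * (p (i k) x * p (i l) x + q (i k) x * q (i l) x)).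
  rewrite !expr2 !mulr_suml -big_split mulr_sumr; apply: eq_bigr => k _ /=.
  rewrite !mulr_sumr -big_split mulr_sumr; apply: eq_bigr => l _ /=.
  by ring.
under eq_Rintegral do rewrite E1.
under [in RHS]eq_Rintegral do rewrite E2.
have iX k l : P.-integrable setT (EFin \o (fun w => X (i k) w * X (i l) w)).
  have [m1 i1] := X2 (Di k); have [m2 i2] := X2 (Di l).
  exact: integrable_prod.
have iX' (k l : 'I_m) := integrableZl measurableT (c k * c l) (iX k l).
have s1 (k : 'I_m) := Rintegral_sum measurableT (index_enum 'I_m) (iX' k).
have [_ ->] := Rintegral_sum measurableT (index_enum 'I_m) (fun k => (s1 k).1).
have ip' (k l : 'I_m) := integrableZl measurableT (c k * c l) (ipp (Di k) (Di l)).
have s2 (k : 'I_m) := Rintegral_sum (mu := mu) measurableT (index_enum 'I_m) (ip' k).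
have [_ ->] := Rintegral_sum (mu := mu) measurableT (index_enum 'I_m) (fun k => (s2 k).1).
rewrite mulr_sumr; apply: eq_bigr => k _.
rewrite (s1 k).2 (s2 k).2 mulr_sumr; apply: eq_bigr => l _.
rewrite (RintegralZl _ measurableT (iX k l)).
rewrite (RintegralZl _ measurableT (ipp (Di k) (Di l))).
by rewrite covX// mulrCA.
Qed.

Variables (N : nat) (sigma : R) (e : 'I_N -> Omega -> R).
Hypothesis e_gauss : forall i, centered_gaussian P (e i) sigma.
Hypothesis e_indep : mutually_independent P e.
Hypothesis e_indep_X : independent_salgebras P (sigma_family setT e) (sigma_family D X).

(** The combination of the family is Gaussian, and its variance is its second
moment; the noise is independent of it and contributes sigma^2 |b|^2. *)
Lemma family_noise_char (m : nat) (i : nat -> I) (c : nat -> R) (b : 'I_N -> R) th :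
  (forall k, D (i k)) ->
  \int[P]_w cos (\sum_(k < m) c k * X (i k) w + \sum_(l < N) b l * e l w + th) =
  cos th * expR (- ((spec_var phi (fun x => \sum_(k < m) c k * p (i k) x)
                                  (fun x => \sum_(k < m) c k * q (i k) x)
                     + sigma ^+ 2 * \sum_(l < N) b l ^+ 2) / 2)).
Proof.
move=> Di.
have [s gs] := gX (fun k : 'I_m => c k) (fun k : 'I_m => Di k).
have [_ s2] := gaussian_moment2 gs.
rewrite -lincomb_moment2// s2.
rewrite (_ : expR _ = expR (- (s ^+ 2 / 2)) *
    expR (- (sigma ^+ 2 * (\sum_(l < N) b l ^+ 2) / 2))); last first.
  by rewrite -expRD; congr expR; ring.
have me l : measurable_fun setT (e l) by have [] := e_gauss l.
apply: (cos_indep (P := P) (S := fun w => \sum_(k < m) c k * X (i k) w)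
  (T := fun w => \sum_(l < N) b l * e l w)).
- by apply: measurable_sum => k; apply: measurable_funM => //; have [] := X2 (Di k).
- by apply: measurable_sum => l; exact: measurable_funM.
- move=> A B mA mB; rewrite setIC muleC; apply: e_indep_X.
    exact: (@sigma_family_lincomb _ _ _ _ _ _ _ _ predT b id).
  exact: (@sigma_family_lincomb _ _ _ _ _ _ _ _ predT (fun k : 'I_m => c k) (fun k : 'I_m => i k)).
- move=> th'; have := gaussian_cos 1 th' gs.
  by under eq_Rintegral do rewrite mul1r; rewrite expr1n mulr1.
- by move=> th'; exact: cos_gaussian_sum.
Qed.

(* X' and g are, up to null sets, combinations of the family.  Two members suffice
   for X': the pairing of the white noise with f and with its reflection. *)
Variables (alpha : R) (g : R -> Omega -> R) (iota : R -> I) (kappa : R -> R).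
Variables (X' : Omega -> R) (i1 i2 : I) (a1 a2 : R).
Hypotheses (Di1 : D i1) (Di2 : D i2).
Hypothesis Diota : forall t, 0 <= t -> D (iota t).
Hypothesis mX' : measurable_fun setT X'.
Hypothesis mg : forall t, 0 <= t -> measurable_fun setT (g t).
Hypothesis X'E : {ae P, forall w, X' w = a1 * X i1 w + a2 * X i2 w}.
Hypothesis gE : forall t, 0 <= t -> {ae P, forall w, g t w = kappa t * X (iota t) w}.
Hypothesis pE : forall t x, 0 <= t -> kappa t * p (iota t) x = expR (alpha * t) * cos (x * t).
Hypothesis qE : forall t x, 0 <= t -> kappa t * q (iota t) x = expR (alpha * t) * sin (x * t).

Lemma family_process_char (m : nat) (c tau : nat -> R) (a : R) (b : 'I_N -> R) (th : R) :
  (forall k, 0 <= tau k) ->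
  \int[P]_w cos (a * X' w + \sum_(k < m) c k * g (tau k) w + \sum_(i < N) b i * e i w + th) =
  cos th * expR (- ((spec_var phi
     (fun x => a * (a1 * p i1 x + a2 * p i2 x) +
        \sum_(k < m) c k * (expR (alpha * tau k) * cos (x * tau k)))
     (fun x => a * (a1 * q i1 x + a2 * q i2 x) +
        \sum_(k < m) c k * (expR (alpha * tau k) * sin (x * tau k)))
   + sigma ^+ 2 * \sum_(i < N) b i ^+ 2) / 2)).
Proof.
move=> tau0.
(* Indices 0 and 1 carry X', the following ones carry g. *)
pose i k := if k is k'.+1 then if k' is k''.+1 then iota (tau k'') else i2 else i1.
pose c' k := if k is k'.+1 then if k' is k''.+1 then c k'' * kappa (tau k'') else a * a2 else a * a1.
have Di k : D (i k) by case: k => [|[|k]] //=; exact: Diota.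
have SE (V : I -> R) : \sum_(k < m.+2) c' k * V (i k) =
    a * (a1 * V i1 + a2 * V i2) + \sum_(k < m) c k * (kappa (tau k) * V (iota (tau k))).
  rewrite !big_ord_recl /= addrA; congr (_ + _); first by ring.
  by apply: eq_bigr => k _; rewrite mulrA.
have := family_noise_char m.+2 c' b th Di.
have -> : (fun x => \sum_(k < m.+2) c' k * p (i k) x) =
   (fun x => a * (a1 * p i1 x + a2 * p i2 x) +
        \sum_(k < m) c k * (expR (alpha * tau k) * cos (x * tau k))).
  apply/funext => x; rewrite (SE (fun j => p j x)); congr (_ + _).
  by apply: eq_bigr => k _; rewrite pE.
have -> : (fun x => \sum_(k < m.+2) c' k * q (i k) x) =
   (fun x => a * (a1 * q i1 x + a2 * q i2 x) +
        \sum_(k < m) c k * (expR (alpha * tau k) * sin (x * tau k))).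
  apply/funext => x; rewrite (SE (fun j => q j x)); congr (_ + _).
  by apply: eq_bigr => k _; rewrite qE.
move=> <-; rewrite /Rintegral; congr fine.
have me l : measurable_fun setT (e l) by have [] := e_gauss l.
have mcos : measurable_fun setT (@cos R) by exact: continuous_measurable_fun (@continuous_cos R).
have mE : measurable_fun setT (fun w => \sum_(l < N) b l * e l w).
  by apply: measurable_sum => l; exact: measurable_funM.
apply: ae_eq_integral => //.
- apply/measurable_EFinP; apply: (measurableT_comp mcos); apply: measurable_funD => //.
  apply: measurable_funD => //; apply: measurable_funD; first exact: measurable_funM.
  by apply: measurable_sum => k; apply: measurable_funM => //; exact: mg.
- apply/measurable_EFinP; apply: (measurableT_comp mcos); apply: measurable_funD => //.
  apply: measurable_funD => //.
  by apply: measurable_sum => k; apply: measurable_funM => //; have [] := X2 (Di k).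
have gE' : {ae P, forall w, forall k : nat, g (tau k) w = kappa (tau k) * X (iota (tau k)) w}.
  by apply/ae_foralln => k; exact: gE.
apply: filterS2 X'E gE' => w Xw gw _.
rewrite (SE (fun j => X j w)) Xw; congr (cos (_ + _ + _ + _))%:E.
by apply: eq_bigr => k _; rewrite gw.
Qed.

End GaussianFamily.

(** * Complex form of the estimator *)

Local Open Scope sesquilinear_scope.

Section ComplexParts.
Context (R : realType).
Implicit Types z w : R[i].

Lemma complex_Re_conj z : complex.Re (z^*%R) = complex.Re z.
Proof. by case: z. Qed.

Lemma complex_Im_conj z : complex.Im (z^*%R) = - complex.Im z.
Proof. by case: z. Qed.

Lemma complex_ReM z w : complex.Re (z * w) = complex.Re z * complex.Re w - complex.Im z * complex.Im w.
Proof. by case: z => a b; case: w. Qed.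

Lemma complex_ImM z w : complex.Im (z * w) = complex.Re z * complex.Im w + complex.Im z * complex.Re w.
Proof. by case: z => a b; case: w. Qed.

Lemma complex_ReD z w : complex.Re (z + w) = complex.Re z + complex.Re w.
Proof. by case: z => a b; case: w. Qed.

Lemma complex_ImD z w : complex.Im (z + w) = complex.Im z + complex.Im w.
Proof. by case: z => a b; case: w. Qed.

Lemma complex_Re_sum (I : Type) (s : seq I) (F : I -> R[i]) :
  complex.Re (\sum_(i <- s) F i) = \sum_(i <- s) complex.Re (F i).
Proof. by elim: s => [|i s IH]; rewrite ?big_nil// !big_cons complex_ReD IH. Qed.

Lemma complex_Im_sum (I : Type) (s : seq I) (F : I -> R[i]) :
  complex.Im (\sum_(i <- s) F i) = \sum_(i <- s) complex.Im (F i).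
Proof. by elim: s => [|i s IH]; rewrite ?big_nil// !big_cons complex_ImD IH. Qed.

Lemma half_real : (2^-1 : R[i]) = (2^-1 : R)%:C.
Proof. by rewrite fmorphV rmorph_nat. Qed.

Lemma two_real : (2 : R[i]) = (2 : R)%:C.
Proof. by rewrite rmorph_nat. Qed.

Lemma complex_eq z w : complex.Re z = complex.Re w -> complex.Im z = complex.Im w -> z = w.
Proof. by case: z => a b; case: w => c d /= -> ->. Qed.

End ComplexParts.

Section ComplexModel.
Context (R : realType).
Notation mu := (@lebesgue_measure R).
Notation D := (`[0, +oo[%classic : set R).
Variables (N : nat) (alpha0 sigma : R) (phi1 u : R -> R).
Hypothesis halpha0 : alpha0 < 0.
Hypothesis phi1_ge0 : forall x, 0 <= phi1 x.
Hypothesis phi1_even : forall x, phi1 (- x) = phi1 x.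
Hypothesis phi1_int : mu.-integrable setT (EFin \o phi1).

Definition input_at (i : 'I_N) (s : R) : R := u (i.+1%:R - s).
Notation h := input_at.
Hypothesis ih : forall i, mu.-integrable D (EFin \o (fun s => expR (alpha0 * s) * h i s)).

Notation A i := (Ure alpha0 (h i)).
Notation B i := (Uim alpha0 (h i)).
Notation G := (gram alpha0 sigma phi1 h).

Lemma UfreqE x i j : Ufreq N alpha0 u x i j = A i x +i* B i x.
Proof.
rewrite mxE half_real; apply: complex_eq; rewrite ?complex_ReM ?complex_ImM /= mul0r ?subr0 ?addr0;
congr (_ * _); apply: eq_Rintegral => s _; rewrite mxE /h /=; ring.
Qed.

Lemma integrable_odd_gram i j : mu.-integrable setT
  (EFin \o (fun x => phi1 x * (B i x * A j x - A i x * B j x))).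
Proof.
apply: (integrable_ext (mu := mu) measurableT
    (fun x => phi1 x * (B i x * A j x + (-1 * A i x) * B j x))).
  by move=> x _; ring.
have mA k := measurable_Ure halpha0 (ih k); have mB k := measurable_Uim halpha0 (ih k).
apply: (integrable_spectral_prod halpha0 phi1_ge0 phi1_int ih) => //.
  by apply: measurable_funM.
apply: (integrable_ext (mu := mu) measurableT (fun x => phi1 x * (A i x ^+ 2 + B i x ^+ 2))).
  by move=> x _; ring.
exact: integrable_U_sqr.
Qed.

Lemma Rintegral_odd (f : R -> R) : mu.-integrable setT (EFin \o f) ->
  (forall x, f (- x) = - f x) -> \int[mu]_x f x = 0.
Proof.
move=> fi fodd; have [_] := Rintegral_opp fi.
under eq_Rintegral do rewrite fodd -mulN1r.
rewrite RintegralZl// mulN1r => H; lra.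
Qed.

(** The imaginary part of U_i conj(U_k) is odd, so it integrates to 0 against the even
function phi1. *)
Lemma VmatE : Vmat N alpha0 sigma phi1 u = map_mx (real_complex R) G.
Proof.
apply/matrixP => i j.
have UU x : (Ufreq N alpha0 u x *m (Ufreq N alpha0 u x) ^t*) i j =
    (A i x * A j x + B i x * B j x) +i* (B i x * A j x - A i x * B j x).
  have conjE k : ((Ufreq N alpha0 u x) ^t*) 0 k = (Ufreq N alpha0 u x k 0)^*%R.
    by rewrite !mxE.
  rewrite mxE big_ord1 conjE !UfreqE.
  by apply: complex_eq; rewrite ?complex_ReM ?complex_ImM complex_Re_conj complex_Im_conj /=; ring.
have E : cintegral mu setT (fun x =>
    (phi1 x)%:C * (Ufreq N alpha0 u x *m (Ufreq N alpha0 u x) ^t*) i j) =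
    (\int[mu]_x (phi1 x * (A i x * A j x + B i x * B j x)))%:C.
  apply: complex_eq => /=.
    by apply: eq_Rintegral => x _; rewrite UU complex_ReM /= mul0r subr0.
  transitivity (\int[mu]_x (phi1 x * (B i x * A j x - A i x * B j x))).
    by apply: eq_Rintegral => x _; rewrite UU complex_ImM /= mul0r addr0.
  apply: Rintegral_odd; first exact: integrable_odd_gram.
  move=> x; have A2 k := Ure_even alpha0 (h k) x; have B2 k := Uim_odd halpha0 (ih k) x.
  rewrite phi1_even !A2 !B2; ring.
rewrite [LHS]mxE [X in X + _]mxE E two_real !mxE.
by apply: complex_eq; case: eqP => _;
  rewrite ?mulr1n ?mulr0n ?complex_ReD ?complex_ImD ?complex_ReM ?complex_ImM /=; ring.
Qed.

Definition weights (y : 'I_N -> R) : 'cV[R]_N := invmx G *m \col_j y j.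

Lemma GpostE (y : 'I_N -> R) x :
  Gpost alpha0 sigma phi1 u (\col_(i < N) (y i)%:C) x =
  (phi1 x * \sum_i A i x * weights y i 0) +i* (- (phi1 x * \sum_i B i x * weights y i 0)).
Proof.
rewrite /Gpost VmatE -map_invmx.
have -> : \col_(i < N) (y i)%:C = map_mx (real_complex R) (\col_j y j).
  by apply/matrixP => i j; rewrite !mxE.
rewrite -mulmxA -map_mxM -/(weights y) mxE.
have conjE k : ((Ufreq N alpha0 u x) ^t*) 0 k = (Ufreq N alpha0 u x k 0)^*%R.
  by rewrite !mxE.
have E i : ((Ufreq N alpha0 u x) ^t*) 0 i * map_mx (real_complex R) (weights y) i 0 =
    (A i x * weights y i 0) +i* (- (B i x * weights y i 0)).
  rewrite conjE UfreqE mxE.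
  by apply: complex_eq; rewrite ?complex_ReM ?complex_ImM complex_Re_conj complex_Im_conj /=; ring.
apply: complex_eq; rewrite ?complex_ReM ?complex_ImM /= mul0r ?subr0 ?addr0 ?complex_Re_sum ?complex_Im_sum.
  by congr (_ * _); apply: eq_bigr => i _; rewrite E.
rewrite -mulrN; congr (_ * _); rewrite -sumrN.
by apply: eq_bigr => i _; rewrite E.
Qed.

End ComplexModel.

(** * Posterior means *)

Section Posterior.
Context d (Omega : measurableType d) (R : realType) (P : probability Omega R).
Notation mu := (@lebesgue_measure R).
Notation D := (`[0, +oo[%classic : set R).
Variables (N : nat) (alpha0 sigma : R) (phi1 u : R -> R).
Variables (g : R -> Omega -> R) (e : 'I_N -> Omega -> R).
Hypotheses (halpha0 : alpha0 < 0) (hsigma : 0 < sigma).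
Hypothesis phi1_ge0 : forall x, 0 <= phi1 x.
Hypothesis phi1_even : forall x, phi1 (- x) = phi1 x.
Hypothesis phi1_int : mu.-integrable setT (fun x => (phi1 x)%:E).
Hypothesis u_int : forall i : 'I_N, mu.-integrable D
  (fun s => (expR (alpha0 * s) * u (i.+1%:R - s))%:E).
Hypothesis g_meas : measurable_fun [set p : measurableTypeR R * Omega | 0 <= p.1]
  (fun p : measurableTypeR R * Omega => g p.1 p.2).
Hypothesis g_gauss : centered_gaussian_family P [set t : R | 0 <= t] g.
Hypothesis g_kernel : forall t s, 0 <= t -> 0 <= s ->
  ('E_P[fun w => (g t w * g s w)%R] = (K alpha0 phi1 t s)%:E)%E.
Hypothesis e_gauss : forall i, centered_gaussian P (e i) sigma.
Hypothesis e_indep : mutually_independent P e.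

Notation h := (input_at (N := N) u).
Notation A i := (Ure alpha0 (h i)).
Notation B i := (Uim alpha0 (h i)).
Notation G := (gram alpha0 sigma phi1 h).
Notation y w := (fun i => meas g u e i w).
Notation Ghat x w := (Gpost alpha0 sigma phi1 u (\col_(i < N) (meas g u e i w)%:C) x).
Notation sigma_y := (sigma_family setT (meas g u e)).

Let ih i : mu.-integrable D (EFin \o (fun s => expR (alpha0 * s) * h i s)) := u_int i.

Let G_unit : G \in unitmx.
Proof. exact: gram_unit. Qed.

(** Re \int phi1 f conj(U_i), for f = p + jq. *)
Definition pairing (p q : R -> R) (i : 'I_N) : R :=
  \int[mu]_x (phi1 x * (p x * A i x + q x * B i x)).

(** Common form of the two estimates: X and g are expressed in one Gaussian family
independent of the noise, and only the pairing of the representative of X with U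
matters.  By symmetry of the Gram matrix G, the regression coefficients G^-1 r applied
to y equal the weights G^-1 y applied to r. *)
Lemma posterior_mean (Di : Type) (D0 : set Di) (F : Di -> Omega -> R) (p q : Di -> R -> R)
    (iota : R -> Di) (kappa : R -> R) (X : Omega -> R) (i1 i2 : Di) (a1 a2 : R) (r : 'I_N -> R) :
  (forall i, D0 i -> measurable_fun setT (p i)) ->
  (forall i, D0 i -> measurable_fun setT (q i)) ->
  (forall i, D0 i -> mu.-integrable setT (EFin \o (fun x => phi1 x * (p i x ^+ 2 + q i x ^+ 2)))) ->
  centered_gaussian_family P D0 F ->
  (forall i j, D0 i -> D0 j -> \int[P]_w (F i w * F j w) =
     2^-1 * \int[mu]_x (phi1 x * (p i x * p j x + q i x * q j x))) ->
  independent_salgebras P (sigma_family setT e) (sigma_family D0 F) ->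
  D0 i1 -> D0 i2 -> (forall t, 0 <= t -> D0 (iota t)) ->
  (forall w, X w = a1 * F i1 w + a2 * F i2 w) ->
  (forall t, 0 <= t -> {ae P, forall w, g t w = kappa t * F (iota t) w}) ->
  (forall t x, 0 <= t -> kappa t * p (iota t) x = expR (alpha0 * t) * cos (x * t)) ->
  (forall t x, 0 <= t -> kappa t * q (iota t) x = expR (alpha0 * t) * sin (x * t)) ->
  (forall i, pairing (fun x => a1 * p i1 x + a2 * p i2 x)
                     (fun x => a1 * q i1 x + a2 * q i2 x) i = r i) ->
  is_cond_exp P sigma_y X (fun w => \sum_i weights alpha0 sigma phi1 u (y w) i 0 * r i).
Proof.
move=> mp mq ipq gF covF indF D1 D2 Diota XE gE pE qE rE.
have iF i : D0 i -> P.-integrable setT (EFin \o F i).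
  by move=> Di0; have [s gs] := gaussian_family1 gF Di0; exact: gaussian_integrable gs.
have iX : P.-integrable setT (EFin \o X).
  apply: (integrable_ext measurableT (fun w => a1 * F i1 w + a2 * F i2 w)) => //.
  exact: (integrableD measurableT (integrableZl measurableT a1 (iF _ D1))
    (integrableZl measurableT a2 (iF _ D2))).
have mX : measurable_fun setT X by apply/measurable_EFinP; exact: measurable_int iX.
have mphi : measurable_fun setT phi1 by apply/measurable_EFinP; exact: measurable_int phi1_int.
have mP : measurable_fun setT (fun x => a1 * p i1 x + a2 * p i2 x).
  by apply: measurable_funD; apply: measurable_funM => //; exact: mp.
have mQ : measurable_fun setT (fun x => a1 * q i1 x + a2 * q i2 x).
  by apply: measurable_funD; apply: measurable_funM => //; exact: mq.
have iPQ : mu.-integrable setT (EFin \o (fun x => phi1 x *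
    ((a1 * p i1 x + a2 * p i2 x) ^+ 2 + (a1 * q i1 x + a2 * q i2 x) ^+ 2))).
  apply: (integrable_dom (mu := mu) measurableT
    (fun x => 2 * a1 ^+ 2 * (phi1 x * (p i1 x ^+ 2 + q i1 x ^+ 2)) +
              2 * a2 ^+ 2 * (phi1 x * (p i2 x ^+ 2 + q i2 x ^+ 2)))).
  - by apply: measurable_funM => //; apply: measurable_funD; exact: measurable_funX.
  - move=> x _; rewrite normrM (ger0_norm (phi1_ge0 x)) ger0_norm ?addr_ge0 ?sqr_ge0//.
    rewrite [leRHS](_ : _ = phi1 x * (2 * a1 ^+ 2 * (p i1 x ^+ 2 + q i1 x ^+ 2) +
       2 * a2 ^+ 2 * (p i2 x ^+ 2 + q i2 x ^+ 2))); last by ring.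
    rewrite ler_wpM2l//.
    have := sqr_ge0 (a1 * p i1 x - a2 * p i2 x); have := sqr_ge0 (a1 * q i1 x - a2 * q i2 x); nra.
  - exact: (integrableD measurableT (integrableZl measurableT _ (ipq _ D1))
      (integrableZl measurableT _ (ipq _ D2))).
have ig t : 0 <= t -> P.-integrable setT (EFin \o g t) by exact: integrable_process g_gauss t.
have gM t : 0 <= t -> \int[P]_w `|g t w| <= Num.sqrt (K1 phi1 0) * expR (alpha0 * t).
  exact: process_norm_le g_gauss g_kernel t.
have gc (s : R) (t : nat -> R) := process_L1_continuous phi1_ge0 phi1_int g_gauss g_kernel (s := s) (p := t).
have ie i : P.-integrable setT (EFin \o e i) by exact: gaussian_integrable (e_gauss i).
have mg t : 0 <= t -> measurable_fun setT (g t) by exact: measurable_process g_gauss t.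
have XEae : {ae P, forall w, X w = a1 * F i1 w + a2 * F i2 w} by exact: aeW.
have charH := family_process_char phi1_ge0 mphi mp mq ipq gF covF e_gauss e_indep indF
  D1 D2 Diota mX mg XEae gE pE qE.
pose c : 'cV[R]_N := invmx G *m \col_i r i.
have Gc i : \sum_(j < N) G i j * c j 0 =
    cross_cov alpha0 phi1 h (fun x => a1 * p i1 x + a2 * p i2 x) (fun x => a1 * q i1 x + a2 * q i2 x) i.
  rewrite /cross_cov -/(pairing _ _ i) rE.
  have : (G *m c) i 0 = r i by rewrite /c mulKVmx// mxE.
  by rewrite mxE.
have := wiener_filter halpha0 phi1_ge0 phi1_int ih g_meas ig gM gc ie iX mP mQ iPQ charH Gc.
rewrite (_ : (fun w => \sum_(i < N) c i 0 * _) =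
  (fun w => \sum_i weights alpha0 sigma phi1 u (y w) i 0 * r i))//.
apply/funext => w; rewrite /weights /c.
have GT : G^T = G by apply/matrixP => i j; rewrite mxE gramC.
pose yv : 'cV[R]_N := \col_j meas g u e j w; pose rv : 'cV[R]_N := \col_j r j.
transitivity (((invmx G *m rv)^T *m yv) 0 0).
  by rewrite mxE; apply: eq_bigr => i _; rewrite !mxE.
transitivity (((invmx G *m yv)^T *m rv) 0 0); last first.
  by rewrite mxE; apply: eq_bigr => i _; rewrite !mxE.
have <- : ((invmx G *m rv)^T *m yv)^T = (invmx G *m yv)^T *m rv.
  by rewrite [LHS]trmx_mul trmxK [in RHS]trmx_mul trmx_inv GT mulmxA.
by rewrite [RHS]mxE.
Qed.

(** The estimate is phi1 conj(U).w with real weights w, so its integral against f is a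
combination of the \int phi1 f conj(U_i), whose real and imaginary parts are the
pairings of f and of -jf. *)
Lemma cintegral_Ghat (p q : R -> R) w :
  measurable_fun setT p -> measurable_fun setT q ->
  mu.-integrable setT (EFin \o (fun x => phi1 x * (p x ^+ 2 + q x ^+ 2))) ->
  cintegrable mu setT (fun x => (p x +i* q x) * Ghat x w) /\
  cintegral mu setT (fun x => (p x +i* q x) * Ghat x w) =
    (\sum_i weights alpha0 sigma phi1 u (y w) i 0 * pairing p q i) +i*
    (\sum_i weights alpha0 sigma phi1 u (y w) i 0 * pairing q (fun x => - p x) i).
Proof.
move=> mp mq ipq; set c := weights _ _ _ _ _.
have iq : mu.-integrable setT (EFin \o (fun x => phi1 x * (q x ^+ 2 + (- p x) ^+ 2))).
  apply: (integrable_ext (mu := mu) measurableT (fun x => phi1 x * (p x ^+ 2 + q x ^+ 2))) => //.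
  by move=> x _; ring.
have mNp : measurable_fun setT (fun x => - p x) by exact: measurableT_comp.
have lin (p' q' : R -> R) : measurable_fun setT p' -> measurable_fun setT q' ->
   mu.-integrable setT (EFin \o (fun x => phi1 x * (p' x ^+ 2 + q' x ^+ 2))) ->
   mu.-integrable setT (EFin \o (fun x => \sum_i c i 0 * (phi1 x * (p' x * A i x + q' x * B i x)))) /\
   \int[mu]_x (\sum_i c i 0 * (phi1 x * (p' x * A i x + q' x * B i x))) =
   \sum_i c i 0 * pairing p' q' i.
  move=> mp' mq' ipq'.
  have i1 i := integrable_spectral_prod halpha0 phi1_ge0 phi1_int ih i mp' mq' ipq'.
  have i2 i := integrableZl measurableT (c i 0) (i1 i).
  have [i3 ->] := Rintegral_sum (mu := mu) measurableT (index_enum 'I_N) i2.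
  split => //; apply: eq_bigr => i _.
  by rewrite (RintegralZl _ measurableT (i1 i)).
have [ir er] := lin p q mp mq ipq.
have [ii ei] := lin q (fun x => - p x) mq mNp iq.
have Re_E x : complex.Re ((p x +i* q x) * Ghat x w) =
    \sum_i c i 0 * (phi1 x * (p x * A i x + q x * B i x)).
  rewrite GpostE// complex_ReM /= mulrN opprK -/c !mulr_sumr -big_split.
  by apply: eq_bigr => i _ /=; ring.
have Im_E x : complex.Im ((p x +i* q x) * Ghat x w) =
    \sum_i c i 0 * (phi1 x * (q x * A i x + - p x * B i x)).
  rewrite GpostE// complex_ImM /= -/c mulrN -mulNr !mulr_sumr -big_split.
  by apply: eq_bigr => i _ /=; ring.
split; last by apply: complex_eq => /=; [rewrite -er|rewrite -ei];
  apply: eq_Rintegral => x _; rewrite ?Re_E ?Im_E.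
split.
  by apply: (integrable_ext (mu := mu) measurableT _ _ ir) => x _; rewrite Re_E.
by apply: (integrable_ext (mu := mu) measurableT _ _ ii) => x _; rewrite Im_E.
Qed.

Lemma is_cond_exp0 : is_cond_exp P sigma_y (fun=> 0) (fun=> 0).
Proof.
have i0 : P.-integrable setT (EFin \o (fun=> 0 : R)) by exact: finite_measure_integrable_cst.
split => //.
move=> C mC.
have := @sigma_family_lincomb _ Omega R _ setT (meas g u e) 'I_N [::] predT (fun=> 0) id C (fun _ _ => I) mC.
rewrite (_ : (fun w => _) = (fun=> 0))//.
by apply/funext => w; rewrite big_nil.
Qed.

Lemma measurable_cos_freq t : measurable_fun setT (fun x : R => cos (x * t)).
Proof.
apply: (measurableT_comp (continuous_measurable_fun (@continuous_cos R))).
exact: measurable_funM.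
Qed.

Lemma measurable_sin_freq t : measurable_fun setT (fun x : R => sin (x * t)).
Proof.
apply: (measurableT_comp (continuous_measurable_fun (@continuous_sin R))).
exact: measurable_funM.
Qed.

Lemma integrable_cis_freq t :
  mu.-integrable setT (EFin \o (fun x => phi1 x * (cos (x * t) ^+ 2 + sin (x * t) ^+ 2))).
Proof.
apply: (integrable_ext (mu := mu) measurableT phi1) => // x _.
by rewrite cos2Dsin2 mulr1.
Qed.

(** -j e^(jxt) conj(U_i(x)) has an odd real part; this makes the reconstructed g(t)
real. *)
Lemma pairing_cis_odd t i : pairing (fun x => sin (x * t)) (fun x => - cos (x * t)) i = 0.
Proof.
have is_ : mu.-integrable setT
    (EFin \o (fun x => phi1 x * (sin (x * t) ^+ 2 + (- cos (x * t)) ^+ 2))).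
  apply: (integrable_ext (mu := mu) measurableT phi1) => // x _.
  by rewrite sqrrN addrC cos2Dsin2 mulr1.
have mc := measurable_cos_freq t.
have mNc : measurable_fun setT (fun x : R => - cos (x * t)) by exact: measurableT_comp.
rewrite /pairing; apply: Rintegral_odd.
  exact: (integrable_spectral_prod halpha0 phi1_ge0 phi1_int ih i (measurable_sin_freq t) mNc is_).
move=> x; rewrite phi1_even Ure_even (Uim_odd halpha0 (ih i)) mulNr sinN cosN; ring.
Qed.

Lemma posterior_mean_process (e_indep_g : independent_salgebras P
    (sigma_family setT e) (sigma_family [set t : R | 0 <= t] g)) t : 0 <= t ->
  is_ccond_exp P sigma_y (fun w => (g t w)%:C)
    (fun w => (expR (alpha0 * t))%:C *
       cintegral mu setT (fun x => Ghat x w * cis (x * t))).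
Proof.
move=> t0.
have IE w : cintegral mu setT (fun x => Ghat x w * cis (x * t)) =
    (\sum_i weights alpha0 sigma phi1 u (y w) i 0 *
       pairing (fun x => cos (x * t)) (fun x => sin (x * t)) i)%:C.
  have [_ H] := cintegral_Ghat w (measurable_cos_freq t) (measurable_sin_freq t) (integrable_cis_freq t).
  rewrite (_ : (fun x => Ghat x w * cis (x * t)) =
    (fun x => (cos (x * t) +i* sin (x * t)) * Ghat x w)); last first.
    by apply/funext => x; rewrite mulrC.
  rewrite H; apply: complex_eq => //=.
  by rewrite big1// => i _; rewrite pairing_cis_odd mulr0.
split; last first.
  rewrite (_ : (fun w => complex.Im (_ * _)) = fun=> 0); first exact: is_cond_exp0.
  by apply/funext => w; rewrite IE complex_ImM /= mulr0 mul0r addr0.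
rewrite (_ : (fun w => complex.Re (_ * _)) = (fun w =>
   \sum_i weights alpha0 sigma phi1 u (y w) i 0 *
     (expR (alpha0 * t) * pairing (fun x => cos (x * t)) (fun x => sin (x * t)) i))); last first.
  apply/funext => w; rewrite IE complex_ReM /= mul0r subr0 mulr_sumr.
  by apply: eq_bigr => i _; rewrite mulrCA.
apply: (posterior_mean (D0 := [set t : R | 0 <= t]) (F := g)
  (p := fun s x => expR (alpha0 * s) * cos (x * s))
  (q := fun s x => expR (alpha0 * s) * sin (x * s))
  (iota := id) (kappa := fun=> 1) (i1 := t) (i2 := t) (a1 := 1) (a2 := 0)) => //.
- by move=> s _; apply: measurable_funM => //; exact: measurable_cos_freq.
- by move=> s _; apply: measurable_funM => //; exact: measurable_sin_freq.
- move=> s _; apply: (integrable_ext (mu := mu) measurableT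
    (fun x => expR (alpha0 * s) ^+ 2 * phi1 x)); last exact: (integrableZl _ _ phi1_int).
  by move=> x _; rewrite !exprMn -mulrDr cos2Dsin2 mulr1 mulrC.
- move=> s s' s0 s'0; have [_ ->] := process_covariance g_gauss g_kernel s0 s'0.
  rewrite /K /K1 mulrCA; congr (_ * _); rewrite -RintegralZl//.
    by apply: eq_Rintegral => x _; rewrite mulrBr cosB mulrDr expRD; ring.
  apply: (integrable_mulr_bounded measurableT 1) => //; first exact: measurable_cos_freq.
  by move=> x _; exact: cos_max.
- by move=> w; rewrite mul1r mul0r addr0.
- by move=> s _; apply: aeW => w; rewrite mul1r.
- by move=> s x _; rewrite mul1r.
- by move=> s x _; rewrite mul1r.
- move=> i; rewrite /pairing -RintegralZl//.
    by apply: eq_Rintegral => x _; ring.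
  exact: (integrable_spectral_prod halpha0 phi1_ge0 phi1_int ih i (measurable_cos_freq t)
    (measurable_sin_freq t) (integrable_cis_freq t)).
Qed.

Section WhiteNoise.
Variable c1 : gen_process Omega R.
Hypothesis c1_noise : complex_white_noise P phi1 c1.
Hypothesis c1_sum : dense_sum P alpha0 c1 g.
Hypothesis e_indep_c : independent_salgebras P (sigma_family setT e)
  (sigma_family [set p | test_fun phi1 p.1] (re_im c1)).

Let T0 : set ((R -> R[i]) * bool) := [set p | test_fun phi1 p.1].

(** Real and imaginary parts of the representative of [re_im c1 z]: the function f
itself for Re (c1 f), and -jf for Im (c1 f) = Re (c1 (-jf)). *)
Definition noise_re (z : (R -> R[i]) * bool) (x : R) : R :=
  if z.2 then complex.Re (z.1 x) else complex.Im (z.1 x).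

Definition noise_im (z : (R -> R[i]) * bool) (x : R) : R :=
  if z.2 then complex.Im (z.1 x) else - complex.Re (z.1 x).

Let cgauss : centered_gaussian_family P T0 (re_im c1).
Proof. by case: c1_noise. Qed.

Let cX2 z : T0 z -> measurable_fun setT (re_im c1 z) /\
  P.-integrable setT (EFin \o (fun w => re_im c1 z w ^+ 2)).
Proof.
by move=> Dz; have [s gs] := gaussian_family1 cgauss Dz; have [] := gaussian_moment2 gs; case: gs.
Qed.

Let cXX z z' : T0 z -> T0 z' ->
  P.-integrable setT (EFin \o (fun w => re_im c1 z w * re_im c1 z' w)).
Proof. by move=> /cX2[m1 i1] /cX2[m2 i2]; exact: integrable_prod. Qed.

(** E[c conj(c')] and E[c c'] are, up to signs, the sums and differences of the
covariances of the real and imaginary parts of c = c1 f and c' = c1 f'.  The second one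
vanishes, so each of these covariances is half of a part of the first one. *)
Lemma white_noise_cov z z' : T0 z -> T0 z' ->
  \int[P]_w (re_im c1 z w * re_im c1 z' w) =
  2^-1 * \int[mu]_x (phi1 x * (noise_re z x * noise_re z' x + noise_im z x * noise_im z' x)).
Proof.
case: z => f b; case: z' => f' b' Tf Tf'.
have [_ _ /(_ f f' Tf Tf') Cbar /(_ f f' Tf Tf') C0] := c1_noise.
have Tft b0 : T0 (f, b0) by []. have Tft' b0 : T0 (f', b0) by [].
pose E b1 b2 := \int[P]_w (re_im c1 (f, b1) w * re_im c1 (f', b2) w).
have iE b1 b2 := cXX (Tft b1) (Tft' b2).
have Eq1 : E true true + E false false =
    \int[mu]_x (phi1 x * (complex.Re (f x) * complex.Re (f' x) + complex.Im (f x) * complex.Im (f' x))).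
  have : \int[P]_w complex.Re (c1 f w * (c1 f' w)^*%R) =
    \int[mu]_x complex.Re (f x * (f' x)^*%R * (phi1 x)%:C) := congr1 (@complex.Re R) Cbar.
  under eq_Rintegral do rewrite complex_ReM complex_Re_conj complex_Im_conj mulrN opprK.
  rewrite RintegralD//; [|exact: (iE true true)|exact: (iE false false)].
  move=> ->; apply: eq_Rintegral => x _.
  by rewrite !complex_ReM !complex_ImM complex_Re_conj complex_Im_conj /=; ring.
have Eq2 : E true true - E false false = 0.
  have : \int[P]_w complex.Re (c1 f w * c1 f' w) = 0 := congr1 (@complex.Re R) C0.
  under eq_Rintegral do rewrite complex_ReM.
  by rewrite RintegralB//; [exact: (iE true true)|exact: (iE false false)].
have Eq3 : E false true - E true false =
    \int[mu]_x (phi1 x * (complex.Im (f x) * complex.Re (f' x) - complex.Re (f x) * complex.Im (f' x))).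
  have : \int[P]_w complex.Im (c1 f w * (c1 f' w)^*%R) =
    \int[mu]_x complex.Im (f x * (f' x)^*%R * (phi1 x)%:C) := congr1 (@complex.Im R) Cbar.
  under eq_Rintegral do rewrite complex_ImM complex_Re_conj complex_Im_conj mulrN addrC.
  rewrite RintegralB//; [|exact: (iE false true)|exact: (iE true false)].
  move=> ->; apply: eq_Rintegral => x _.
  by rewrite !complex_ImM !complex_ReM complex_Re_conj complex_Im_conj /=; ring.
have Eq4 : E false true + E true false = 0.
  have : \int[P]_w complex.Im (c1 f w * c1 f' w) = 0 := congr1 (@complex.Im R) C0.
  under eq_Rintegral do rewrite complex_ImM addrC.
  by rewrite RintegralD//; [exact: (iE false true)|exact: (iE true false)].
rewrite -/(E b b'); case: b b' Tf Tf' => -[] [[mr mi] iff] [[mr' mi'] iff']; rewrite /noise_re /noise_im /=.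
- by rewrite -Eq1; lra.
- transitivity (2^-1 * - (E false true - E true false)); first lra.
  rewrite Eq3 -mulN1r -RintegralZl//.
    by congr (_ * _); apply: eq_Rintegral => x _; ring.
  have mphi : measurable_fun setT phi1 by apply/measurable_EFinP; exact: measurable_int phi1_int.
  apply: (integrable_dom (mu := mu) measurableT _ _ _ (integrableD measurableT iff iff')).
    by apply: measurable_funM => //; apply: measurable_funB; exact: measurable_funM.
  move=> x _; rewrite -mulrDr normrM (ger0_norm (phi1_ge0 x)) ler_wpM2l//.
  rewrite ler_norml; apply/andP; split.
    have := sqr_ge0 (complex.Im (f x) + complex.Re (f' x)).
    have := sqr_ge0 (complex.Re (f x) - complex.Im (f' x)); nra.
  have := sqr_ge0 (complex.Im (f x) - complex.Re (f' x)).
  have := sqr_ge0 (complex.Re (f x) + complex.Im (f' x)); nra.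
- transitivity (2^-1 * (E false true - E true false)); first lra.
  by rewrite Eq3; congr (_ * _); apply: eq_Rintegral => x _; ring.
- transitivity (2^-1 * (E true true + E false false)); first lra.
  by rewrite Eq1; congr (_ * _); apply: eq_Rintegral => x _; ring.
Qed.

(** The reflected conjugate, through which conj(c1(-x)) enters the process G. *)
Definition flip (f : R -> R[i]) (x : R) : R[i] := (f (- x))^*%R.

Lemma test_fun_flip f : test_fun phi1 f -> test_fun phi1 (flip f).
Proof.
move=> [[mr mi] iff]; split; last first.
  have [i1 _] := Rintegral_opp iff.
  apply: (integrable_ext (mu := mu) measurableT _ _ i1) => x _.
  by rewrite phi1_even /flip complex_Re_conj complex_Im_conj sqrrN.
have mN : measurable_fun setT (-%R : R -> R) by exact: oppr_measurable.
have mr' : measurable_fun setT (fun x : R => complex.Re (f x)) := mr.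
have mi' : measurable_fun setT (fun x : R => complex.Im (f x)) := mi.
split.
  rewrite (_ : (fun x => _) = (fun x => complex.Re (f x)) \o -%R).
    exact: (measurableT_comp mr' mN).
  by apply/funext => x; rewrite /flip complex_Re_conj.
rewrite (_ : (fun x => _) = -%R \o ((fun x => complex.Im (f x)) \o -%R)).
  exact: (measurableT_comp mN (measurableT_comp mi' mN)).
by apply/funext => x; rewrite /flip complex_Im_conj.
Qed.

Lemma test_fun_cis t : test_fun phi1 (fun x => cis (x * t)).
Proof.
split; last exact: integrable_cis_freq.
by split; [exact: measurable_cos_freq|exact: measurable_sin_freq].
Qed.

(** Replacing f = p + jq by its reflected conjugate turns the integrand
phi1 Re (f conj(U_i)) into its reflection, because phi1 is even and
U(-x) = conj(U(x)). *)
Lemma pairing_symmetrize (p q : R -> R) i :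
  measurable_fun setT p -> measurable_fun setT q ->
  mu.-integrable setT (EFin \o (fun x => phi1 x * (p x ^+ 2 + q x ^+ 2))) ->
  pairing (fun x => 2^-1 * p x + 2^-1 * p (- x)) (fun x => 2^-1 * q x - 2^-1 * q (- x)) i =
  pairing p q i.
Proof.
move=> mp mq ipq.
pose F x := phi1 x * (p x * A i x + q x * B i x).
have i1 : mu.-integrable setT (EFin \o F).
  exact: (integrable_spectral_prod halpha0 phi1_ge0 phi1_int ih i mp mq ipq).
have [i2 e2] := Rintegral_opp i1.
have i3 : mu.-integrable setT (EFin \o (fun x => 2^-1 * F x)) by exact: (integrableZl _ _ i1).
have i4 : mu.-integrable setT (EFin \o (fun x => 2^-1 * F (- x))) by exact: (integrableZl _ _ i2).
transitivity (\int[mu]_x (2^-1 * F x + 2^-1 * F (- x))).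
  apply: eq_Rintegral => x _.
  by rewrite /F phi1_even Ure_even (Uim_odd halpha0 (ih i)); ring.
rewrite (RintegralD measurableT i3 i4).
rewrite (RintegralZl _ measurableT i1) (RintegralZl _ measurableT i2) e2 -/(pairing p q i).
by set z := pairing p q i; field.
Qed.

(** Re (\int f G) = (Re (c1 f) + Re (c1 f~)) / 2 and
Im (\int f G) = (Im (c1 f) - Im (c1 f~)) / 2, where f~ is the reflected conjugate of f.
Their representatives are the averages of f, resp. of -jf, with their own reflected
conjugates, the conjugate of -jf(-x) being j f~(x). *)
Lemma posterior_mean_G : is_gen_cond_exp P sigma_y phi1 (Gproc c1) (fun x w => Ghat x w).
Proof.
move=> f Tf; have [[mr mi] iff] := Tf.
have fE w : (fun x => f x * Ghat x w) =
    (fun x => (complex.Re (f x) +i* complex.Im (f x)) * Ghat x w).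
  by apply/funext => x; congr (_ * _); case: (f x).
have TF := test_fun_flip Tf.
have GE w : Gproc c1 f w = (c1 f w + (c1 (flip f) w)^*%R) / 2 by [].
have gen b X a2 r := @posterior_mean _ T0 (re_im c1) noise_re noise_im
  (fun t => ((fun x => cis (x * t)), true)) (fun t => expR (alpha0 * t)) X (f, b) (flip f, b)
  2^-1 a2 r.
have mre z : T0 z -> measurable_fun setT (noise_re z).
  by case: z => z [] [[mrz miz] _].
have mim z : T0 z -> measurable_fun setT (noise_im z).
  by case: z => z [] [[mrz miz] _] //; exact: measurableT_comp.
have ipq z : T0 z -> mu.-integrable setT
    (EFin \o (fun x => phi1 x * (noise_re z x ^+ 2 + noise_im z x ^+ 2))).
  case: z => z b [_ iz]; apply: (integrable_ext (mu := mu) measurableT _ _ iz) => x _.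
  by rewrite /noise_re /noise_im; case: b {iz} => /=; [|rewrite sqrrN addrC].
have gE t : 0 <= t -> {ae P, forall w, g t w =
    expR (alpha0 * t) * re_im c1 ((fun x => cis (x * t)), true) w} by exact: c1_sum.
have Dc t : 0 <= t -> T0 ((fun x => cis (x * t)), true) by move=> _; exact: test_fun_cis.
split.
  by move=> w; rewrite fE; have [] := cintegral_Ghat w mr mi iff.
have IE w : cintegral mu setT (fun x => f x * Ghat x w) =
    (\sum_i weights alpha0 sigma phi1 u (y w) i 0 *
       pairing (fun x => complex.Re (f x)) (fun x => complex.Im (f x)) i) +i*
    (\sum_i weights alpha0 sigma phi1 u (y w) i 0 *
       pairing (fun x => complex.Im (f x)) (fun x => - complex.Re (f x)) i).
  by rewrite fE; have [] := cintegral_Ghat w mr mi iff.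
have halfE (z : R[i]) : z / 2 = (2^-1)%:C * z by rewrite half_real mulrC.
have Dc1 b : T0 (f, b) by []. have Dc2 b : T0 (flip f, b) by [].
split.
  rewrite (_ : (fun w => complex.Re (cintegral _ _ _)) = (fun w =>
     \sum_i weights alpha0 sigma phi1 u (y w) i 0 *
       pairing (fun x => complex.Re (f x)) (fun x => complex.Im (f x)) i)); last first.
    by apply/funext => w; rewrite IE.
  apply: (gen true _ 2^-1) => //; first exact: white_noise_cov.
    move=> w; rewrite GE halfE complex_ReM complex_ReD complex_Re_conj /= mul0r subr0 mulrDr //.
  move=> i; rewrite -(pairing_symmetrize i mr mi iff).
  congr (pairing _ _ i); apply/funext => x; rewrite /noise_re /noise_im /flip /=.
    by rewrite complex_Re_conj.
  by rewrite complex_Im_conj mulrN.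
have mNr : measurable_fun setT (fun x => - complex.Re (f x)) by exact: measurableT_comp.
have iff' : mu.-integrable setT (EFin \o (fun x => phi1 x *
    (complex.Im (f x) ^+ 2 + (- complex.Re (f x)) ^+ 2))).
  by apply: (integrable_ext (mu := mu) measurableT _ _ iff) => x _; rewrite sqrrN addrC.
rewrite (_ : (fun w => complex.Im (cintegral _ _ _)) = (fun w =>
     \sum_i weights alpha0 sigma phi1 u (y w) i 0 *
       pairing (fun x => complex.Im (f x)) (fun x => - complex.Re (f x)) i)); last first.
  by apply/funext => w; rewrite IE.
apply: (gen false _ (- 2^-1)) => //; first exact: white_noise_cov.
  move=> w; rewrite GE halfE complex_ImM complex_ImD complex_Im_conj /= mul0r addr0 mulrDr mulrN mulNr//.
move=> i; rewrite -(pairing_symmetrize i mi mNr iff').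
congr (pairing _ _ i); apply/funext => x; rewrite /noise_re /noise_im /flip /=.
  by rewrite complex_Im_conj mulrNN.
by rewrite complex_Re_conj mulNr.
Qed.

End WhiteNoise.

End Posterior.

Theorem proposition4 (d : measure_display) (Omega : measurableType d)
    (R : realType) (P : probability Omega R) (N : nat)
    (alpha0 sigma : R) (phi1 u : R -> R)
    (g : R -> Omega -> R) (e : 'I_N -> Omega -> R)
    (halpha0 : alpha0 < 0) (hsigma : 0 < sigma)
    (phi1_ge0 : forall x, 0 <= phi1 x)
    (phi1_even : forall x, phi1 (- x) = phi1 x)
    (phi1_int : (@lebesgue_measure R).-integrable setT (fun x => (phi1 x)%:E))
    (u_int : forall i : 'I_N, (@lebesgue_measure R).-integrable `[0, +oo[
       (fun s => (expR (alpha0 * s) * u (i.+1%:R - s))%:E))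
    (g_meas : measurable_fun [set p : measurableTypeR R * Omega | 0 <= p.1]
       (fun p : measurableTypeR R * Omega => g p.1 p.2))
    (g_gauss : centered_gaussian_family P [set t : R | 0 <= t] g)
    (g_kernel : forall t s, 0 <= t -> 0 <= s ->
       ('E_P[fun w => (g t w * g s w)%R] = (K alpha0 phi1 t s)%:E)%E)
    (e_gauss : forall i, centered_gaussian P (e i) sigma)
    (e_indep : mutually_independent P e)
    (e_indep_g : independent_salgebras P
       (sigma_family setT e) (sigma_family [set t : R | 0 <= t] g)) :
  let sigma_y := sigma_family setT (meas g u e) in
  let yN := fun w => \col_(i < N) (meas g u e i w)%:C in
  let Ghat := fun x w => Gpost alpha0 sigma phi1 u (yN w) x in
  [/\ Vmat N alpha0 sigma phi1 u \in unitmx,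
      forall t, 0 <= t ->
        is_ccond_exp P sigma_y (fun w => (g t w)%:C)
          (fun w => (expR (alpha0 * t))%:C *
             cintegral (@lebesgue_measure R) setT
               (fun x => Ghat x w * cis (x * t))) &
      forall c1 : gen_process Omega R,
        complex_white_noise P phi1 c1 ->
        dense_sum P alpha0 c1 g ->
        independent_salgebras P (sigma_family setT e)
          (sigma_family [set p | test_fun phi1 p.1] (re_im c1)) ->
        is_gen_cond_exp P sigma_y phi1 (Gproc c1) Ghat].
Proof.
move=> sigma_y yN Ghat; split.
- rewrite (VmatE sigma halpha0 phi1_ge0 phi1_even phi1_int u_int) map_unitmx.
  exact: (gram_unit halpha0 phi1_ge0 phi1_int u_int hsigma).
- by move=> t t0; exact: posterior_mean_process.
- by move=> c1 c1_noise c1_sum e_indep_c; exact: posterior_mean_G.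
Qed.
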